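(* Let $(W,S)$ be a Coxeter system and $u,v\in W$ with $u\le v$. Then $$\widetilde F(u,v)=\sum_{\alpha}c_\alpha(u,v)\,M_\alpha=\sum_\alpha b_\alpha(u,v)\,L_\alpha,$$ the sums being over all compositions $\alpha$ (including the empty one). Moreover $\widetilde F(u,v)$ lies in the peak algebra $\Pi$; in fact $$\widetilde F(u,v)\in\Pi_{l(u,v)}\oplus\Pi_{l(u,v)-2}\oplus\Pi_{l(u,v)-4}\oplus\cdots.$$
   Context: Coxeter setting: $(W,S)$ Coxeter system, length $l$, reflections $T=\{wsw^{-1}\}$, Bruhat order $\le$, $l(u,v)=l(v)-l(u)$. The $R$-polynomials $R_{u,v}(q)$ are defined by $(T_{v^{-1}})^{-1}=q^{-l(v)}\sum_{u\le v}(-1)^{l(v)-l(u)}R_{u,v}(q)T_u$ in the Hecke algebra (free $\mathbb Z[q^{\pm1}]$-module on $T_w$, with $T_wT_s=T_{ws}$ if $l(ws)>l(w)$, $T_wT_s=qT_{ws}+(q-1)T_w$ otherwise). $\widetilde R_{u,v}\in\mathbb N[q]$ is the unique polynomial with $R_{u,v}(q)=q^{l(u,v)/2}\widetilde R_{u,v}(q^{1/2}-q^{-1/2})$. Paths: fix a reflection ordering $<_T$ (a total order on $T$ such that for every dihedral reflection subgroup with canonical generators $\{a,b\}$ one has $a<_Taba<_Tababa<_T\cdots<_Tbab<_Tb$ or the reverse). The Bruhat graph has vertex set $W$ and an edge $x\to y$ iff $yx^{-1}\in T$ and $l(x)<l(y)$; a Bruhat path $\Delta=(a_0,\dots,a_r)$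 is a directed path, of length $r$, with descent set $D(\Delta)=\{i\in[r-1]: a_ia_{i-1}^{-1}>_Ta_{i+1}a_i^{-1}\}$, and descent composition the composition of $r$ corresponding to $D(\Delta)$ under $\beta_1\cdots\beta_k\mapsto\{\beta_1,\beta_1+\beta_2,\dots,\beta_1+\cdots+\beta_{k-1}\}$. For compositions $\alpha,\beta$ of $n$, $\alpha\preceq\beta$ means $\alpha$ refines $\beta$. $b_\alpha(u,v)$ is the number of Bruhat paths from $u$ to $v$ of length $|\alpha|$ with descent composition equal to $\alpha$, and $c_\alpha(u,v)$ the number with descent composition $\succeq\alpha$ (for the empty composition both count paths of length $0$). Quasisymmetric functions: for a composition $\alpha=\alpha_1\cdots\alpha_k$, $M_\alpha=\sum_{i_1<\cdots<i_k}x_{i_1}^{\alpha_1}\cdots x_{i_k}^{\alpha_k}$ and $L_\beta=\sum_{\alpha\preceq\beta}M_\alpha$, with $M_\emptyset=L_\emptyset=1$; $L^{(n)}_T$ denotes $L_\beta$ for the composition $\beta$ of $n$ corresponding to $T\subseteq[n-1]$. Let ${\bf c},{\bf d}$ be noncommuting variables of degrees $1$ and $2$. For a ${\bf cd}$-word $w={\bf c}^{n_1}{\bf d}{\bf c}^{n_2}{\bf d}\cdots{\bf c}^{n_k}{\bf d}{\bf c}^{n_0}$ of degree $n$, let $m_j=\deg({\bf c}^{n_1}{\bf d}\cdots{\bf c}^{n_j}{\bf d})$, $\mathcal I^w=\{\{m_j-1,m_j\}:j=1,\dots,k\}$, $B[\mathcal I^w]=\{T\subseteq[n]: T\cap A\neq\emptyset\text{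 and }([n]\setminus T)\cap A\ne\emptyset\ \forall A\in\mathcal I^w\}$, and $\Theta_w=\sum_{T\in B[\mathcal I^w]}L^{(n+1)}_T$ (so $\Theta_{\bf 1}=L_1$ for the empty word). The peak algebra $\Pi$ is the span of $1$ and all $\Theta_w$, and $\Pi_i$ is its homogeneous part of degree $i$. The $R$-quasisymmetric function is $\widetilde F(u,v)=\sum\widetilde R_{u_0,u_1}(x_1)\widetilde R_{u_1,u_2}(x_2)\cdots\widetilde R_{u_{k-1},u_k}(x_k)$, summed over all $k\ge1$ and multichains $u=u_0\le u_1\le\cdots\le u_{k-1}<u_k=v$ (with the convention $\widetilde F(u,u)=1$). *)

(* Defs.v *)
From HB Require Import structures.
From mathcomp Require Import all_boot all_order all_fingroup all_algebra finmap.
From mathcomp Require Import boolp classical_sets functions cardinality fsbigop.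
From mathcomp Require Import monalg.

Set Implicit Arguments.
Unset Strict Implicit.
Unset Printing Implicit Defensive.

Import GRing.Theory.

Local Open Scope classical_set_scope.
Local Open Scope ring_scope.

(** * The ring Z[q, q^-1], as a subring of the fraction field of Z[q] *)

Definition is_laurent : {pred {fraction {poly int}}} :=
  fun x => `[< exists (p : {poly int}) (n : nat),
                 x = tofrac p / (tofrac 'X) ^+ n >].

Fact fracX_neq0 : tofrac ('X : {poly int}) != 0.
Proof. by rewrite tofrac_eq0 polyX_eq0. Qed.

Fact is_laurent_subring_closed : subring_closed is_laurent.
Proof.
split=> [|x y|x y]; first by apply/asboolP; exists 1, 0%N; rewrite expr0 divr1 tofrac1.
  move=> /asboolP[p [m ->]] /asboolP[r [n ->]].
  apply/asboolP; exists (p * 'X ^+ n - r * 'X ^+ m), (m + n)%N.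
  rewrite tofracB !tofracM !tofracXn exprD.
  rewrite mulrBl -!mulrA; congr (_ * _ - _ * _).
    by rewrite invfM mulrCA divff ?mulr1 // expf_neq0 ?fracX_neq0.
  by rewrite invfM mulrA divff ?mul1r // expf_neq0 ?fracX_neq0.
move=> /asboolP[p [m ->]] /asboolP[r [n ->]].
by apply/asboolP; exists (p * r), (m + n)%N; rewrite tofracM exprD invfM mulrACA.
Qed.

HB.instance Definition _ :=
  GRing.isSubringClosed.Build _ is_laurent is_laurent_subring_closed.

Record laurent : predArgType :=
  Laurent { laurent_val : {fraction {poly int}}; _ : laurent_val \in is_laurent }.

HB.instance Definition _ := [isSub for laurent_val].
HB.instance Definition _ := [Choice of laurent by <:].
HB.instance Definition _ := [SubChoice_isSubComNzRing of laurent by <:].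

Definition laurent_unit : {pred laurent} := fun x => `[< exists y, y * x = 1 >].
Definition laurent_inv (x : laurent) : laurent := xget x [set y | y * x = 1].

Fact laurent_mulV : {in laurent_unit, left_inverse 1 laurent_inv *%R}.
Proof. by move=> x /asboolP ex; apply: (xgetPex x ex). Qed.

Fact laurent_unitP x y : y * x = 1 -> laurent_unit x.
Proof. by move=> yx; apply/asboolP; exists y. Qed.

Fact laurent_inv_out : {in [predC laurent_unit], laurent_inv =1 id}.
Proof.
by move=> x /negP nx; apply: xgetPN => y yx; apply/nx/laurent_unitP/yx.
Qed.

HB.instance Definition _ := GRing.ComNzRing_hasMulInverse.Build laurent
  laurent_mulV laurent_unitP laurent_inv_out.

Fact laurentX_subproof : tofrac 'X \in is_laurent.
Proof. by apply/asboolP; exists 'X, 0%N; rewrite expr0 divr1. Qed.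

Definition lX : laurent := Laurent laurentX_subproof.

Lemma lX_unit : lX \is a GRing.unit.
Proof.
have invX : (tofrac 'X)^-1 \in is_laurent.
  by apply/asboolP; exists 1, 1%N; rewrite expr1 tofrac1 div1r.
apply: (@laurent_unitP _ (Laurent invX)); apply: val_inj.
by rewrite /= mulVf ?fracX_neq0.
Qed.

(** * Coxeter systems *)

Section Coxeter.
Local Open Scope group_scope.
Context {W : groupType}.
Implicit Types (S : set W) (s t u v w x y : W).

Definition expression S w (e : seq W) : Prop :=
  (forall s, s \in e -> S s) /\ \prod_(s <- e) s = w.

(* [m s t = 0] encodes [m(s,t) = oo]. *)
Definition coxeter_matrix S (m : W -> W -> nat) : Prop :=
  (forall s, S s -> m s s = 1%N) /\
  (forall s t, S s -> S t -> s <> t -> m s t = m t s /\ m s t <> 1%N).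

Definition coxeter_relations S (m : W -> W -> nat) (G : groupType) (f : W -> G) :=
  forall s t, S s -> S t -> (f s * f t) ^+ m s t = 1.

(* W is generated by S, and has the universal property of the group presented by
   the generators S subject to the relations (st)^m(s,t) = 1. *)
Definition coxeter_system S : Prop :=
  exists m : W -> W -> nat,
    [/\ coxeter_matrix S m,
        forall w, exists e, expression S w e,
        coxeter_relations S m id &
        forall (G : groupType) (f : W -> G), coxeter_relations S m f ->
          exists g : {multiplicative W -> G}, forall s, S s -> g s = f s].

Definition is_length S w (k : nat) : Prop :=
  (exists2 e, expression S w e & size e = k) /\
  (forall e, expression S w e -> (k <= size e)%N).

Definition len S w : nat := xget 0%N [set k | is_length S w k].

Definition len2 S u v : nat := (len S v - len S u)%N.

Definition reflections S : set W :=
  [set t | exists w, exists2 s, S s & t = w * s * w^-1].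

Definition bruhat_edge S x y : Prop :=
  reflections S (y * x^-1) /\ (len S x < len S y)%N.

(* The path u = a_0, a_1, ..., a_r = v is given by p = [:: a_1; ...; a_r]. *)
Definition bruhat_path S u v (p : seq W) : Prop :=
  path (fun x y => `[< bruhat_edge S x y >]) u p /\ last u p = v.

Definition bruhat_le S u v : Prop := exists p, bruhat_path S u v p.

(** * Reflection orderings *)

Definition is_subgroup (G : set W) : Prop :=
  [/\ G 1, forall x y, G x -> G y -> G (x * y) & forall x, G x -> G x^-1].

Definition generated (A : set W) : set W := smallest is_subgroup A.

Definition inversions S w : set W :=
  [set t | reflections S t /\ (len S (t * w) < len S w)%N].

(* Dyer's canonical generators of a reflection subgroup G. *)
Definition canonical_generators S (G : set W) : set W :=
  [set t | [/\ reflections S t, G t & inversions S t `&` G = [set t]]].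

(* The order of x exceeds n. *)
Definition order_gt x (n : nat) : Prop :=
  forall k, (0 < k <= n)%N -> x ^+ k <> 1.

(* a < aba < ababa < ... < babab < bab < b in the dihedral group <a, b>, whose
   reflections are (ab)^i a and (ba)^j b. If ab has finite order m, then
   (ab)^i a = (ba)^(m-1-i) b, and the first clause is the whole chain; if it has
   infinite order, the chain has an increasing part (first clause), which lies
   below (last clause) a decreasing part (second clause). *)
Definition dihedral_chain (lt : rel W) a b : Prop :=
  [/\ forall i j, (i < j)%N -> order_gt (a * b) j ->
        lt ((a * b) ^+ i * a) ((a * b) ^+ j * a),
      forall i j, (i < j)%N -> order_gt (a * b) j ->
        lt ((b * a) ^+ j * b) ((b * a) ^+ i * b) &
      forall i j, order_gt (a * b) (i + j).+1 ->
        lt ((a * b) ^+ i * a) ((b * a) ^+ j * b)].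

Definition reflection_order S (lt : rel W) : Prop :=
  [/\ forall t, reflections S t -> ~~ lt t t,
      forall t1 t2 t3, reflections S t1 -> reflections S t2 -> reflections S t3 ->
        lt t1 t2 -> lt t2 t3 -> lt t1 t3,
      forall t1 t2, reflections S t1 -> reflections S t2 -> t1 <> t2 ->
        lt t1 t2 \/ lt t2 t1 &
      forall t1 t2 a b, reflections S t1 -> reflections S t2 -> t1 <> t2 ->
        a <> b -> canonical_generators S (generated [set t1; t2]) = [set a; b] ->
        dihedral_chain lt a b \/ dihedral_chain lt b a].

End Coxeter.

(** * Compositions *)

Definition composition (al : seq nat) : Prop := all (leq 1) al.

Definition comp_set (be : seq nat) : {fset nat} :=
  [fset sumn (take i be) | i in iota 1 (size be).-1]%fset.

(* be is obtained from al by adding up consecutive parts. *)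
Definition refines (al be : seq nat) : Prop :=
  exists ss : seq (seq nat), flatten ss = al /\ map sumn ss = be.

Definition comp_of_set (n : nat) (A : {fset nat}) : seq nat :=
  xget [::] [set be | [/\ composition be, sumn be = n & comp_set be = A]].

Section Counting.
Local Open Scope group_scope.
Context {W : groupType}.
Implicit Types (S : set W) (lt : rel W) (u v : W).

Definition descents lt u (p : seq W) : {fset nat} :=
  let a := nth u (u :: p) in
  [fset i in iota 1 (size p).-1
     | lt (a i.+1 * (a i)^-1) (a i * (a i.-1)^-1)]%fset.

Definition descent_composition lt u (p : seq W) (be : seq nat) : Prop :=
  [/\ composition be, sumn be = size p & comp_set be = descents lt u p].

Definition b_ S lt u v (al : seq nat) : nat :=
  #|` fset_set [set p | [/\ bruhat_path S u v p, size p = sumn al &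
                            descent_composition lt u p al]] |%fset.

Definition c_ S lt u v (al : seq nat) : nat :=
  #|` fset_set [set p | [/\ bruhat_path S u v p, size p = sumn al &
        exists2 be, descent_composition lt u p be & refines al be]] |%fset.

End Counting.

(** * The Hecke algebra, and R-polynomials *)

Section Hecke.
Context {W : groupType} (S : set W) {H : algType laurent} (T : W -> H).

(* H is the Hecke algebra of (W, S) over Z[q, q^-1], with standard basis T. *)
Definition hecke_algebra : Prop :=
  [/\ forall h : H, exists (A : seq W) (a : W -> laurent),
        h = \sum_(w <- A) a w *: T w,
      forall (A : seq W) (a : W -> laurent), uniq A ->
        \sum_(w <- A) a w *: T w = 0 -> forall w, w \in A -> a w = 0,
      T 1%g = 1 &
      forall w s, S s ->
        T w * T s = if (len S w < len S (w * s)%g)%N then T (w * s)%g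
                    else lX *: T (w * s)%g + (lX - 1) *: T w].

Definition R_family (R : W -> W -> {poly int}) : Prop :=
  (forall u v, ~ bruhat_le S u v -> R u v = 0) /\
  (forall v,
     let Tinv := lX ^- len S v *: \sum_(u \in [set u | bruhat_le S u v])
                   ((-1) ^+ len2 S u v * (map_poly intr (R u v)).[lX]) *: T u in
     Tinv * T (v^-1)%g = 1 /\ T (v^-1)%g * Tinv = 1).

Definition Rpoly : W -> W -> {poly int} := xget (fun _ _ => 0) [set R | R_family R].

(* The identity R(q) = q^(l(u,v)/2) Rt(q^(1/2) - q^(-1/2)), for u <= v, is written
   in the Laurent polynomials in lX = q^(1/2). *)
Definition Rtilde (u v : W) : {poly nat} :=
  xget 0 [set P : {poly nat} |
    (map_poly intr (Rpoly u v)).[lX ^+ 2] =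
    lX ^+ len2 S u v * (map_poly (fun n : nat => n%:R) P).[lX - lX^-1]].

End Hecke.

(** * Formal power series with rational coefficients in x_0, x_1, x_2, ... *)

Notation pseries := ({cmonom nat} -> rat^o).

(* Coefficientwise sum; it is meant for families such that each monomial occurs in
   finitely many members. *)
Definition ser_sum (I : choiceType) (A : set I) (f : I -> pseries) : pseries :=
  fun m => \sum_(i \in A) f i m.

Definition ser_of_poly (p : {malg rat[{cmonom nat}]}) : pseries := fun m => p@_m.

Definition x_ (i : nat) : {malg rat[{cmonom nat}]} := << ucm i >>.

Definition ser1 : pseries := ser_of_poly 1.

Definition homogeneous (n : nat) (f : pseries) : Prop :=
  forall m, f m != 0 -> mdeg m = n.

(** * Quasisymmetric functions, and the peak algebra *)

Definition M_ (al : seq nat) : pseries :=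
  ser_sum [set i : seq nat | sorted ltn i /\ size i = size al]
    (fun i => ser_of_poly (\prod_(ia <- zip i al) x_ ia.1 ^+ ia.2)).

Definition L_ (be : seq nat) : pseries :=
  ser_sum [set al | composition al /\ refines al be] M_.

Definition Lset (n : nat) (A : {fset nat}) : pseries := L_ (comp_of_set n A).

(* ([:: n_1; ...; n_k], n_0) is the word c^n_1 d c^n_2 d ... c^n_k d c^n_0. *)
Definition cdword : Type := (seq nat * nat)%type.

Definition cd_m (w : cdword) (j : nat) : nat := (sumn (take j w.1) + j.*2)%N.

Definition cd_deg (w : cdword) : nat := (cd_m w (size w.1) + w.2)%N.

Definition interval1 (n : nat) : {fset nat} := [fset i in iota 1 n]%fset.

Definition cd_sets (w : cdword) : seq {fset nat} :=
  [seq [fset (cd_m w j).-1; cd_m w j]%fset | j <- iota 1 (size w.1)].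

Definition in_B (w : cdword) (A : {fset nat}) : bool :=
  all (fun E => (A `&` E != fset0) &&
                ((interval1 (cd_deg w) `\` A) `&` E != fset0))%fset (cd_sets w).

Definition Theta (w : cdword) : pseries :=
  \sum_(A <- fpowerset (interval1 (cd_deg w)) | in_B w A) Lset (cd_deg w).+1 A.

Definition peak_algebra : set pseries :=
  [set f | exists (a0 : rat) (ws : seq cdword) (a : cdword -> rat),
     f = a0 *: ser1 + \sum_(w <- ws) a w *: Theta w].

Definition peak_part (n : nat) : set pseries :=
  [set f | peak_algebra f /\ homogeneous n f].

(** * The R-quasisymmetric function *)

Section Ftilde.
Context {W : groupType} (S : set W) {H : algType laurent} (T : W -> H).

(* The multichain u = u_0 <= ... <= u_(k-1) < u_k = v, with k >= 1, is given by
   c = [:: u_1; ...; u_k]. *)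
Definition multichain (u v : W) (c : seq W) : Prop :=
  [/\ (0 < size c)%N, path (fun x y => `[< bruhat_le S x y >]) u c,
      last u c = v & nth u (u :: c) (size c).-1 <> v].

(* Since the variables start at x_0, the j-th step of a multichain, counted from 0,
   contributes a polynomial in x_j. *)
Definition Ftilde (u v : W) : pseries :=
  if u == v then ser1 else
  ser_sum [set c | multichain u v c] (fun c => ser_of_poly
    (\prod_(j < size c)
       (map_poly (fun n : nat => n%:R)
          (Rtilde S T (nth u (u :: c) j) (nth u (u :: c) j.+1))).[x_ j])).

End Ftilde.

(* Main.v *)
(** The crux is Dyer's description of [Rtilde u v] as the generating function of the
    Bruhat paths from u to v whose labels increase. For an initial section A of the
    reflection ordering, let a generator s act on Z[q][W] by x |-> x s - q x if x s
    precedes x in the Bruhat order with the edges labelled by A reversed, and by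
    x |-> x s otherwise. The operator x |-> x + q [t x > x] t x intertwines these
    actions for A = {r < t} and A = {r <= t}. This reduces to the claim that, for
    reflections r <> t, l(r t) < l(t) iff t lies between r and t r t in the ordering,
    a statement about the dihedral group <r, t>. Composing these operators in
    increasing order of t gives the recursion of the R-polynomials.

    The coefficient of a monomial in [Ftilde u v] then counts the paths which increase
    along consecutive blocks, whence both expansions. For the peak algebra, let Psi be
    the sum over the paths from u to v of their descent words in noncommuting letters
    x (ascent) and y (descent), and let e_k(u, a) be the number of increasing paths of
    length k. Splitting off the first ascents, Psi = F + F y Psi, where F is the sum of
    the e_k (x - y)^(k-1). The reversed ordering is again a reflection ordering, with
    the same e_k, so the roles of x and y can be exchanged. Adding both identities
    expresses 2 Psi in terms of Psi for shorter intervals, with coefficients polynomial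
    in c = x + y and (x - y)^2 = c^2 - 2 d; hence Psi is a polynomial in c and d. *)

Require Import Defs.
From HB Require Import structures.
From mathcomp Require Import all_boot all_order all_fingroup all_algebra finmap.
From mathcomp Require Import boolp classical_sets functions cardinality fsbigop.
From mathcomp Require Import monalg zify ring lra.

Set Implicit Arguments.
Unset Strict Implicit.
Unset Printing Implicit Defensive.

Import GRing.Theory.

Local Open Scope classical_set_scope.
Local Open Scope ring_scope.

(** * Inversion sets and the exchange property *)

(** [coxeter_system] is a universal property, so the exchange condition and the parity of lengths
    have to be won by mapping W into suitable groups. [reflection_order] constrains only dihedral
    groups with exactly two canonical generators, so every group generated by two distinct
    reflections is first shown to be one. W may be infinite, and with it the initial sections. But
    only finitely many elements lie below v, so a finite sorted list [ts] that contains every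
    reflection relevant below v can replace the whole ordering. [Rpoly] and [Rtilde] are picked by
    [xget], so their characterizations must be shown to have one and only one solution: polynomials
    built from path counts are shown to give the inverse of T_(v^-1), and a polynomial over N is
    shown to be determined by its value at q^(1/2) - q^(-1/2). Both are defined without any
    ordering, and this alone is why the counts e_k do not change when the ordering is reversed. *)

Section CocycleGroup.
Local Open Scope group_scope.
Variable W : groupType.

(* W acting on the subsets of W by conjugation, in a semidirect product. By the universal
   property s |-> (s, {s}) extends to W, and the second component of w is N(w). *)
Definition cocycle_group : Type := (W * (W -> bool))%type.
HB.instance Definition _ := Choice.on cocycle_group.

Definition cg_mul (a b : cocycle_group) : cocycle_group :=
  (a.1 * b.1, fun t => a.2 t (+) b.2 (a.1^-1 * t * a.1)).
Definition cg_one : cocycle_group := (1, fun=> false).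
Definition cg_inv (a : cocycle_group) : cocycle_group :=
  (a.1^-1, fun t => a.2 (a.1 * t * a.1^-1)).

Fact cg_mulA : associative cg_mul.
Proof.
move=> [x A] [y B] [z C]; congr pair; rewrite /= ?mulgA //.
by apply/funext => t /=; rewrite addbA invgM !mulgA.
Qed.

Fact cg_mul1 : left_id cg_one cg_mul.
Proof.
move=> [x A]; congr pair; rewrite /= ?mul1g //.
by apply/funext => t /=; rewrite invg1 mul1g mulg1.
Qed.

Fact cg_mulr1 : right_id cg_one cg_mul.
Proof.
move=> [x A]; congr pair; rewrite /= ?mulg1 //.
by apply/funext => t /=; rewrite addbF.
Qed.

Fact cg_mulV : left_inverse cg_one cg_inv cg_mul.
Proof.
move=> [x A]; congr pair; rewrite /= ?mulVg //.
by apply/funext => t /=; rewrite invgK addbb.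
Qed.

Fact cg_mulrV : right_inverse cg_one cg_inv cg_mul.
Proof.
move=> [x A]; congr pair; rewrite /= ?mulgV //.
by apply/funext => t /=; rewrite !mulgA mulgV mul1g mulgK addbb.
Qed.

HB.instance Definition _ := isGroup.Build cocycle_group
  cg_mulA cg_mul1 cg_mulr1 cg_mulV cg_mulrV.

End CocycleGroup.

(** * Alternating words in two involutions, and the extension of s |-> (s, {s}) to W *)

Section Involutions.
Local Open Scope group_scope.

Lemma eq_conjV (G : groupType) (x y z : G) : (x == y^-1 * z * y) = (y * x * y^-1 == z).
Proof.
by rewrite -(inj_eq (mulIg y^-1)) -(inj_eq (mulgI y)) !mulgA mulgV mul1g mulgK.
Qed.

Variables (W : groupType) (a b : W).
Hypotheses (a2 : a * a = 1) (b2 : b * b = 1).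

Lemma involV : a^-1 = a.
Proof. exact: mulg1_eq. Qed.

Lemma mulg_expgC n : a * (b * a) ^+ n = (a * b) ^+ n * a.
Proof.
elim: n => [|n IH]; first by rewrite !expg0 mulg1 mul1g.
by rewrite expgSr mulgA IH [in RHS]expgSr !mulgA.
Qed.

Lemma expgV_swap n : (a * b) ^- n = (b * a) ^+ n.
Proof.
by rewrite -expVgn invgM (mulg1_eq a2) (mulg1_eq b2).
Qed.

Lemma alt_conj n : (a * b) ^+ n * a * (a * b) ^- n = (a * b) ^+ n.*2 * a.
Proof. by rewrite expgV_swap -mulgA mulg_expgC mulgA -expgnDr addnn. Qed.

Lemma alt_conj2 n :
  (a * b) ^+ n * (a * b * a) * (a * b) ^- n = (a * b) ^+ n.*2.+1 * a.
Proof.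
rewrite mulgA -expgSr expgV_swap -mulgA mulg_expgC mulgA -expgnDr.
by rewrite addSn addnn.
Qed.

End Involutions.

Section Cocycle.
Local Open Scope group_scope.
Variables (W : groupType) (S : set W).
Hypothesis hWS : coxeter_system S.

Lemma gen_invol s : S s -> s * s = 1.
Proof. by case: hWS => m [[m1 _] _ rel _] Ss; have := rel s s Ss Ss; rewrite m1. Qed.

Lemma genV s : S s -> s^-1 = s.
Proof. by move=> Ss; apply: involV (gen_invol Ss). Qed.

Let gpair (s : W) : cocycle_group W := (s, eq_op s).

Let gpair_pow s t n : S s -> S t ->
  (gpair s * gpair t) ^+ n =
  ((s * t) ^+ n, fun r => \big[addb/false]_(i < n.*2) ((s * t) ^+ i * s == r))
    :> cocycle_group W.
Proof.
move=> Ss St; have s2 := gen_invol Ss; have t2 := gen_invol St.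
elim: n => [|n IH].
  by rewrite !expg0; congr pair; apply/funext => r; rewrite big_ord0.
rewrite !expgSr IH; congr pair; apply/funext => r /=.
rewrite doubleS !big_ord_recr /= -addbA; congr (_ (+) (_ (+) _)).
  by rewrite eq_conjV alt_conj.
by rewrite !eq_conjV -alt_conj2 // (genV Ss) !mulgA.
Qed.

Lemma cocycle_exists : exists N : W -> W -> bool,
  (forall x y t, N (x * y) t = N x t (+) N y (x^-1 * t * x)) /\
  (forall s, S s -> N s = eq_op s).
Proof.
case: hWS => m [[m1 mC] gen rel univ].
have [|g gS] := univ (cocycle_group W) gpair.
  move=> s t Ss St; rewrite gpair_pow //; congr pair; first exact: rel.
  (* As (st)^m = 1, the reflections (st)^i s with i < m and with m <= i < 2m are the same, and
     cancel in pairs. For m = 0, the case of infinite order, there are none. *)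
  apply/funext => r /=; rewrite -addnn big_split_ord /=.
  rewrite [X in _ (+) X](eq_bigr (fun i : 'I_(m s t) => (s * t) ^+ i * s == r)) ?addbb //.
  by move=> i _; rewrite /= expgnDr (rel s t Ss St) mul1g.
have g1 : g 1 = 1.
  by apply: (@mulgI _ (g 1)); rewrite -gmulfM !mulg1.
have gfst w : (g w).1 = w.
  have [e [eS <-]] := gen w; elim: e eS => [|s e IH] eS.
    by rewrite big_nil g1.
  rewrite big_cons gmulfM /= IH => [|x xe]; last by apply: eS; rewrite inE xe orbT.
  by rewrite gS //; apply: eS; rewrite inE eqxx.
exists (fun w => (g w).2); split=> [x y t|s Ss]; last by rewrite gS.
by rewrite gmulfM /= gfst.
Qed.

End Cocycle.

Section Length.
Local Open Scope group_scope.
Variables (W : groupType) (S : set W).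
Hypothesis hWS : coxeter_system S.
Implicit Types (s t u v w x y : W) (e : seq W).

Definition inv w t : bool := (len S (t * w) < len S w)%N.

Lemma len_spec w : is_length S w (len S w).
Proof.
apply: xgetPex; case: hWS => m [_ gen _ _].
have ex : exists n, `[< exists2 e, expression S w e & size e = n >].
  by have [e we] := gen w; exists (size e); apply/asboolP; exists e.
case: (ex_minnP ex) => n /asboolP[e we se] nmin; exists n; split; first by exists e.
by move=> e' we'; apply: nmin; apply/asboolP; exists e'.
Qed.

Lemma len_le w e : expression S w e -> (len S w <= size e)%N.
Proof. by have [_] := len_spec w; apply. Qed.

Lemma reduced_exists w : exists2 e, expression S w e & size e = len S w.
Proof. by have [] := len_spec w. Qed.

Lemma expression_cat x y e f :
  expression S x e -> expression S y f -> expression S (x * y) (e ++ f).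
Proof.
move=> [eS <-] [fS <-]; split; last by rewrite big_cat.
by move=> s; rewrite mem_cat => /orP[/eS|/fS].
Qed.

Lemma expression_catP w e f : expression S w (e ++ f) ->
  exists x y, [/\ expression S x e, expression S y f & w = x * y].
Proof.
move=> [efS <-]; exists (\prod_(s <- e) s), (\prod_(s <- f) s).
split; last by rewrite big_cat.
  by split=> // s se; apply: efS; rewrite mem_cat se.
by split=> // s se; apply: efS; rewrite mem_cat se orbT.
Qed.

Lemma expression_gen s : S s -> expression S s [:: s].
Proof. by move=> Ss; split=> [x|]; rewrite ?inE ?big_seq1 // => /eqP->. Qed.

Lemma expression_nil w : expression S w [::] -> w = 1.
Proof. by move=> [_ <-]; rewrite big_nil. Qed.

Lemma expression_seq1 w s : expression S w [:: s] -> S s /\ w = s.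
Proof. by move=> [sS <-]; rewrite big_seq1; split=> //; apply: sS; rewrite inE. Qed.

Lemma expressionV w e : expression S w e -> expression S w^-1 (rev e).
Proof.
elim: e w => [|s e IH] w.
  by move/expression_nil->; rewrite invg1; split=> //; rewrite big_nil.
rewrite -cat1s => /expression_catP[x [y [/expression_seq1[Ss ->] ye ->]]].
rewrite invgM (genV hWS Ss) rev_cat; apply: expression_cat (IH _ ye) _.
exact: expression_gen.
Qed.

Lemma lenV w : len S w^-1 = len S w.
Proof.
have leV x : (len S x^-1 <= len S x)%N.
  by have [e xe <-] := reduced_exists x; rewrite -size_rev; apply/len_le/expressionV.
apply/eqP; rewrite eqn_leq leV /=.
by rewrite -{1}(invgK w); apply: leV.
Qed.

Lemma lenM x y : (len S (x * y) <= len S x + len S y)%N.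
Proof.
have [e xe <-] := reduced_exists x; have [f yf <-] := reduced_exists y.
by rewrite -size_cat; apply/len_le/expression_cat.
Qed.

Lemma len_gen s : S s -> (len S s <= 1)%N.
Proof. by move=> Ss; apply: (len_le (expression_gen Ss)). Qed.

Lemma len1 : len S 1 = 0%N.
Proof.
apply/eqP; rewrite -leqn0; apply: (@len_le _ [::]).
by split=> //; rewrite big_nil.
Qed.

Lemma len_eq0 w : len S w = 0%N -> w = 1.
Proof.
have [e we <-] := reduced_exists w => /size0nil e0.
by apply: expression_nil; rewrite -e0.
Qed.

(** Sending every generator to the transposition of ['S_2] respects the relations, because the
    product of any two images is 1. The parity of the image is then the parity of the length. *)
Lemma sign_exists : exists sg : W -> bool,
  [/\ forall x y, sg (x * y) = sg x (+) sg y, forall s, S s -> sg s &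
      forall w, sg w = odd (len S w)].
Proof.
case: (hWS) => m [_ gen _ univ].
have [|g gS] := univ 'S_2 (fun=> tperm ord0 ord_max).
  by move=> s t _ _; rewrite tperm2 expg1n.
have gM x y : g (x * y) = g x * g y by apply: gmulfM.
have g1 : g 1 = 1 by apply: (@mulgI _ (g 1)); rewrite -gM !mulg1.
have gs s : S s -> odd_perm (g s) by move=> Ss; rewrite gS // odd_tperm.
exists (fun w => odd_perm (g w)); split=> // [x y|w]; first by rewrite gM odd_permM.
have [e we <-] := reduced_exists w; elim: e w we => [|s e IH] w.
  by move/expression_nil->; rewrite g1 odd_perm1.
rewrite -cat1s => /expression_catP[x [y [/expression_seq1[Ss ->] ye ->]]].
by rewrite gM odd_permM gs //= (IH _ ye).
Qed.

Lemma odd_len_mul x y : odd (len S (x * y)) = odd (len S x) (+) odd (len S y).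
Proof. by have [sg [sgM _ sgE]] := sign_exists; rewrite -!sgE. Qed.

Lemma odd_len_gen s : S s -> odd (len S s).
Proof. by have [sg [_ sgS sgE]] := sign_exists; rewrite -!sgE; apply: sgS. Qed.

Lemma odd_len_refl t : reflections S t -> odd (len S t).
Proof.
by move=> [w [s Ss ->]]; rewrite !odd_len_mul lenV (odd_len_gen Ss) addbT addNb addbb.
Qed.

Lemma refl_invol t : reflections S t -> t * t = 1.
Proof.
move=> [w [s Ss ->]]; rewrite !mulgA mulgVK -(mulgA w) (gen_invol hWS Ss).
by rewrite mulg1 mulgV.
Qed.

Lemma reflV t : reflections S t -> t^-1 = t.
Proof. by move=> rt; apply: involV (refl_invol rt). Qed.

Lemma refl_conj x t : reflections S t -> reflections S (x * t * x^-1).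
Proof.
by move=> [w [s Ss ->]]; exists (x * w), s => //; rewrite invgM !mulgA.
Qed.

Lemma refl_conjV x t : reflections S t -> reflections S (x^-1 * t * x).
Proof. by move=> /(refl_conj x^-1); rewrite invgK. Qed.

Lemma refl_gen s : S s -> reflections S s.
Proof. by move=> Ss; exists 1, s; rewrite // invg1 mul1g mulg1. Qed.

Lemma refl_conj_refl t r : reflections S t -> reflections S r ->
  reflections S (t * r * t).
Proof. by move=> rt rr; rewrite -{2}(reflV rt); apply: refl_conj. Qed.

(* t belongs to N w iff it occurs an odd number of times among the reflections
   attached to the letters of an expression of w, and then deleting such a letter
   from a reduced expression yields t w. *)
Lemma inv_cocycle_exists : exists N : W -> W -> bool,
  [/\ forall x y t, N (x * y) t = N x t (+) N y (x^-1 * t * x),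
      forall s, S s -> N s = eq_op s,
      forall w t e, N w t -> expression S w e ->
        exists x s y e1 e2, [/\ expression S x e1, S s & expression S y e2] /\
           [/\ e = e1 ++ s :: e2, w = x * s * y & t = x * s * x^-1] &
      forall w t, reflections S t -> N w t = inv w t].
Proof.
have [N [NM NS]] := cocycle_exists hWS.
have N1 t : N 1 t = false.
  by have := NM 1 1 t; rewrite invg1 !mul1g mulg1; case: (N 1 t).
have split w t e : N w t -> expression S w e ->
    exists x s y e1 e2, [/\ expression S x e1, S s & expression S y e2] /\
       [/\ e = e1 ++ s :: e2, w = x * s * y & t = x * s * x^-1].
  elim: e w t => [|s e IH] w t Nwt.
    by move/expression_nil=> w1; rewrite w1 N1 in Nwt.
  rewrite -cat1s => /expression_catP[x [y [/expression_seq1[Ss ->] ye wE]]].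
  move: Nwt; rewrite wE NM NS //; case: eqP => [<-|_] /= Nwt.
    exists 1, s, y, [::], e; rewrite invg1 !mul1g mulg1; split=> //.
    by split=> //; split=> //; rewrite big_nil.
  have [x1 [s1 [y1 [e1 [e2 [[xe1 Ss1 ye2] [-> -> tE]]]]]]] := IH _ _ Nwt ye.
  exists (s * x1), s1, y1, (s :: e1), e2; split; split=> //.
  - by rewrite -cat1s; apply: expression_cat => //; apply: expression_gen.
  - by rewrite !mulgA.
  have -> : t = s * (x1 * s1 * x1^-1) * s^-1 by rewrite -tE !mulgA mulgV mul1g mulgK.
  by rewrite invgM !mulgA.
have Nlt w t : N w t -> (len S (t * w) < len S w)%N.
  move=> Nwt; have [e we <-] := reduced_exists w.
  have [x [s [y [e1 [e2 [[xe1 Ss ye2] [-> -> ->]]]]]]] := split _ _ _ Nwt we.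
  have -> : x * s * x^-1 * (x * s * y) = x * y.
    by rewrite !mulgA mulgVK -(mulgA x) (gen_invol hWS Ss) mulg1.
  have := len_le (expression_cat xe1 ye2); rewrite !size_cat /=; lia.
exists N; split=> // w t rt; apply/idP/idP; first exact: Nlt.
have NV x r : N x^-1 r = N x (x * r * x^-1).
  have := NM x x^-1 (x * r * x^-1).
  by rewrite mulgV N1 !mulgA mulVg mul1g mulgVK; case: (N x^-1 r); case: (N x _).
have Ntt : N t t.
  case: rt => x [s Ss tE].
  have tJ : x^-1 * t * x = s by rewrite tE !mulgA mulVg mul1g mulgVK.
  have tJ2 : (x * s)^-1 * t * (x * s) = s.
    by rewrite invgM -!mulgA (mulgA t) !(mulgA x^-1) tJ mulKg.
  by rewrite {1}tE !NM NV (NS _ Ss) tJ tJ2 -tE eqxx addbAC addbb.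
(* If t is not in N(w), then t is in N(t w), because t is in N(t); so multiplying t w by t shortens
   it to w. *)
rewrite /inv; apply: contraLR => nNwt; rewrite -leqNgt ltnW //.
rewrite -{1}[w](mulKg t) (reflV rt); apply: (Nlt (t * w) t).
by rewrite NM Ntt (reflV rt) refl_invol // mul1g (negbTE nNwt).
Qed.

Lemma inv_mul x y t : reflections S t ->
  inv (x * y) t = inv x t (+) inv y (x^-1 * t * x).
Proof.
have [N [NM _ _ NE]] := inv_cocycle_exists.
by move=> rt; rewrite -!NE ?NM //; apply: refl_conjV.
Qed.

Lemma inv_gen s t : S s -> reflections S t -> inv s t = (s == t).
Proof. by have [N [_ NS _ NE]] := inv_cocycle_exists => Ss rt; rewrite -NE // NS. Qed.

Lemma inv_self t : reflections S t -> inv t t.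
Proof. by move=> rt; rewrite /inv refl_invol // len1 odd_gt0 // odd_len_refl. Qed.

(** The cocycle rule for the product t t = 1, whose inversion set is empty. *)
Lemma inv_reflJ t r : reflections S t -> reflections S r ->
  inv t (t * r * t) = inv t r.
Proof.
move=> rt rr; have /esym := inv_mul t t rr; rewrite refl_invol // reflV // /inv.
by rewrite len1 ltn0; do 2!case: (_ < _)%N.
Qed.

(** As t is in N(t), the word splits as t = p s q with t = p s p^-1, so q = p^-1. Both outer pieces
    have at least l(p) letters, but together at most 2 l(p), since l(t) <= 2 l(p) + 1. *)
Lemma refl_palindrome t e : reflections S t -> expression S t e ->
  size e = len S t -> exists p s e1 e2,
  [/\ expression S p e1, S s, e = e1 ++ s :: e2, size e1 = size e2 &
      t = p * s * p^-1].
Proof.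
have [N [_ _ Nsplit NE]] := inv_cocycle_exists.
move=> rt te se; have Ntt : N t t by rewrite NE // inv_self.
have [p [s [q [e1 [e2 [[pe1 Ss qe2] [eE tE tE']]]]]]] := Nsplit _ _ _ Ntt te.
exists p, s, e1, e2; split=> //.
have qE : q = p^-1 by apply: (@mulgI _ (p * s)); rewrite -tE.
have lp := len_le pe1; have lq := len_le qe2; have ls := len_gen Ss.
have := lenM (p * s) q; have := lenM p s; rewrite -tE -se eE size_cat /=.
by move: lp lq; rewrite qE lenV; lia.
Qed.

(** Write t = p s' p^-1 with p = w s y. Then r = w s w^-1 is a shorter palindrome around an earlier
    letter, and r t r = (w y) s' (w y)^-1 is t with s and its mirror image deleted. *)
Lemma refl_prefix_shorter t e w s f1 f2 : reflections S t ->
  expression S t e -> size e = len S t -> e = f1 ++ s :: f2 ->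
  (size f1 < size f2)%N -> expression S w f1 -> S s ->
  (len S (w * s * w^-1) < len S t)%N /\
  (len S (w * s * w^-1 * t * (w * s * w^-1)) < len S t)%N.
Proof.
move=> rt te se eE lt wf1 Ss.
have [p [s' [e1 [e2 [pe1 Ss' eE' sz tE]]]]] := refl_palindrome rt te se.
have szE : size e = (size e1).*2.+1 by rewrite eE' size_cat /= -sz; lia.
have lt1 : (size f1 < size e1)%N by move: szE; rewrite eE size_cat /=; lia.
have [g e1E] : exists g, e1 = f1 ++ s :: g.
  have eEE : f1 ++ s :: f2 = e1 ++ s' :: e2 by rewrite -eE.
  exists (drop (size f1).+1 e1); rewrite -{1}(cat_take_drop (size f1) e1).
  have -> : take (size f1) e1 = f1.
    by have := congr1 (take (size f1)) eEE; rewrite take_size_cat // takel_cat // ltnW.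
  congr cat; rewrite (drop_nth s) //; congr cons.
  have := congr1 (nth s ^~ (size f1)) eEE.
  by rewrite nth_cat ltnn subnn nth_cat lt1.
have wl := len_le wf1; have sl := len_gen Ss; have sl' := len_gen Ss'.
move: pe1; rewrite e1E => /expression_catP[w' [y0 [wf1' yg0 pE]]].
have {w' wf1' pE} pE : p = w * y0 by rewrite pE; case: wf1 wf1' => _ <- [_ <-].
move: yg0; rewrite -cat1s => /expression_catP[s1 [y [/expression_seq1[_ ->] yg y0E]]].
have yl := len_le yg; have s2 := gen_invol hWS Ss.
move: szE; rewrite se e1E size_cat /= => ->; split.
  have := lenM (w * s) w^-1; have := lenM w s; rewrite lenV; lia.
have -> : w * s * w^-1 * t * (w * s * w^-1) = w * y * s' * (w * y)^-1.
  rewrite tE pE y0E !invgM (genV hWS Ss) !mulgA !mulgVK.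
  by rewrite -(mulgA w s s) s2 mulg1 -!mulgA (mulgA s s) s2 mul1g.
have := lenM (w * y * s') (w * y)^-1; have := lenM (w * y) s'; have := lenM w y.
rewrite lenV; lia.
Qed.

(* A reflection r <> t in N(t) comes from a letter of a palindromic reduced
   expression of t other than the middle one; up to replacing r by t r t, that
   letter lies in the first half. *)
Lemma inv_refl_shorter t r : reflections S t -> reflections S r -> r <> t ->
  inv t r -> exists2 r', r' = r \/ r' = t * r * t &
    (len S r' < len S t)%N /\ (len S (r' * t * r') < len S t)%N.
Proof.
have [N [_ _ Nsplit NE]] := inv_cocycle_exists.
move=> rt rr ne; rewrite -NE // => Ntr.
have [e te se] := reduced_exists t.
have [w [s [v [f1 [f2 [[wf1 Ss vf2] [eE tE rE]]]]]]] := Nsplit _ _ _ Ntr te.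
have [lt|lt|eq1] := ltngtP (size f1) (size f2).
- exists r; first by left.
  by rewrite rE; apply: (refl_prefix_shorter rt te se eE).
- exists (t * r * t); first by right.
  have -> : t * r * t = v^-1 * s * v^-1^-1.
    rewrite invgK -{1}(reflV rt) rE tE !invgM (genV hWS Ss) -!mulgA mulKg.
    by rewrite (mulgA s s) (gen_invol hWS Ss) mul1g mulKg.
  apply: (@refl_prefix_shorter t (rev e) _ _ (rev f2) (rev f1)) => //.
  + by rewrite -(reflV rt); apply: expressionV.
  + by rewrite size_rev.
  + by rewrite eE rev_cat rev_cons -cats1 -catA.
  + by rewrite !size_rev.
  + exact: expressionV.
case: ne; rewrite rE.
have [p [s' [e1 [e2 [pe1 Ss' eE' sz ->]]]]] := refl_palindrome rt te se.
have : f1 ++ s :: f2 = e1 ++ s' :: e2 by rewrite -eE.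
have sz1 : size f1 = size e1.
  by move: eE'; rewrite eE => /(congr1 size); rewrite !size_cat /=; lia.
move/eqP; rewrite eqseq_cat // => /andP[/eqP f1E /eqP[-> _]].
by case: wf1 pe1 => _ <- [_ <-]; rewrite f1E.
Qed.

End Length.

(** * Dihedral reflection subgroups *)

Section GeneratedByTwo.
Local Open Scope group_scope.
Variables (W : groupType) (S : set W).
Hypothesis hWS : coxeter_system S.
Implicit Types (t r x y : W).

Lemma generated_subgroup (A : set W) : is_subgroup (Defs.generated A).
Proof.
split=> [G [[]]//|x y Ax Ay G GA|x Ax G GA].
  by have [[_ GM _] _] := GA; apply: GM; [apply: Ax | apply: Ay].
by have [[_ _ GV] _] := GA; apply: GV; apply: Ax.
Qed.

Lemma mem_generated (A : set W) x : A x -> Defs.generated A x.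
Proof. by move=> Ax G [_]; apply. Qed.

Lemma refl_alt t1 t2 i : reflections S t1 -> reflections S t2 ->
  reflections S ((t1 * t2) ^+ i * t1).
Proof.
move=> r1 r2; have i1 := refl_invol hWS r1; have i2 := refl_invol hWS r2.
rewrite -(odd_double_half i); case: (odd i) => /=; rewrite ?add0n ?add1n.
  by rewrite -alt_conj2 //; apply/refl_conj/(refl_conj_refl hWS).
by rewrite -alt_conj //; apply: refl_conj.
Qed.

Let rotation t1 t2 x := exists i, x = (t1 * t2) ^+ i \/ x = (t2 * t1) ^+ i.

(** An element of the group is a rotation (a power of t1 t2 or of t2 t1) or a rotation times t1.
    Rotations have even length, so an odd element is alternating and hence conjugate to t1 or t2. *)
Lemma generated2_odd t1 t2 x : reflections S t1 -> reflections S t2 ->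
  Defs.generated [set t1; t2] x -> odd (len S x) -> reflections S x.
Proof.
move=> r1 r2 Gx ox; have i1 := refl_invol hWS r1; have i2 := refl_invol hWS r2.
have rot_even y : rotation t1 t2 y -> ~~ odd (len S y).
  have ev s1 s2 i : reflections S s1 -> reflections S s2 ->
      ~~ odd (len S ((s1 * s2) ^+ i)).
    move=> q1 q2; elim: i => [|i IH]; first by rewrite expg0 len1.
    by rewrite expgS !(odd_len_mul hWS) (odd_len_refl hWS q1) (odd_len_refl hWS q2).
  by move=> [i [->|->]]; apply: ev.
have [e [eS xE]] : exists e, expression [set t1; t2] x e.
  apply: (Gx [set y | exists e, expression [set t1; t2] y e]); split; last first.
    move=> y Ay; exists [:: y]; split; last by rewrite big_seq1.
    by move=> z; rewrite inE => /eqP->.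
  split=> [|y z [e [eS <-]] [f [fS <-]]|y [e [eS <-]]].
  - by exists [::]; split=> //; rewrite big_nil.
  - exists (e ++ f); split; last by rewrite big_cat.
    by move=> s; rewrite mem_cat => /orP[/eS|/fS].
  exists (rev e); split=> [s|]; first by rewrite mem_rev => /eS.
  elim: e eS => [|s e IH] eS; first by rewrite big_nil invg1.
  rewrite rev_cons -cats1 big_cat big_seq1 big_cons invgM -IH => [|z ze].
    have [->|->] : [set t1; t2] s by apply: eS; rewrite inE eqxx.
      by rewrite (involV i1).
    by rewrite (involV i2).
  by apply: eS; rewrite inE ze orbT.
suff [rotx|[y roty xyE]] : rotation t1 t2 x \/ exists2 y, rotation t1 t2 y & x = y * t1.
- by move: (rot_even _ rotx); rewrite ox.
- case: roty xyE => [[|i]] [->|->] ->; rewrite ?expg0 ?mul1g //.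
    exact: refl_alt.
  by rewrite expgSr -!mulgA i1 mulg1; apply: refl_alt.
have C1 y : rotation t1 t2 y -> exists2 z, rotation t1 t2 z & t1 * y = z * t1.
  move=> [i [->|->]]; last by exists ((t1 * t2) ^+ i); [exists i; left | rewrite mulg_expgC].
  exists ((t2 * t1) ^+ i); first by exists i; right.
  by rewrite -{1}(mulgK t1 ((t1 * t2) ^+ i)) -mulg_expgC (involV i1) !mulgA i1 mul1g.
have C2 y : rotation t1 t2 y -> rotation t1 t2 (t2 * t1 * y).
  move=> [[|i]] [->|->]; rewrite ?expg0 ?mulg1; try by exists 1%N; right.
    by exists i; left; rewrite expgS !mulgA -(mulgA t2 t1) i1 mulg1 i2 mul1g.
  by exists i.+2; right; rewrite [RHS]expgS.
have C1' y : (rotation t1 t2 y \/ exists2 z, rotation t1 t2 z & y = z * t1) ->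
    (rotation t1 t2 (t1 * y) \/ exists2 z, rotation t1 t2 z & t1 * y = z * t1).
  move=> [/C1|[z /C1[z' rz' zE] ->]]; first by right.
  by left; rewrite mulgA zE -mulgA i1 mulg1.
elim: e eS x xE {Gx ox} => [|s e IH] eS x <-.
  by left; exists 0%N; left; rewrite big_nil.
rewrite big_cons.
have {}IH := IH (fun z ze => eS z (mem_behead (s := s :: e) ze)) _ erefl.
have [->|->] : [set t1; t2] s by apply: eS; rewrite inE eqxx.
  exact: C1'.
have {IH} := C1' _ IH; set y := _ * _.
have -> : t2 * \prod_(j <- e) j = t2 * t1 * y by rewrite /y -mulgA (mulgA t1) i1 mul1g.
move=> [/C2|[z /C2 rz ->]]; first by left.
by right; exists (t2 * t1 * z); rewrite ?mulgA.
Qed.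

End GeneratedByTwo.

Section Dihedral.
Local Open Scope group_scope.
Variables (W : groupType) (S G : set W).
Hypotheses (hWS : coxeter_system S) (hG : is_subgroup G).
Hypothesis Godd : forall x, G x -> odd (len S x) -> reflections S x.
Implicit Types (a b t r x y : W).

Definition canonical t :=
  [/\ reflections S t, G t &
      forall r, reflections S r -> G r -> inv S t r -> r = t].

Lemma canonical_generatorsP t : canonical_generators S G t <-> canonical t.
Proof.
split=> [[rt Gt E]|[rt Gt can]]; split=> //.
  move=> r rr Gr tr; have : (inversions S t `&` G) r by [].
  by rewrite E.
apply/seteqP; split=> [r [[rr lt] Gr]|r ->]; first exact: can.
by split=> //; split=> //; apply: (inv_self hWS).
Qed.

Let GM x y : G x -> G y -> G (x * y). Proof. by case: hG => _ GM _; apply: GM. Qed.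

Lemma canonical_invE t r : canonical t -> reflections S r -> G r ->
  inv S t r = (t == r).
Proof.
move=> [rt Gt can] rr Gr; apply/idP/eqP => [|<-]; last exact: (inv_self hWS).
by move/(can _ rr Gr) => ->.
Qed.

Lemma min_refl (P : set W) t : P t ->
  exists2 a, P a & forall r, P r -> (len S a <= len S r)%N.
Proof.
move=> Pt; have ex : exists n, `[< exists2 a, P a & len S a = n >].
  by exists (len S t); apply/asboolP; exists t.
case: (ex_minnP ex) => n /asboolP[a Pa <-] nmin; exists a => // r Pr.
by apply: nmin; apply/asboolP; exists r.
Qed.

(** A reflection r <> t in N(t) and G yields by [inv_refl_shorter] a reflection r' in G such that r'
    and r' t r' are both shorter than t. This makes canonicity accessible to arguments by minimal
    length. *)
Lemma canonical_of_minimal t : reflections S t -> G t ->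
  (forall r, reflections S r -> G r -> (len S r < len S t)%N ->
     (len S (r * t * r) < len S t)%N -> False) ->
  canonical t.
Proof.
move=> rt Gt tmin; split=> // r rr Gr tr; apply: contrapT => rneq.
have [r' rE [l1 l2]] := inv_refl_shorter hWS rt rr rneq tr.
apply: (tmin r') => //; case: rE => -> //; first exact: (refl_conj_refl hWS).
by apply: GM => //; apply: GM.
Qed.

(* If a, t, b were distinct canonical reflections, then the reflection a t b would
   lie in N(a t b), which is contained in {a, a t a, a t b t a}. *)
Lemma canonical_at_most2 a b t : canonical a -> canonical b -> canonical t ->
  a <> b -> t = a \/ t = b.
Proof.
move=> ca cb ct ab; apply: contrapT => /not_orP[ta tb].
have [ra Ga _] := ca; have [rb Gb _] := cb; have [rt Gt _] := ct.
pose w := a * t * b; have Gw : G w by apply: GM => //; apply: GM.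
have rw : reflections S w.
  by apply: Godd => //; rewrite !(odd_len_mul hWS) !odd_len_refl.
have := inv_self hWS rw; rewrite {1}/w !(inv_mul hWS) // ?invgM !(reflV hWS) //.
have E1 : a * w * a = t * b * a by rewrite /w !mulgA (refl_invol hWS) // mul1g.
have E2 : t * a * w * (a * t) = b * a * t.
  by rewrite /w !mulgA -(mulgA t a a) (refl_invol hWS ra) mulg1 (refl_invol hWS rt) mul1g.
rewrite E1 E2 !canonical_invE //; last first.
- by rewrite -E1; apply: GM => //; apply: GM.
- by rewrite -E1; apply: (refl_conj_refl hWS).
- by rewrite -E2 -!mulgA; do !apply: GM.
- have -> : b * a * t = t * a * w * (t * a)^-1 by rewrite -E2 invgM !(reflV hWS).
  exact: refl_conj.
case: eqP => [/esym E|_]; first by case: tb; apply: (@mulIg _ b); rewrite (refl_invol hWS rb) -[LHS](mulKg a) (mulgA a) -/w E mulVg.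
case: eqP => [/esym E|_]; first by case: ab; apply: (@mulgI _ b); rewrite (refl_invol hWS rb) -[LHS](mulKg t) (mulgA t) E mulVg.
case: eqP => [/esym E|_] //; case: ta; apply: (@mulgI _ a); rewrite (refl_invol hWS ra).
by rewrite -[LHS](mulKg b) (mulgA b) E mulVg.
Qed.

Definition alternating a b t :=
  exists i, t = (a * b) ^+ i * a \/ t = (b * a) ^+ i * b.

Lemma alternating_sym a b t : alternating a b t -> alternating b a t.
Proof. by move=> [i []->]; exists i; [right|left]. Qed.

Lemma alternating_conj a b t r : a * a = 1 -> b * b = 1 ->
  alternating a b t -> alternating a b r -> alternating a b (r * t * r).
Proof.
move=> a2 b2; wlog [i ->] : a b a2 b2 / exists i, r = (a * b) ^+ i * a.
  move=> th at_ ar; case: (ar) => i [rE|rE]; first by apply: th => //; exists i.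
  by apply: alternating_sym; apply: th; rewrite //; [exists i|exact: alternating_sym..].
have ja c d s : c * c = 1 -> d * d = 1 -> alternating c d s -> alternating c d (c * s * c).
  move=> c2 d2 [[|j]] [->|->]; rewrite ?expg0 ?mul1g.
  - by exists 0%N; left; rewrite expg0 mul1g c2 mul1g.
  - by exists 1%N; left.
  - by exists j; right; rewrite -!mulgA c2 mulg1 expgS !mulgA c2 mul1g -mulg_expgC.
  by exists j.+2; left; rewrite mulgA mulg_expgC [in RHS]expgSr !mulgA.
move=> alt_t _; elim: i => [|i IH]; first by rewrite expg0 mul1g; apply: ja.
have -> : (a * b) ^+ i.+1 * a * t * ((a * b) ^+ i.+1 * a) =
    a * (b * ((a * b) ^+ i * a * t * ((a * b) ^+ i * a)) * b) * a.
  by rewrite {1}expgS expgSr !mulgA.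
by apply: (ja) => //; apply: alternating_sym; apply: (ja) => //; apply: alternating_sym.
Qed.

(** Take for a a shortest reflection of G and for b a shortest one besides a: the only reflection
    shorter than b can be a, and a b a, being different from a, is not shorter than b. A shortest
    reflection that is not alternating in a and b would be a third canonical one, since conjugating
    an alternating reflection by another gives an alternating one. *)
Lemma dihedral_canonical t1 t2 : reflections S t1 -> reflections S t2 ->
  G t1 -> G t2 -> t1 <> t2 ->
  exists a b, [/\ canonical a, canonical b, a <> b,
    canonical_generators S G = [set a; b] &
    forall t, reflections S t -> G t -> alternating a b t].
Proof.
move=> r1 r2 G1 G2 neq.
have [a [ra Ga] amin] := @min_refl (reflections S `&` G) t1 (conj r1 G1).
have [t0 [[r0 G0] t0a]] : exists t, (reflections S `&` G) t /\ t <> a.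
  have [E|ne] := pselect (t1 = a); last by exists t1; split=> //; split.
  by exists t2; split; [split | rewrite -E => /esym].
have [b [[rb Gb] ba] bmin] :=
  @min_refl [set t | (reflections S `&` G) t /\ t <> a] t0 (conj (conj r0 G0) t0a).
have ca : canonical a.
  by apply: canonical_of_minimal => // r rr Gr; rewrite ltnNge amin.
have cb : canonical b.
  apply: canonical_of_minimal => // r rr Gr l1 l2.
  have ra' : r = a by apply: contrapT => ra'; move: l1; rewrite ltnNge bmin.
  move: l2; rewrite ltnNge bmin // ra'; split; first split.
  - exact: (refl_conj_refl hWS).
  - by apply: GM => //; apply: GM.
  by rewrite -mulgA -[RHS]mulg1 => /mulgI/mulg1_eq; rewrite (reflV hWS rb).
exists a, b; split=> //; first by move=> /esym.
  apply/seteqP; split=> [t /canonical_generatorsP ct|t [->|->]].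
  - by apply: canonical_at_most2 => // /esym.
  - exact/canonical_generatorsP.
  exact/canonical_generatorsP.
move=> t rt Gt; apply: contrapT => nalt.
have [t' [[rt' Gt'] nalt'] tmin] := @min_refl
  [set t | (reflections S `&` G) t /\ ~ alternating a b t] t (conj (conj rt Gt) nalt).
have ct : canonical t'.
  apply: canonical_of_minimal => // r rr Gr l1 l2.
  have altr : alternating a b r.
    by apply: contrapT => nr; move: l1; rewrite ltnNge tmin.
  move: l2; rewrite ltnNge tmin //; split; first split.
  - exact: (refl_conj_refl hWS).
  - by apply: GM => //; apply: GM.
  move=> alt'; apply: nalt'.
  have -> : t' = r * (r * t' * r) * r.
    by rewrite !mulgA (refl_invol hWS rr) mul1g -mulgA (refl_invol hWS rr) mulg1.
  by apply: alternating_conj => //; apply: (refl_invol hWS).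
have [//|E|E] := canonical_at_most2 ca cb ct _; first by move=> /esym.
  by apply: nalt'; exists 0%N; left; rewrite expg0 mul1g.
by apply: nalt'; exists 0%N; right; rewrite expg0 mul1g.
Qed.

End Dihedral.

Section OrderDihedral.
Local Open Scope group_scope.
Variables (W : groupType) (S G : set W).
Hypotheses (hWS : coxeter_system S) (hG : is_subgroup G).
Implicit Types (a b t r x y : W).

Let GM x y : G x -> G y -> G (x * y). Proof. by case: hG => _ GM _; apply: GM. Qed.

Let GV x : G x -> G x^-1. Proof. by case: hG => _ _; apply. Qed.

Lemma order_gt_le x m n : (m <= n)%N -> order_gt x n -> order_gt x m.
Proof. by move=> mn xn k /andP[k0 km]; apply: xn; rewrite k0 (leq_trans km). Qed.

Section Words.
Variables a b : W.
Hypotheses (ca : canonical S G a) (cb : canonical S G b).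

Let ra : reflections S a. Proof. by case: ca. Qed.
Let rb : reflections S b. Proof. by case: cb. Qed.
Let Ga : G a. Proof. by case: ca. Qed.
Let Gb : G b. Proof. by case: cb. Qed.
Let a2 : a * a = 1. Proof. exact: (refl_invol hWS). Qed.
Let b2 : b * b = 1. Proof. exact: (refl_invol hWS). Qed.
Local Notation p i := ((a * b) ^+ i * a).
Local Notation q i := ((b * a) ^+ i * b).

Lemma altE l : q l = (a * b) ^- l.+1 * a.
Proof. by rewrite expgV_swap // expgSr -!mulgA a2 mulg1. Qed.

Lemma order_gt_swap n : order_gt (a * b) n -> order_gt (b * a) n.
Proof.
move=> o k kn E; apply: (o k kn); apply: (@mulgI _ ((b * a) ^+ k)).
by rewrite -{1}expgV_swap // mulVg E mulg1.
Qed.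

Lemma alt_neq i l n : order_gt (a * b) n -> (i < l <= n)%N -> p i <> p l.
Proof.
move=> o /andP[il ln] /mulIg E; apply: (o (l - i)%N); first by lia.
by rewrite expgnFr 1?ltnW // E mulgV.
Qed.

Lemma alt_neq2 i l n : order_gt (a * b) n -> (i + l < n)%N -> p i <> q l.
Proof.
move=> o iln; rewrite altE => /mulIg E; apply: (o (i + l.+1)%N); first by lia.
by rewrite expgnDr E mulVg.
Qed.

Lemma alt_conj_alt i x : p i * (x * a) * p i = (a * b) ^+ i * (a * x * a^-1) * (a * b) ^+ i * a.
Proof. by rewrite (involV a2) !mulgA. Qed.

Lemma conjV_rot l : a * (a * b) ^+ l * a^-1 = (a * b) ^- l.
Proof. by rewrite expgV_swap // (involV a2) -mulgA -mulg_expgC mulgA a2 mul1g. Qed.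

Lemma alt_mul3_le i l : (l <= i.*2)%N -> p i * p l * p i = p (i.*2 - l)%N.
Proof.
move=> li; rewrite alt_conj_alt conjV_rot expgnFr // -addnn expgnDr; congr (_ * _).
by rewrite -!mulgA; congr (_ * _); rewrite -expVgn; apply/commuteX/commute_sym/commuteX/commuteV.
Qed.

Lemma alt_mul3_gt i l : (i.*2 < l)%N -> p i * p l * p i = q (l - i.*2.+1)%N.
Proof.
move=> il; rewrite alt_conj_alt conjV_rot altE subnSK //; congr (_ * _).
have {1}-> : l = (i + (l - i.*2) + i)%N by lia.
by rewrite !expgnDr !invgM !mulgA mulgV mul1g mulgVK.
Qed.

Lemma alt_mul3_swap i l : p i * q l * p i = p (i.*2 + l).+1.
Proof.
rewrite altE alt_conj_alt; congr (_ * _).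
have -> : a * (a * b) ^- l.+1 * a^-1 = (a * b) ^+ l.+1.
  by apply: invg_inj; rewrite !invgM !invgK mulgA conjV_rot.
by rewrite -!expgnDr; congr (_ ^+ _); lia.
Qed.

Let Gab k : G ((a * b) ^+ k).
Proof.
elim: k => [|k IH]; first by case: hG; rewrite expg0.
by rewrite expgS; do 2?apply: GM.
Qed.

(** The generators a and b need not be simple, but within G their inversion sets are the singletons
    {a} and {b}. So on G the cocycle rule works as for a word in simple generators. *)
Lemma inv_rotation n r : reflections S r -> G r ->
  inv S ((a * b) ^+ n) r = \big[addb/false]_(l < n.*2) (p l == r).
Proof.
move=> rr Gr.
elim: n => [|n IH].
  by rewrite big_ord0 expg0 /inv mulg1 (len1 hWS) ltn0.
rewrite expgSr (inv_mul hWS) // IH doubleS !big_ord_recr /= -addbA; congr (_ (+) _).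
have rr' := refl_conjV ((a * b) ^+ n) rr.
have Gr' : G ((a * b) ^- n * r * (a * b) ^+ n) by do 2?apply: GM => //; apply: GV.
have rr2 := refl_conjV a rr'.
have Gr2 : G (a^-1 * ((a * b) ^- n * r * (a * b) ^+ n) * a) by do 2?apply: GM => //; apply: GV.
rewrite (inv_mul hWS) // (canonical_invE hWS ca) // (canonical_invE hWS cb) //.
rewrite !eq_conjV alt_conj // -alt_conj2 // (involV a2) !mulgA.
by [].
Qed.

Lemma inv_alt i r : reflections S r -> G r ->
  inv S (p i) r = \big[addb/false]_(l < i.*2.+1) (p l == r).
Proof.
move=> rr Gr.
rewrite (inv_mul hWS) // inv_rotation // big_ord_recr /=; congr (_ (+) _).
rewrite (canonical_invE hWS ca) //; first by rewrite eq_conjV alt_conj.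
  exact: refl_conjV.
by do 2?apply: GM => //; apply: GV.
Qed.

Lemma inv_altP i l : order_gt (a * b) i.*2 -> (l <= i.*2)%N ->
  reflections S (p l) -> G (p l) -> inv S (p i) (p l).
Proof.
move=> o li rl Gl; rewrite inv_alt // (bigD1 (Ordinal (li : l < i.*2.+1)%N)) //=.
rewrite eqxx big1 // => -[k ki] /= kl; apply/eqP => E.
have {kl} : k != l by apply: contra kl => /eqP kl; apply/eqP/val_inj.
rewrite neq_ltn => /orP[kl|lk]; first by apply: (alt_neq o _ E); rewrite kl.
by apply: (alt_neq o _ (esym E)); rewrite lk.
Qed.

Lemma inv_altN i r : (forall l, (l <= i.*2)%N -> p l <> r) ->
  reflections S r -> G r -> inv S (p i) r = false.
Proof.
by move=> ne rr Gr; rewrite inv_alt // big1 // => -[l li] _; apply/eqP/ne.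
Qed.

Let order_reduce : (forall n, order_gt (a * b) n) \/
  exists m, [/\ (0 < m)%N, (a * b) ^+ m = 1 & order_gt (a * b) m.-1].
Proof.
have [ex|nex] := pselect (exists n, (0 < n)%N && ((a * b) ^+ n == 1)).
  right; case: (ex_minnP ex) => m /andP[m0 /eqP mE] mmin; exists m; split=> //.
  by move=> k /andP[k0 km] kE; have := mmin k; rewrite k0 kE eqxx => /(_ isT); lia.
left=> n k /andP[k0 _] kE; apply: nex; exists k; by rewrite k0 kE eqxx.
Qed.

Let alt_mod m r : (0 < m)%N -> (a * b) ^+ m = 1 -> alternating a b r ->
  exists2 l, (l < m)%N & r = p l.
Proof.
move=> m0 mE [l0 rE].
suff [l ->] : exists l, r = p l.
  exists (l %% m)%N; first by rewrite ltn_mod.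
  by rewrite {1}(divn_eq l m) expgnDr mulnC expgnA mE expg1n mul1g.
case: rE => ->; first by exists l0.
exists (l0.+1 * m - l0.+1)%N; rewrite altE; congr (_ * _).
by rewrite expgnFr ?leq_pmulr // mulnC expgnA mE expg1n mul1g.
Qed.

(** Of the two ways to reach t from the ends of the chain, take the shorter. The bound on the order
    makes p_0, ..., p_(2i) distinct, so that nothing cancels in N(p_i). *)
Lemma alt_short t : alternating a b t ->
  exists2 i, order_gt (a * b) i.*2 & t = p i \/ t = q i.
Proof.
case: order_reduce => [inf [i tE]|[m [m0 mE om]] /(alt_mod m0 mE)[l lm ->]].
  by exists i.
have [lt|ge] := ltnP l.*2 m.
  by exists l; [apply: order_gt_le om; lia | left].
exists (m - l.+1)%N; first by apply: order_gt_le om; lia.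
right; rewrite altE subnSK //; congr (_ * _).
by apply: invg_inj; rewrite invgK expgnFr 1?ltnW // mE mul1g.
Qed.

(** The index of r lies in 0, ..., 2i, is negative, or exceeds 2i. In the last two cases the
    [order_gt] bounds keep r apart from p_0, ..., p_(2i). *)
Lemma alt_cases i r : alternating a b r ->
  [\/ exists2 l, (l <= i.*2)%N & r = p l,
      exists2 l, order_gt (a * b) (i.*2 + l).+1 & r = q l |
      exists l, [/\ (i.*2 < l)%N, order_gt (a * b) l & r = p l]].
Proof.
case: order_reduce => [inf [l [->|->]]|[m [m0 mE om]] /(alt_mod m0 mE)[l lm ->]].
- by have [le|gt] := leqP l i.*2; [apply: Or31; exists l | apply: Or33; exists l].
- by apply: Or32; exists l.
have [le|gt] := leqP l i.*2; first by apply: Or31; exists l.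
by apply: Or33; exists l; split=> //; apply: order_gt_le om; lia.
Qed.

(* With p_i = (ab)^i a and q_j = (ba)^j b, one has p_i p_l p_i = p_(2i-l), where
   p_(-1-j) = q_j, and N(p_i) consists of p_0, ..., p_(2i). *)
Lemma dihedral_chain_inv (lt : rel W) i r : dihedral_chain lt a b ->
  (forall x y, reflections S x -> reflections S y -> lt x y -> ~~ lt y x) ->
  order_gt (a * b) i.*2 -> reflections S r -> G r -> alternating a b r ->
  r <> p i -> inv S (p i) r = lt r (p i) (+) lt (p i * r * p i) (p i).
Proof.
move=> [ch1 _ ch3] asym oi rr Gr altr rneq.
have ri : reflections S (p i) by apply: refl_alt.
have rirr : reflections S (p i * r * p i) by apply: (refl_conj_refl hWS).
have ltF x y : reflections S x -> reflections S y -> lt y x -> lt x y = false.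
  by move=> rx ry /asym => /(_ ry rx)/negbTE.
have oi' : order_gt (a * b) i by apply: order_gt_le oi; lia.
case: (alt_cases i altr) => [[l li rE]|[l ol rE]|[l [il ol rE]]]; subst r.
- have il : i != l by apply/eqP => E; apply: rneq; rewrite E.
  rewrite inv_altP //; move: rirr; rewrite alt_mul3_le // => rirr.
  have ol : order_gt (a * b) l by apply: order_gt_le oi; lia.
  have [lt1|lt1|E] := ltngtP i l; last by rewrite E eqxx in il.
    by rewrite ltF ?ch1 //; lia.
  have lt2 : (i < i.*2 - l)%N by lia.
  rewrite ch1 // ltF //; apply: ch1 => //.
  by apply: order_gt_le oi; lia.
- rewrite inv_altN //; last first.
    by move=> k ki; apply: (alt_neq2 ol); lia.
  move: rirr; rewrite alt_mul3_swap => rirr.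
  rewrite (ltF _ _ rr ri); last by apply: ch3; apply: order_gt_le ol; lia.
  by rewrite (ltF _ _ rirr ri) //; apply: ch1 => //; lia.
rewrite inv_altN //; last first.
  by move=> k ki; apply: (alt_neq ol); lia.
move: rirr; rewrite alt_mul3_gt // => rirr.
rewrite (ltF _ _ rr ri); last by apply: ch1 => //; lia.
by rewrite (ltF _ _ rirr ri) //; apply: ch3; apply: order_gt_le ol; lia.
Qed.

End Words.

Lemma dihedral_chain_rev (lt : rel W) a b : canonical S G a -> canonical S G b ->
  dihedral_chain lt a b -> dihedral_chain (fun x y => lt y x) b a.
Proof.
move=> ca cb [ch1 ch2 ch3]; split=> [i j ij /(order_gt_swap cb ca)|i j ij /(order_gt_swap cb ca)|i j].
- exact: ch2.
- exact: ch1.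
by move/(order_gt_swap cb ca); rewrite addnC; apply: ch3.
Qed.

End OrderDihedral.

(** * Inversions of a reflection, read off from the reflection ordering *)

Section ReflectionOrder.
Local Open Scope group_scope.
Variables (W : groupType) (S : set W) (lt : rel W).
Hypotheses (hWS : coxeter_system S) (hlt : reflection_order S lt).
Implicit Types (t r : W).

Lemma refl_order_asym t r : reflections S t -> reflections S r ->
  lt t r -> ~~ lt r t.
Proof.
case: hlt => irr trans _ _ rt rr tr; apply/negP => rt'.
by move/negP: (irr t rt); apply; apply: trans tr rt'.
Qed.

Lemma refl_order_total t r : reflections S t -> reflections S r -> t <> r ->
  lt r t = ~~ lt t r.
Proof.
move=> rt rr ne; case: (hlt) => _ _ tot _; have [tr|rt'] := tot _ _ rt rr ne.
  by rewrite tr (negbTE (refl_order_asym rt rr tr)).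
by rewrite rt' refl_order_asym.
Qed.

Lemma refl_order_inv t r : reflections S t -> reflections S r -> r <> t ->
  inv S t r = lt r t (+) lt (t * r * t) t.
Proof.
move=> rt rr rneq; pose G := Defs.generated [set t; r].
have hG : is_subgroup G by apply: generated_subgroup.
have Gt : G t by apply: mem_generated; left.
have Gr : G r by apply: mem_generated; right.
have Godd x : G x -> odd (len S x) -> reflections S x.
  exact: (generated2_odd hWS).
have tneq : t <> r by move=> /esym.
have [a [b [ca cb ab genE alt]]] := dihedral_canonical hWS hG Godd rt rr Gt Gr tneq.
have ch : dihedral_chain lt a b \/ dihedral_chain lt b a.
  by case: hlt => _ _ _ dih; apply: (dih t r).
have trtneq : t * r * t <> t.
  by rewrite -{3}[t]mul1g => /mulIg/mulg1_eq; rewrite (reflV hWS rt) => /esym.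
have rtrt : reflections S (t * r * t) by apply: (refl_conj_refl hWS).
have core (R : rel W) c d : canonical S G c -> canonical S G d ->
    (forall s, reflections S s -> G s -> alternating c d s) ->
    (forall x y, reflections S x -> reflections S y -> R x y -> ~~ R y x) ->
    dihedral_chain R c d -> (exists2 i, order_gt (c * d) i.*2 & t = (c * d) ^+ i * c) ->
    inv S t r = R r t (+) R (t * r * t) t.
  move=> cc cd altcd asym chR [i oi tE]; move: (rneq); rewrite tE => rneq'.
  exact: (dihedral_chain_inv hWS hG cc cd chR asym oi rr Gr (altcd r rr Gr)).
have rev_asym x y : reflections S x -> reflections S y -> lt y x -> ~~ lt x y.
  by move=> *; apply: refl_order_asym.
(* Reversing the ordering negates both terms and leaves their sum unchanged. This permits exchanging
   a and b when t lies nearer to the other end of the chain. *)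
have xorN : lt t r (+) lt t (t * r * t) = lt r t (+) lt (t * r * t) t.
  rewrite (refl_order_total rr rt rneq) (refl_order_total rtrt rt trtneq).
  by rewrite addNb addbN negbK.
have key c d : canonical S G c -> canonical S G d ->
    (forall s, reflections S s -> G s -> alternating c d s) -> dihedral_chain lt c d ->
    inv S t r = lt r t (+) lt (t * r * t) t.
  move=> cc cd altcd chcd; have [i oi [tE|tE]] := alt_short hWS cc cd (altcd t rt Gt).
    by apply: (core lt c d) => //; [exact: refl_order_asym | exists i].
  rewrite -xorN; apply: (core (fun x y => lt y x) d c) => //.
  - by move=> s rs Gs; apply/alternating_sym/altcd.
  - exact: (dihedral_chain_rev hWS cc cd).
  by exists i => //; apply: (order_gt_swap hWS cc cd).
case: ch => ch; first exact: (key a b).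
by apply: (key b a) => // s rs Gs; apply/alternating_sym/alt.
Qed.

Lemma reflection_order_rev : reflection_order S (fun x y => lt y x).
Proof.
case: (hlt) => irr trans tot dih; split=> //.
- by move=> t1 t2 t3 r1 r2 r3 l12 l23; apply: trans l23 l12.
- by move=> t1 t2 r1 r2 /(tot _ _ r1 r2)[]; [right|left].
move=> t1 t2 a b r1 r2 ne ab genE.
pose G := Defs.generated [set t1; t2].
have can c : [set a; b] c -> canonical S G c.
  by rewrite -genE => /(canonical_generatorsP G hWS).
have ca := can a (or_introl erefl); have cb := can b (or_intror erefl).
have [ch|ch] := dih _ _ _ _ r1 r2 ne ab genE.
  by right; apply: (dihedral_chain_rev hWS ca cb).
by left; apply: (dihedral_chain_rev hWS cb ca).
Qed.

End ReflectionOrder.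

(** * Bruhat paths and the recursion for increasing paths *)

Section BruhatPaths.
Local Open Scope group_scope.
Variables (W : groupType) (S : set W).
Hypothesis hWS : coxeter_system S.
Implicit Types (s t u v w x y : W) (p q : seq W).

Lemma bruhat_edgeE x y :
  bruhat_edge S x y <-> exists2 t, reflections S t & y = t * x /\ (len S x < len S y)%N.
Proof.
split=> [[r l]|[t r [-> l]]]; last by split; rewrite ?mulgK.
by exists (y * x^-1); rewrite ?mulgVK.
Qed.

(** Every inversion is attached to a letter of one fixed expression of w. The finiteness of lower
    intervals and of sets of paths rests on this. *)
Lemma inv_finite w : finite_set [set t | reflections S t /\ inv S w t].
Proof.
have [N [_ _ Nsplit NE]] := inv_cocycle_exists hWS.
have [e we _] := reduced_exists hWS w.
pose f i := (\prod_(x <- take i e) x) * nth 1 e i * (\prod_(x <- take i e) x)^-1.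
apply: (@sub_finite_set _ _ [set` [seq f i | i <- iota 0 (size e)]]); last exact: finite_seq.
move=> t [rt]; rewrite -NE // => Nwt.
have [x [s [y [e1 [e2 [[[_ xE] Ss ye2] [eE wE tE]]]]]]] := Nsplit _ _ _ Nwt we.
apply/mapP; exists (size e1).
  by rewrite mem_iota eE size_cat /= addnS leq_addr.
by rewrite /f eE take_size_cat // xE nth_cat ltnn subnn.
Qed.

Lemma predecessors_finite v : finite_set [set x | bruhat_edge S x v].
Proof.
apply: sub_finite_set (finite_image (fun t => t * v) (inv_finite v)) => x.
move=> /bruhat_edgeE[t rt [-> l]]; exists t.
  by split=> //; rewrite /inv mulgA (refl_invol hWS rt) mul1g.
by rewrite mulgA (refl_invol hWS rt) mul1g.
Qed.

Lemma bruhat_path_nil u v : bruhat_path S u v [::] <-> u = v.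
Proof. by split=> [[]|->]. Qed.

Lemma bruhat_path_cons u v x p :
  bruhat_path S u v (x :: p) <-> bruhat_edge S u x /\ bruhat_path S x v p.
Proof.
split=> [[/= /andP[/asboolP ux pp] l]|[ux [pp l]]]; first by split.
by split=> //=; rewrite pp andbT; apply/asboolP.
Qed.

Lemma bruhat_path_cat u v p q :
  bruhat_path S u v (p ++ q) <-> bruhat_path S u (last u p) p /\ bruhat_path S (last u p) v q.
Proof.
rewrite /bruhat_path cat_path last_cat; split=> [[/andP[]]|[[-> _] [-> ->]]] //.
Qed.

Lemma bruhat_path_len u v p : bruhat_path S u v p -> (len S u + size p <= len S v)%N.
Proof.
elim: p u => [|x p IH] u; first by move/bruhat_path_nil->; rewrite addn0.
by move=> /bruhat_path_cons[[_ ux] /IH]; rewrite /=; lia.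
Qed.

Lemma bruhat_path_odd u v p : bruhat_path S u v p ->
  odd (size p) = odd (len S u) (+) odd (len S v).
Proof.
elim: p u => [|x p IH] u; first by move/bruhat_path_nil->; rewrite addbb.
move=> /bruhat_path_cons[/bruhat_edgeE[t rt [xE _]] /IH /= ->].
by rewrite xE (odd_len_mul hWS) (odd_len_refl hWS rt) /= addNb negbK.
Qed.

Lemma bruhat_le_refl u : bruhat_le S u u.
Proof. by exists [::]; split. Qed.

Lemma bruhat_le_trans u v w : bruhat_le S u v -> bruhat_le S v w -> bruhat_le S u w.
Proof.
move=> [p up] [q vq]; exists (p ++ q); apply/bruhat_path_cat.
by case: (up) => _ ->.
Qed.

Lemma bruhat_le_len u v : bruhat_le S u v -> (len S u <= len S v)%N.
Proof. by move=> [p /bruhat_path_len]; apply: leq_trans; rewrite leq_addr. Qed.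

Lemma bruhat_le_edge u v : bruhat_edge S u v -> bruhat_le S u v.
Proof. by move=> uv; exists [:: v]; apply/bruhat_path_cons; split=> //; split. Qed.

Lemma bruhat_path_le u v p x : bruhat_path S u v p -> x \in u :: p ->
  bruhat_le S x v.
Proof.
elim: p u => [|y p IH] u pp.
  by rewrite inE => /eqP->; exists [::].
rewrite inE => /orP[/eqP->|]; first by exists (y :: p).
by apply: IH; case/bruhat_path_cons: pp.
Qed.

Let paths_to_finite n v :
  finite_set [set up : W * seq W | bruhat_path S up.1 v up.2 /\ size up.2 = n].
Proof.
elim: n v => [|n IH] v.
  apply: (@sub_finite_set _ _ [set (v, [::])]); last exact: finite_set1.
  by move=> [u p] /= [pp /size0nil p0]; move: pp; rewrite p0 => /bruhat_path_nil ->.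
pose F x := (fun up : W * seq W => (up.1, rcons up.2 v)) @`
  [set up : W * seq W | bruhat_path S up.1 x up.2 /\ size up.2 = n].
apply: (@sub_finite_set _ _ (\bigcup_(x in [set x | bruhat_edge S x v]) F x)); last first.
  apply: bigcup_finite; first exact: predecessors_finite.
  by move=> x _; apply/finite_image/IH.
move=> [u p] /= []; case/lastP: p => [|p z] // pp; rewrite size_rcons => -[sz].
move: pp; rewrite -cats1 => /bruhat_path_cat[pp /bruhat_path_cons[e /bruhat_path_nil zv]].
by exists (last u p); rewrite ?zv //=; [rewrite -zv | exists (u, p) => //=; rewrite cats1].
Qed.

Lemma paths_finite n u v : finite_set [set p | bruhat_path S u v p /\ size p = n].
Proof.
apply: sub_finite_set (finite_image snd (paths_to_finite n v)) => p pp.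
by exists (u, p).
Qed.

Lemma all_paths_finite u v : finite_set [set p | bruhat_path S u v p].
Proof.
apply: (@sub_finite_set _ _ (\bigcup_(n in `I_(len S v).+1)
   [set p | bruhat_path S u v p /\ size p = n])).
  move=> p pp; exists (size p) => //=; have := bruhat_path_len pp; lia.
by apply: bigcup_finite; [exact: finite_II | move=> n _; apply: paths_finite].
Qed.

Lemma below_finite v : finite_set [set x | bruhat_le S x v].
Proof.
apply: (@sub_finite_set _ _ (\bigcup_(n in `I_(len S v).+1)
   fst @` [set up : W * seq W | bruhat_path S up.1 v up.2 /\ size up.2 = n])).
  move=> u [p pp]; exists (size p) => /=; first by have := bruhat_path_len pp; lia.
  by exists (u, p).
apply: bigcup_finite; first exact: finite_II.
by move=> n _; apply/finite_image/paths_to_finite.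
Qed.

Definition below v : seq W := fset_set [set x | bruhat_le S x v].
Definition paths n u v : seq (seq W) :=
  fset_set [set p | bruhat_path S u v p /\ size p = n].

Lemma belowP v x : reflect (bruhat_le S x v) (x \in below v).
Proof. by rewrite in_fset_set ?inE; [apply: asboolP | apply: below_finite]. Qed.

Lemma pathsP n u v p : reflect (bruhat_path S u v p /\ size p = n) (p \in paths n u v).
Proof. by rewrite in_fset_set ?inE; [apply: asboolP | apply: paths_finite]. Qed.

Lemma below_uniq v : uniq (below v). Proof. exact: fset_uniq. Qed.

Lemma paths_uniq n u v : uniq (paths n u v). Proof. exact: fset_uniq. Qed.

(** Nothing is listed twice: the length k fixes the first piece, and its last vertex is the
    midpoint. *)
Lemma paths_cat k m u v : perm_eq (paths (k + m) u v)
  [seq q | a <- below v, q <- [seq p1 ++ p2 | p1 <- paths k u a, p2 <- paths m a v]].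
Proof.
apply: uniq_perm; first exact: paths_uniq.
  apply: allpairs_uniq_dep; first exact: below_uniq.
    move=> a _; apply: allpairs_uniq; try exact: paths_uniq.
    move=> [p1 p2] [q1 q2] /allpairsP[[? ?] /= [/pathsP[_ s1] _ [-> ->]]].
    move=> /allpairsP[[? ?] /= [/pathsP[_ s2] _ [-> ->]]] /eqP.
    by rewrite eqseq_cat ?s1 ?s2 // => /andP[/eqP-> /eqP->].
  move=> [a1 q1] [a2 q2] /allpairsPdep[a1' [q1' [_ /allpairsP[[p1 p2] /= [/pathsP[[_ l1] s1] _ ->]] [-> ->]]]].
  move=> /allpairsPdep[a2' [q2' [_ /allpairsP[[p3 p4] /= [/pathsP[[_ l2] s2] _ ->]] [-> ->]]]] /= /eqP.
  rewrite eqseq_cat ?s1 ?s2 // => /andP[/eqP E1 /eqP E2].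
  by rewrite -l1 -l2 E1 E2.
move=> p; apply/pathsP/allpairsPdep => [[pp sz]|].
  exists (last u (take k p)), p; split=> //.
    apply/belowP; exists (drop k p).
    by move: pp; rewrite -{1}(cat_take_drop k p) => /bruhat_path_cat[].
  apply/allpairsP; exists (take k p, drop k p); rewrite /= cat_take_drop.
  move: pp; rewrite -{1}(cat_take_drop k p) => /bruhat_path_cat[p1 p2].
  split=> //; apply/pathsP; split=> //; first by rewrite size_takel // sz leq_addr.
  by rewrite size_drop sz addKn.
move=> [a [q [_ /allpairsP[[p1 p2] /= [/pathsP[pp1 s1] /pathsP[pp2 s2] ->]] ->]]].
split; last by rewrite size_cat s1 s2.
by apply/bruhat_path_cat; case: (pp1) => _ ->.
Qed.

Lemma big_paths_cat (R : Type) (idx : R) (op : Monoid.com_law idx)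
    (F : seq W -> R) k m u v :
  \big[op/idx]_(p <- paths (k + m) u v) F p = \big[op/idx]_(a <- below v)
     \big[op/idx]_(p1 <- paths k u a) \big[op/idx]_(p2 <- paths m a v) F (p1 ++ p2).
Proof.
rewrite (perm_big _ (paths_cat k m u v)) /= big_allpairs_dep.
by apply: eq_bigr => a _; rewrite big_allpairs_dep.
Qed.

Lemma count_sum (T : Type) (a : pred T) (r : seq T) :
  count a r = (\sum_(i <- r) a i)%N.
Proof. by rewrite -sum1_count big_mkcond; apply: eq_bigr => i _; case: (a i). Qed.

Lemma count_paths_cat (P : pred (seq W)) (Q : W -> pred (seq W)) k m u v :
  count (fun p => P (take k p) && Q (last u (take k p)) (drop k p)) (paths (k + m) u v) =
  (\sum_(a <- below v) count P (paths k u a) * count (Q a) (paths m a v))%N.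
Proof.
rewrite count_sum big_paths_cat; apply: eq_bigr => a _.
rewrite !count_sum big_distrl /=; apply: eq_big_seq => p1 /pathsP[[_ l1] s1].
rewrite big_distrr /=; apply: eq_bigr => p2 _.
by rewrite -s1 take_size_cat // drop_size_cat // l1 mulnb.
Qed.

End BruhatPaths.

(** * Operators attached to edges and to generators, and the recursion for increasing paths *)

Section IncreasingPaths.
Local Open Scope group_scope.
Variables (W : groupType) (S : set W) (lt : rel W).
Hypotheses (hWS : coxeter_system S) (hlt : reflection_order S lt).
Implicit Types (s t u v w x y : W) (p q : seq W) (ts : seq W).
Implicit Types (phi : W -> {poly int}).

Definition labels u p : seq W := pairmap (fun x y => y * x^-1) u p.
Definition increasing u p : bool := sorted lt (labels u p).

Let ltT t1 t2 t3 : reflections S t1 -> reflections S t2 -> reflections S t3 ->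
  lt t1 t2 -> lt t2 t3 -> lt t1 t3.
Proof. by case: hlt => _ tr _ _; apply: tr. Qed.

Let lt_irr t : reflections S t -> lt t t = false.
Proof. by case: hlt => irr _ _ _ /irr/negbTE. Qed.

Lemma refl_labels u v p t : bruhat_path S u v p -> t \in labels u p -> reflections S t.
Proof.
elim: p u => [|x p IH] u //= /bruhat_path_cons[[r _] /IH]; rewrite inE => H.
by move=> /orP[/eqP->|/H].
Qed.

Definition up t u : bool := (len S u < len S (t * u))%N.

(** A function [phi] stands for a linear form on Z[q][W], and the operators act by composition with
    it. Hence the outermost factor of [edge_ops] is the least label, which belongs to the first step
    of a path. *)
Definition edge_op t phi u : {poly int} := (phi u + (up t u)%:R * ('X * phi (t * u)%g))%R.
Definition edge_ops ts phi := foldr edge_op phi ts.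
Definition point v u : {poly int} := ((u == v)%:R)%R.

Let IP ts u v := [set p | [/\ bruhat_path S u v p, increasing u p &
                              forall t, t \in labels u p -> t \in ts]].

Let IP_finite ts u v : finite_set (IP ts u v).
Proof. by apply: sub_finite_set (all_paths_finite hWS u v) => p []. Qed.

Lemma up_inv t u : reflections S t -> up t u = ~~ inv S u t.
Proof.
move=> rt; rewrite /up /inv -leqNgt ltn_neqAle.
suff -> : len S u != len S (t * u) by [].
apply/eqP => /(congr1 odd); rewrite (odd_len_mul hWS) (odd_len_refl hWS rt).
by case: (odd _).
Qed.


Lemma path_refl_sortedE l ls : reflections S l ->
  (forall t, t \in ls -> reflections S t) ->
  path lt l ls <-> sorted lt ls /\ forall t, t \in ls -> lt l t.
Proof.
elim: ls l => [|k ls IH] l rl rls //=.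
have rk : reflections S k by apply: rls; rewrite inE eqxx.
have rls' t : t \in ls -> reflections S t by move=> h; apply: rls; rewrite inE h orbT.
split=> [/andP[lk pk]|[-> h]]; last by rewrite h ?inE ?eqxx.
have [_ kls] := (IH k rk rls').1 pk.
split=> // t; rewrite inE => /orP[/eqP->//|tls].
by apply: (ltT rl rk (rls' t tls) lk); apply: kls.
Qed.

(** The least label t can occur only as the first one, so a path either avoids t or starts with the
    edge from u to t u, and continues with larger labels. *)
Lemma edge_ops_paths ts u v : (forall t, t \in ts -> reflections S t) ->
  sorted lt ts ->
  edge_ops ts (point v) u = (\sum_(p \in IP ts u v) ('X^(size p) : {poly int}))%R.
Proof.
elim: ts u => [|t ts IH] u rts.
  move=> _; rewrite /= /point; have [->|/eqP ne] := eqVneq u v.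
    have -> : IP [::] v v = [set [::]].
      apply/seteqP; split=> [[|x p] // [_ _ h]|p ->]; last by split.
      by have := h (x * v^-1); rewrite /= inE eqxx => /(_ isT).
    by rewrite fsbig_set1 expr0.
  have -> : IP [::] u v = set0; last by rewrite fsbig_set0.
  apply/seteqP; split=> [[|x p] // [pp _ h]|p //]; first by case: ne; case: pp.
  by have := h (x * u^-1); rewrite /= inE eqxx => /(_ isT).
have rt : reflections S t by apply: rts; rewrite inE eqxx.
have rts' r : r \in ts -> reflections S r by move=> h; apply: rts; rewrite inE h orbT.
move=> /(path_refl_sortedE rt rts')[srt lt_t].
have tts : t \notin ts by apply/negP => /lt_t; rewrite lt_irr.
rewrite /= /edge_op !IH //.
have step x p : IP (t :: ts) u v (x :: p) -> x * u^-1 <> t -> IP ts u v (x :: p).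
  move=> [pp ip h] ne; split=> // r rl; have := h r rl; rewrite inE => /orP[/eqP rE|//].
  have [[re _] pp'] := (bruhat_path_cons _ _ _ _ _).1 pp.
  have /(path_refl_sortedE re)[|_ hl] := ip; first by move=> r'; apply: refl_labels pp'.
  have lts : x * u^-1 \in ts.
    by have := h (x * u^-1); rewrite /= !inE eqxx => /(_ isT)/orP[/eqP|].
  move: rl; rewrite rE /= inE => /orP[/eqP/esym //|/hl lt1].
  have := refl_order_asym hlt re rt lt1; by rewrite lt_t.
have sub : IP ts u v `<=` IP (t :: ts) u v.
  by move=> p [pp ip h]; split=> // r /h; rewrite inE => ->; rewrite orbT.
case upE : (up t u); last first.
  rewrite mul0r addr0; apply: eq_fsbigl; apply/seteqP; split; first exact: sub.
  move=> [|x p] h; first by case: h.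
  apply: step => // E; case: h => /bruhat_path_cons[[_ ux] _] _ _.
  by move: upE; rewrite /up -E mulgVK ux.
rewrite mul1r.
have -> : IP (t :: ts) u v = IP ts u v `|` cons (t * u) @` IP ts (t * u) v.
  apply/seteqP; split=> [[|x p] h|p [/sub//|[p' [pp ip h] <-]]].
  - by left; case: h.
  - have [E|] := pselect (x * u^-1 = t); last by left; apply: step.
    have xE : x = t * u by rewrite -E mulgVK.
    case: h => /bruhat_path_cons[[re ux] pp] ip h.
    have /(path_refl_sortedE re)[|ip' hl] := ip; first by move=> r'; apply: refl_labels pp.
    right; exists p; rewrite -xE //; split=> // r rl.
    have := h r; rewrite /= inE rl orbT => /(_ isT); rewrite inE => /orP[/eqP rE|//].
    by have := hl r rl; rewrite E rE lt_irr.
  split.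
  - by apply/bruhat_path_cons; split=> //; split; rewrite ?mulgK.
  - apply/path_refl_sortedE; rewrite ?mulgK //; first by move=> r; apply: refl_labels pp.
    by split=> // r /h; apply: lt_t.
  by move=> r; rewrite /= !inE mulgK => /orP[->//|/h->]; rewrite orbT.
rewrite fsbigU0 //; last first.
- move=> p [[_ _ h] [p' _ pE]]; move: h; rewrite -pE => /(_ t).
  by rewrite /= inE mulgK eqxx => /(_ isT); apply/negP.
- exact: finite_image.
congr (_ + _)%R; rewrite fsbig_image; last by move=> p q _ _ [].
rewrite mulr_fsumr; apply: eq_fsbigr => p _.
by rewrite /= exprS.
Qed.

Definition inc_count n u v : nat := count (increasing u) (paths S n u v).

Lemma edge_ops_coef ts u v n : (forall t, t \in ts -> reflections S t) ->
  sorted lt ts ->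
  (forall x y, bruhat_le S x v -> bruhat_le S y v -> reflections S (y * x^-1) ->
    y * x^-1 \in ts) ->
  ((edge_ops ts (point v) u)`_n)%R = ((inc_count n u v)%:R)%R.
Proof.
move=> rts srt allts; rewrite edge_ops_paths //.
have IPE p : IP ts u v p <-> bruhat_path S u v p /\ increasing u p.
  split=> [[]//|[pp ip]]; split=> // t.
  elim: p u pp {ip} => [|x p IH] u // /[dup] pp /bruhat_path_cons[[re _] pp'].
  rewrite /= inE => /orP[/eqP->|]; last exact: IH.
  by apply: allts => //; apply: (bruhat_path_le pp); rewrite !inE eqxx ?orbT.
rewrite fsbig_finite // coef_sum /=.
under eq_bigr do rewrite coefXn.
rewrite -natr_sum -count_sum; congr (_%:R)%R.
rewrite /inc_count -!size_filter; apply/perm_size/uniq_perm.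
- exact/filter_uniq/fset_uniq.
- exact/filter_uniq/paths_uniq.
move=> p; rewrite !mem_filter in_fset_set //.
apply/andP/andP => [[/eqP-> /set_mem/IPE[pp ip]]|[ip /(pathsP hWS)[pp <-]]].
  by split=> //; apply/(pathsP hWS).
by split=> //; apply/mem_set/IPE.
Qed.

(* [below_in A u s]: u s < u in the order obtained from the Bruhat order by
   reversing the edges labelled by A. *)
Definition below_in (A : pred W) u s : bool :=
  inv S u (u * s * u^-1) (+) A (u * s * u^-1).

Definition gen_op (A : pred W) s phi u : {poly int} :=
  (phi (u * s)%g - (below_in A u s)%:R * ('X * phi u))%R.

Lemma gen_op_edge t s phi u : S s -> reflections S t ->
  gen_op (lt^~ t) s (edge_op t phi) u =
  edge_op t (gen_op (fun r => (r == t) || lt r t) s phi) u.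
Proof.
move=> Ss rt; have rs := refl_gen Ss; have s2 := gen_invol hWS Ss.
have sV : s^-1 = s by apply: (genV hWS).
have t2 := refl_invol hWS rt; have tV : t^-1 = t by apply: (reflV hWS).
pose r := u * s * u^-1; have rr : reflections S r by apply: refl_conj.
rewrite /gen_op /edge_op /below_in !up_inv // -/r.
have tuE : t * u * s * (t * u)^-1 = t * r * t by rewrite /r invgM tV !mulgA.
have inv_us : inv S (u * s) t = inv S u t (+) (r == t).
  rewrite (inv_mul hWS) // (inv_gen hWS Ss); last exact: refl_conjV.
  congr (_ (+) _); rewrite /r.
  by rewrite -(inj_eq (@mulgI _ u)) -(inj_eq (@mulIg _ u^-1)) !mulgA mulgV mul1g mulgK.
(* If r = t, then t u = u s: only u and u s are involved, and the edge between them is reversed on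
   the right-hand side but not on the left. *)
have [rt_eq|/eqP rneq] := eqVneq r t.
  have tu : t * u = u * s by rewrite -rt_eq /r mulgVK.
  have usE : u * s * s * (u * s)^-1 = t.
    by rewrite invgM sV -!mulgA (mulgA s s) s2 mul1g mulgA.
  rewrite inv_us rt_eq eqxx lt_irr // addbT negbK addbF /=.
  rewrite !tu usE inv_us rt_eq eqxx addbT.
  rewrite -tu mulgA t2 mul1g tu -mulgA s2 mulg1 /=.
  case: (inv S u t) => /=; rewrite ?mul0r ?mul1r ?subr0 ?addr0 ?mulrBr.
    by rewrite addrK.
  by rewrite addrNK.
(* Otherwise t goes up from u iff it goes up from u s, and what remains is that [below_in] agrees at
   u and t u. By the cocycle rule this says that r is in N(t) iff t lies between r and t r t, which
   is [refl_order_inv]. *)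
rewrite inv_us (introF eqP rneq) addbF /=.
case itu : (inv S u t); first by rewrite /= !mul0r !addr0.
rewrite /= tuE !mul1r mulgA.
have trtneq : t * r * t <> t.
  by rewrite -{3}[t]mul1g => /mulIg/mulg1_eq; rewrite tV => /esym.
have rtrt : reflections S (t * r * t) by apply: (refl_conj_refl hWS).
rewrite (introF eqP trtneq) /= (inv_mul hWS) // (inv_reflJ hWS) // tV.
have -> : t * (t * r * t) * t = r by rewrite -(mulgA t r t) (mulgA t t) t2 mul1g -(mulgA r t t) t2 mulg1.
rewrite (refl_order_inv hWS hlt rt rr rneq).
have -> : (lt r t (+) lt (t * r * t) t (+) inv S u r (+) lt (t * r * t) t) =
   inv S u r (+) lt r t.
  by case: (lt r t); case: (lt (t * r * t) t); case: (inv S u r).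
case: (_ (+) _); rewrite ?mul0r ?mul1r ?subr0 //.
by rewrite mulrBr [in LHS]mulrDr opprD addrACA.
Qed.

Lemma edge_ops_support ts u v : (forall t, t \in ts -> reflections S t) ->
  edge_ops ts (point v) u != 0%R -> bruhat_le S u v.
Proof.
elim: ts u => [|t ts IH] u rts /=.
  rewrite /point; have [->|_] := eqVneq u v; first by move=> _; apply: bruhat_le_refl.
  by rewrite mulr0n eqxx.
have {}IH x := IH x (fun r h => rts r (mem_behead (s := t :: ts) h)).
rewrite /edge_op; have [->|/IH//] := eqVneq (edge_ops ts (point v) u) 0%R.
rewrite add0r; case upE: (up t u); last by rewrite mul0r eqxx.
rewrite mul1r; have [->|/IH le _] := eqVneq (edge_ops ts (point v) (t * u)) 0%R.
  by rewrite mulr0 eqxx.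
apply: bruhat_le_trans le; apply: bruhat_le_edge; split=> //.
by rewrite mulgK; apply: rts; rewrite inE eqxx.
Qed.

(** Each label of [ts] in turn joins the initial section, by [gen_op_edge]. The hypotheses make A,
    on the conjugates x s x^-1 with x <= v, the section just before [ts], and make the section
    complete after [ts]. *)
Lemma gen_op_edge_ops s v ts (A : pred W) : S s ->
  (forall t, t \in ts -> reflections S t) -> sorted lt ts ->
  (forall x, bruhat_le S x v -> A (x * s * x^-1) = (x * s * x^-1 \notin ts)) ->
  (forall x t, bruhat_le S x v -> t \in ts -> x * s * x^-1 \notin ts -> lt (x * s * x^-1) t) ->
  gen_op A s (edge_ops ts (point v)) =1 edge_ops ts (gen_op xpredT s (point v)).
Proof.
move=> Ss; elim: ts A => [|t ts IH] A rts srt AE ltE u /=.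
  rewrite /gen_op /point; have [->|] := eqVneq u v; last by rewrite !mulr0.
  by rewrite /below_in AE //; apply: bruhat_le_refl.
have rt : reflections S t by apply: rts; rewrite inE eqxx.
have rts' r : r \in ts -> reflections S r by move=> h; apply: rts; rewrite inE h orbT.
have [srt' lt_t] := (path_refl_sortedE rt rts').1 srt.
have tts : t \notin ts by apply/negP => /lt_t; rewrite lt_irr.
have AltE x : bruhat_le S x v -> A (x * s * x^-1) = lt (x * s * x^-1) t.
  move=> xv; rewrite AE //; have [|nin] /= := boolP (_ \in _); last first.
    by rewrite ltE // inE eqxx.
  rewrite inE => /orP[/eqP->|]; first by rewrite lt_irr.
  move=> /[dup] h /lt_t h2; apply/esym/negbTE.
  by apply: (refl_order_asym hlt) => //; apply: rts'.
(* A is known only at elements below v; at any other u the value that [below_in] multiplies is 0. *)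
transitivity (gen_op (lt^~ t) s (edge_op t (edge_ops ts (point v))) u).
  rewrite /gen_op.
  have [->|ne] := eqVneq (edge_op t (edge_ops ts (point v)) u) 0%R; first by rewrite !mulr0.
  rewrite /below_in AltE //.
  by apply: (@edge_ops_support (t :: ts)).
have {}IH x : gen_op (fun r => (r == t) || lt r t) s (edge_ops ts (point v)) x =
    edge_ops ts (gen_op xpredT s (point v)) x.
  apply: IH => // {x} [x xv|x r xv rin nin].
    rewrite -AltE // AE // inE negb_or; case: eqP => [->|//] /=.
    by rewrite tts.
  have [E|/eqP ne] := eqVneq (x * s * x^-1) t; first by rewrite E lt_t.
  by apply: ltE; rewrite // inE ?rin ?orbT // negb_or nin andbT; apply/eqP.
by rewrite gen_op_edge // /edge_op !IH.
Qed.

Lemma sorted_refls (rs : seq W) : (forall t, t \in rs -> reflections S t) ->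
  exists2 ts, sorted lt ts & ts =i rs.
Proof.
move=> rrs; pose le := [rel x y | (x == y) || lt x y].
exists (sort le (undup rs)); last by move=> x; rewrite mem_sort mem_undup.
have mem_rs : all (mem rs) (undup rs) by apply/allP => x; rewrite mem_undup.
have tot : {in mem rs &, total le}.
  move=> x y /rrs rx /rrs ry; rewrite /= (eq_sym y); case: eqP => //= ne.
  by rewrite (refl_order_total hlt rx ry ne) orbN.
have := sort_sorted_in tot mem_rs.
have := sort_uniq le (undup rs); rewrite undup_uniq.
have : forall x, x \in sort le (undup rs) -> reflections S x.
  by move=> x; rewrite mem_sort mem_undup => /rrs.
elim: (sort le (undup rs)) => [|x [|y l] IH] //= rl /andP[nin un] /andP[xy pl].
have /= -> : sorted lt (y :: l).
  by apply: IH => // z zl; apply: rl; rewrite inE zl orbT.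
rewrite andbT.
by case/orP: xy nin => // /eqP->; rewrite inE eqxx.
Qed.

(** Coefficients are compared in [gen_op_edge_ops] with nothing reversed on the left and everything
    on the right, where v s < v turns [point v] into [point (v * s)]. *)
Lemma inc_count_gen n u v s : S s -> (len S (v * s) < len S v)%N ->
  (inc_count n (u * s) v =
   inc_count n u (v * s) +
   (if (len S (u * s) < len S u)%N then (if n is m.+1 then inc_count m u v else 0) else 0))%N.
Proof.
move=> Ss vs; have s2 := gen_invol hWS Ss; have sV := genV hWS Ss.
have rvs : reflections S (v * s * v^-1) by apply/refl_conj/refl_gen.
(* The first list provides all labels of paths to v; the second provides all x s x^-1 with x <= v,
   so that no such conjugate lies outside [ts], in agreement with [pred0]. *)
pose rs := [seq r <- [seq y * x^-1 | x <- below S v, y <- below S v] ++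
                     [seq x * s * x^-1 | x <- below S v] | `[< reflections S r >]].
have [|ts srt tsE] := @sorted_refls rs; first by move=> t; rewrite mem_filter => /andP[/asboolP].
have rts t : t \in ts -> reflections S t by rewrite tsE mem_filter => /andP[/asboolP].
have ts1 x y : bruhat_le S x v -> bruhat_le S y v -> reflections S (y * x^-1) -> y * x^-1 \in ts.
  move=> xv yv r; rewrite tsE mem_filter mem_cat; apply/andP; split; first exact/asboolP.
  by apply/orP; left; apply/allpairsP; exists (x, y); split=> //; apply/(belowP hWS).
have ts2 x : bruhat_le S x v -> x * s * x^-1 \in ts.
  move=> xv; rewrite tsE mem_filter mem_cat; apply/andP; split.
    exact/asboolP/refl_conj/refl_gen.
  by apply/orP; right; apply/mapP; exists x => //; apply/(belowP hWS).
have vsv : bruhat_le S (v * s) v.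
  apply: bruhat_le_edge; split=> //.
  have -> : v * (v * s)^-1 = v * s * v^-1 by rewrite invgM sV mulgA.
  by [].
have E := @gen_op_edge_ops s v ts pred0 Ss rts srt.
have {}E : gen_op pred0 s (edge_ops ts (point v)) u = edge_ops ts (point (v * s)) u.
  rewrite E; last 2 first.
  - by move=> x xv; rewrite ts2.
  - by move=> x t xv _; rewrite ts2.
  congr edge_ops; apply/funext => x; rewrite /gen_op /point.
  have -> : (x * s == v) = (x == v * s).
    by rewrite -(inj_eq (@mulIg _ s)) -mulgA s2 mulg1.
  have [->|] := eqVneq x v; last by rewrite !mulr0 subr0.
  rewrite /below_in /inv mulgVK vs /= mul0r subr0 //.
move/(congr1 (fun P : {poly int} => P`_n)%R): E.
have invE : inv S u (u * s * u^-1) = (len S (u * s) < len S u)%N by rewrite /inv mulgVK.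
rewrite /gen_op /below_in /= addbF invE coefB (edge_ops_coef _ _ rts) //.
rewrite (edge_ops_coef _ _ rts) // => [|x y xv yv]; last first.
  by apply: ts1; apply: bruhat_le_trans vsv.
case: (_ < _)%N; last by rewrite mul0r coef0 subr0 addn0 => /eqP; rewrite Num.Theory.eqr_nat => /eqP.
rewrite mul1r coefXM => /eqP; rewrite subr_eq.
case: n => [|n] /=; first by rewrite addr0 addn0 Num.Theory.eqr_nat => /eqP.
by rewrite (edge_ops_coef _ _ rts) // -natrD Num.Theory.eqr_nat => /eqP.
Qed.

End IncreasingPaths.

(** * R-polynomials *)

Section RPolynomials.
Variables (W : groupType) (S : set W) (lt : rel W).
Hypotheses (hWS : coxeter_system S) (hlt : reflection_order S lt).
Implicit Types (s t u v w x y : W).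

Lemma inc_count_support n u v : inc_count S lt n u v != 0%N ->
  [/\ bruhat_le S u v, (len S u + n <= len S v)%N &
      odd n = odd (len S u) (+) odd (len S v)].
Proof.
rewrite -lt0n -has_count => /hasP[p /(pathsP hWS)[pp <-] _]; split.
- by exists p.
- exact: bruhat_path_len pp.
exact: bruhat_path_odd pp.
Qed.

Lemma inc_count_nle n u v : ~ bruhat_le S u v -> inc_count S lt n u v = 0%N.
Proof. by move=> nle; apply: contrapT => /eqP/inc_count_support[]. Qed.

Lemma inc_count_down n u v s : S s ->
  (len S (u * s)%g < len S u)%N -> (len S (v * s)%g < len S v)%N ->
  inc_count S lt n u v = inc_count S lt n (u * s)%g (v * s)%g.
Proof.
move=> Ss us vs; have := inc_count_gen hWS hlt n (u * s)%g Ss vs.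
by rewrite -mulgA (gen_invol hWS Ss) mulg1 ltnNge (ltnW us) addn0.
Qed.

(** Apply [inc_count_gen] at u s, and again at u to the term of degree one less. This is the
    recursion of the polynomials Rtilde. *)
Lemma inc_count_up n u v s : S s ->
  (len S u < len S (u * s)%g)%N -> (len S (v * s)%g < len S v)%N ->
  (inc_count S lt n u v = inc_count S lt n (u * s)%g (v * s)%g +
    (if n is m.+1 then inc_count S lt m u (v * s)%g else 0))%N.
Proof.
move=> Ss us vs; have := inc_count_gen hWS hlt n (u * s)%g Ss vs.
rewrite -mulgA (gen_invol hWS Ss) mulg1 us => ->; congr addn.
case: n => // n; rewrite (inc_count_gen hWS hlt n u Ss vs).
by rewrite ltnNge (ltnW us) addn0.
Qed.

(* The n-th power of z = q^(1/2) - q^(-1/2), times q^(d/2). *)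
Definition Rterm d n : {poly int} := ('X - 1) ^+ n * 'X^((d - n)./2).

(** The expected R-polynomial: q^(l(u,v)/2) times the generating function of the increasing paths at
    z. The halved exponent in [Rterm] is exact wherever the count is nonzero, by the parity of path
    lengths. *)
Definition Rinc u v : {poly int} :=
  \sum_(n < (len S v).+1) (inc_count S lt n u v)%:R * Rterm (len S v - len S u) n.

Lemma Rinc_widen N u v : (len S v < N)%N ->
  Rinc u v = \sum_(n < N) (inc_count S lt n u v)%:R * Rterm (len S v - len S u) n.
Proof.
move=> vN; rewrite /Rinc.
rewrite (big_ord_widen N (fun n => (inc_count S lt n u v)%:R * Rterm (len S v - len S u) n)) //.
rewrite big_mkcond /=; apply: eq_bigr => n _; case: ltnP => // vn.
have [->|/inc_count_support[_ le _]] := eqVneq (inc_count S lt n u v) 0%N.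
  by rewrite mul0r.
have := leq_trans (leq_addl _ _) le; lia.
Qed.

Lemma Rinc_nle u v : ~ bruhat_le S u v -> Rinc u v = 0.
Proof.
by move=> nle; rewrite /Rinc big1 // => n _; rewrite inc_count_nle // mul0r.
Qed.

Lemma len_mul_gen v s : S s -> (len S (v * s)%g < len S v)%N ->
  len S v = (len S (v * s)%g).+1.
Proof.
move=> Ss vs; have := lenM hWS (v * s)%g s; have := len_gen hWS Ss.
rewrite -mulgA (gen_invol hWS Ss) mulg1; lia.
Qed.

Lemma len_mul_gen_up v s : S s -> (len S v < len S (v * s)%g)%N ->
  len S (v * s)%g = (len S v).+1.
Proof. by move=> Ss vs; have := lenM hWS v s; have := len_gen hWS Ss; lia. Qed.

Lemma len_gen_neq v s : S s -> len S (v * s)%g != len S v.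
Proof.
move=> Ss; apply/eqP => /(congr1 odd); rewrite (odd_len_mul hWS).
by rewrite (odd_len_gen hWS Ss); case: (odd _).
Qed.

Lemma Rinc_down u v s : S s ->
  (len S (u * s)%g < len S u)%N -> (len S (v * s)%g < len S v)%N ->
  Rinc u v = Rinc (u * s)%g (v * s)%g.
Proof.
move=> Ss us vs; rewrite [RHS](@Rinc_widen (len S v).+1); last by lia.
apply: eq_bigr => n _; rewrite (inc_count_down _ Ss us vs).
by congr (_ * Rterm _ _); have := len_mul_gen Ss us; have := len_mul_gen Ss vs; lia.
Qed.

(** The factor q comes from l(u s, v s) = l(u, v) - 2. In the other term l drops by one and a factor
    z is split off, and q^(1/2) z = q - 1. *)
Lemma Rinc_up u v s : S s ->
  (len S u < len S (u * s)%g)%N -> (len S (v * s)%g < len S v)%N ->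
  Rinc u v = 'X * Rinc (u * s)%g (v * s)%g + ('X - 1) * Rinc u (v * s)%g.
Proof.
move=> Ss us vs; have lv := len_mul_gen Ss vs; have lu := len_mul_gen_up Ss us.
rewrite (@Rinc_widen (len S v).+1 (u * s)%g); last by lia.
rewrite {1}/Rinc.
under eq_bigr do rewrite (inc_count_up _ Ss us vs) natrD mulrDl.
rewrite big_split /=; congr (_ + _).
  rewrite mulr_sumr; apply: eq_bigr => n _.
  have [->|/inc_count_support[_ le _]] := eqVneq (inc_count S lt n (u * s)%g (v * s)%g) 0%N.
    by rewrite mul0r mul0r mulr0.
  rewrite [RHS]mulrCA; congr (_ * _); rewrite /Rterm [RHS]mulrCA -exprS; congr (_ * 'X^_).
  have -> : (len S v - len S u - n = (len S (v * s)%g - len S (u * s)%g - n).+2)%N by lia.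
  by [].
rewrite big_ord_recl /= mul0r add0r (@Rinc_widen (len S v)) // mulr_sumr; apply: eq_bigr => n _.
rewrite [RHS]mulrCA; congr (_ * _); rewrite /Rterm [RHS]mulrA -exprS.
by rewrite /bump /= add1n; congr (_ * 'X^_); congr half; lia.
Qed.

Lemma Rinc1 u : Rinc u 1%g = ((u == 1%g)%:R).
Proof.
rewrite /Rinc (len1 hWS) big_ord_recl big_ord0 addr0 /= /Rterm sub0n expr0 mul1r /= expr0 mulr1.
congr (_%:R); rewrite /inc_count.
have -> : paths S 0 u 1%g = if u == 1%g then [:: [::]] else [::].
  apply: perm_small_eq; first by case: ifP.
  apply: uniq_perm; [exact: paths_uniq | by case: ifP|].
  move=> p; apply/(pathsP hWS)/idP => [[pp /size0nil p0]|].
    by move: pp; rewrite p0 => /bruhat_path_nil->; rewrite eqxx.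
  by case: eqP => // ->; rewrite inE => /eqP->.
by case: ifP.
Qed.

Lemma exists_descent v : v <> 1%g ->
  exists2 s, S s & (len S (v * s)%g < len S v)%N.
Proof.
move=> v1; have [e ve sz] := reduced_exists hWS v.
case/lastP: e ve sz => [/expression_nil//|e s].
rewrite -cats1 => /expression_catP[x [y [xe /expression_seq1[Ss ->] vE]]] sz.
exists s => //; rewrite vE -mulgA (gen_invol hWS Ss) mulg1 -vE -sz size_cat addn1 ltnS.
exact: len_le.
Qed.

End RPolynomials.

(** * Evaluation of polynomials in the Laurent ring *)

Section LaurentEvaluation.

Let lval : {rmorphism laurent -> {fraction {poly int}}} := val.

Definition ev (P : {poly int}) : laurent := (map_poly intr P).[lX].

Lemma lval_ev P : lval (ev P) = tofrac P.
Proof.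
rewrite /ev -horner_map -map_poly_comp -[in RHS](comp_polyXr P) /comp_poly.
rewrite -horner_map -map_poly_comp; congr (_.[_]).
apply: eq_map_poly => i; transitivity (i%:~R : {fraction {poly int}}).
  exact: (rmorph_int lval).
have iP : i%:P = i%:~R :> {poly int} by rewrite -[in LHS](intz i) rmorph_int.
by rewrite /= iP rmorph_int.
Qed.

Lemma ev_inj : injective ev.
Proof. by move=> P Q /(congr1 lval); rewrite !lval_ev => /eqP; rewrite tofrac_eq => /eqP. Qed.

Fact ev_zmod_morphism : zmod_morphism ev.
Proof. by move=> P Q; rewrite /ev rmorphB hornerD hornerN. Qed.

Fact ev_monoid_morphism : monoid_morphism ev.
Proof. by split=> [|P Q]; rewrite /ev ?rmorph1 ?hornerC // rmorphM hornerM. Qed.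

HB.instance Definition _ := GRing.isZmodMorphism.Build _ _ ev ev_zmod_morphism.
HB.instance Definition _ := GRing.isMonoidMorphism.Build _ _ ev ev_monoid_morphism.

Lemma evX : ev 'X = lX.
Proof. by rewrite /ev map_polyX hornerX. Qed.

Definition lz : laurent := lX - lX^-1.

Lemma lX_lz n k : (n <= k)%N -> ~~ odd (k - n) ->
  lX ^+ k * lz ^+ n = (lX ^+ 2 - 1) ^+ n * (lX ^+ 2) ^+ (k - n)./2.
Proof.
move=> nk ev_kn; rewrite -{1}(subnKC nk) exprD mulrAC -exprMn /lz mulrBr divrr ?lX_unit //.
by rewrite -expr2 -exprM mul2n even_halfK.
Qed.

(* Here [lX] plays the role of q^(1/2), whereas in [ev] it stands for q. *)
Definition zeval (P : {poly nat}) : laurent := (map_poly (fun n : nat => n%:R) P).[lz].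

Lemma lX_zeval (P : {poly nat}) k : (size P <= k.+1)%N ->
  lX ^+ k * zeval P =
  ev (\sum_(n < k.+1) (P`_n)%R%:R * (('X ^+ 2 - 1) ^+ n * 'X ^+ (k - n))).
Proof.
move=> szP; rewrite /zeval (@horner_coef_wide _ k.+1); last first.
  by apply: leq_trans szP; apply: size_poly.
rewrite mulr_sumr rmorph_sum; apply: eq_bigr => n _.
rewrite coef_map_id0 // rmorphM !rmorphM rmorph_nat !rmorphXn rmorphB rmorphXn rmorph1 /= !evX mulrCA.
congr (_ * _); have nk : (n <= k)%N by rewrite -ltnS.
rewrite -{1}(subnK nk) addnC exprD -mulrA mulrCA [RHS]mulrC; congr (_ * _).
by rewrite -exprMn /lz mulrBr divrr ?lX_unit // -expr2.
Qed.

(** Multiplication by X^k clears the denominators; the claim becomes the independence of the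
    polynomials (X^2 - 1)^n X^(k-n), n <= k, over the integers. *)
Lemma zeval_inj : injective zeval.
Proof.
move=> P Q PQ; pose k := (size P + size Q)%N.
pose D n : int := (P`_n)%R%:R - (Q`_n)%R%:R.
have /ev_inj/eqP : ev (\sum_(n < k.+1) (P`_n)%R%:R * (('X ^+ 2 - 1) ^+ n * 'X ^+ (k - n))) =
    ev (\sum_(n < k.+1) (Q`_n)%R%:R * (('X ^+ 2 - 1) ^+ n * 'X ^+ (k - n))).
  by rewrite -!lX_zeval ?PQ // /k; lia.
rewrite -subr_eq0 -sumrB => /eqP sum0.
have {sum0} sum0 : \sum_(n < k.+1) (D n)%:P * (('X ^+ 2 - 1) ^+ n * 'X ^+ (k - n)) = 0.
  rewrite -[RHS]sum0; apply: eq_bigr => n _; rewrite -mulrBl /D; congr (_ * _).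
  by rewrite rmorphB /= !rmorph_nat.
suff D0 n : (n <= k)%N -> D n = 0.
  apply/polyP => n; have [/D0/eqP|kn] := leqP n k.
    by rewrite subr_eq0 Num.Theory.eqr_nat => /eqP.
  by rewrite !nth_default //; apply: leq_trans (ltnW kn); rewrite ?leq_addl ?leq_addr.
(* Divide by X and evaluate at 0, from the largest exponent of X^2 - 1 down. *)
move: sum0; elim: k => [|k IH] in n *.
  rewrite big_ord_recl big_ord0 addr0 expr0 mul1r mulr1 leqn0 => /eqP + /eqP->.
  by rewrite polyC_eq0 => /eqP.
rewrite big_ord_recr /= subnn expr0 mulr1 => sum0.
have Dk : D k.+1 = 0.
  have := congr1 (horner^~ 0) sum0; rewrite hornerD horner_sum big1 => [|i _].
    rewrite add0r !hornerE => /eqP; rewrite mulf_eq0 => /orP[/eqP//|].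
    by rewrite signr_eq0.
  by rewrite !hornerE subSn -1?ltnS // expr0n /= !mulr0.
rewrite leq_eqVlt ltnS => /orP[/eqP->//|]; apply: IH.
apply: (@mulfI _ 'X); first by rewrite polyX_eq0.
rewrite mulr0 mulr_sumr -[RHS]sum0 Dk mul0r addr0; apply: eq_bigr => i _.
by rewrite mulrCA; congr (_ * _); rewrite mulrCA -exprS subSn // -ltnS.
Qed.

End LaurentEvaluation.

(** * The inverse of T_(v^-1) in the Hecke algebra *)

Section HeckeInverse.
Variables (W : groupType) (S : set W) (lt : rel W) (H : algType laurent) (T : W -> H).
Hypotheses (hWS : coxeter_system S) (hlt : reflection_order S lt).
Hypothesis hHT : hecke_algebra S T.
Implicit Types (s u v w x : W).

Let T1 : T 1%g = 1. Proof. by case: hHT. Qed.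

Let TM_up w s : S s -> (len S w < len S (w * s)%g)%N -> T w * T s = T (w * s)%g.
Proof. by case: hHT => _ _ _ TM Ss l; rewrite TM // l. Qed.

Let TM_down w s : S s -> (len S (w * s)%g < len S w)%N ->
  T w * T s = lX *: T (w * s)%g + (lX - 1) *: T w.
Proof. by case: hHT => _ _ _ TM Ss l; rewrite TM // ltnNge (ltnW l). Qed.

(** The axioms give only products with T_s on the right. Stripping a right descent from w transfers
    the rule to the left, where v^-1 = s (v s)^-1 needs it. *)
Lemma hecke_mulSl s w : S s -> (len S w < len S (s * w)%g)%N ->
  T (s * w)%g = T s * T w.
Proof.
move=> Ss; elim: {w}(len S w) {-2}w (erefl (len S w)) => [|n IH] w lw.
  by rewrite (len_eq0 hWS lw) mulg1 T1 mulr1.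
have w1 : w <> 1%g by move=> w1; move: lw; rewrite w1 (len1 hWS).
have [r Sr wr] := exists_descent hWS w1; pose w' := (w * r)%g.
have wE : w = (w' * r)%g by rewrite /w' -mulgA (gen_invol hWS Sr) mulg1.
have lw' : len S w = (len S w').+1 := len_mul_gen hWS Sr wr.
have ls := len_gen hWS Ss; have lr := len_gen hWS Sr.
move=> lsw; have swE : (s * w' * r = s * w)%g by rewrite -mulgA -wE.
have l1 := lenM hWS (s * w')%g r; have l2 := lenM hWS s w'; rewrite swE in l1.
have E1 : T (s * w' * r)%g = T (s * w')%g * T r by rewrite TM_up // swE; lia.
have E2 : T (w' * r)%g = T w' * T r by rewrite TM_up // -wE lw'.
rewrite wE mulgA E1 E2 (IH w') ?mulrA //; first by move: lw; rewrite lw' => -[].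
lia.
Qed.

Lemma hecke_gen_inv s : S s ->
  T s * (T s - (lX - 1) *: 1) = lX *: 1 /\ (T s - (lX - 1) *: 1) * T s = lX *: 1.
Proof.
move=> Ss; have TT : T s * T s = lX *: 1 + (lX - 1) *: T s.
  rewrite TM_down // (gen_invol hWS Ss) ?T1 // (len1 hWS).
  by rewrite odd_gt0 // (odd_len_gen hWS).
by rewrite mulrBr mulrBl TT -scalerAl -scalerAr mul1r mulr1 addrK.
Qed.

Definition rcoef u v : laurent := (-1) ^+ len2 S u v * ev (Rinc S lt u v).
(** The candidate for q^l(v) times the inverse of T_(v^-1). *)
Definition hsum v : H := \sum_(u <- below S v) rcoef u v *: T u.

Lemma hsum_widen v (B : seq W) : uniq B -> {subset below S v <= B} ->
  hsum v = \sum_(u <- B) rcoef u v *: T u.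
Proof.
move=> uB sub; rewrite (bigID (mem (below S v))) /= [X in _ + X]big1 => [|u nu].
  rewrite addr0 -big_filter; apply/perm_big/uniq_perm.
  - exact: below_uniq.
  - exact: filter_uniq.
  move=> u; rewrite mem_filter; case: (boolP (u \in below S v)) => // /sub ->.
  by [].
rewrite /rcoef Rinc_nle ?rmorph0 ?mulr0 ?scale0r //.
by move=> le; move/negP: nu; apply; apply/(belowP hWS).
Qed.

Lemma rcoef_down u v s : S s ->
  (len S (u * s)%g < len S u)%N -> (len S (v * s)%g < len S v)%N ->
  rcoef u v = rcoef (u * s)%g (v * s)%g.
Proof.
move=> Ss us vs; rewrite /rcoef (Rinc_down hWS hlt Ss us vs) /len2.
by rewrite (len_mul_gen hWS Ss us) (len_mul_gen hWS Ss vs) subSS.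
Qed.

Lemma rcoef_up u v s : S s ->
  (len S u < len S (u * s)%g)%N -> (len S (v * s)%g < len S v)%N ->
  rcoef u v = lX * rcoef (u * s)%g (v * s)%g - (lX - 1) * rcoef u (v * s)%g.
Proof.
move=> Ss us vs; have lv := len_mul_gen hWS Ss vs; have lu := len_mul_gen_up hWS Ss us.
rewrite /rcoef (Rinc_up hWS hlt Ss us vs) rmorphD !rmorphM rmorphB rmorph1 /= evX mulrDr.
congr (_ + _).
  rewrite [RHS]mulrCA.
  (* [len2] is a truncated difference, hence reliable only for comparable elements; otherwise the
     polynomial is 0. *)
  have [le|nle] := pselect (bruhat_le S (u * s)%g (v * s)%g); last first.
    by rewrite Rinc_nle // rmorph0 !mulr0.
  have := bruhat_le_len le => le'; congr (_ * _); rewrite /len2.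
  have -> : (len S v - len S u = (len S (v * s)%g - len S (u * s)%g).+2)%N by lia.
  by rewrite !exprS mulrA mulrNN mul1r mul1r.
rewrite [in RHS]mulrCA -mulNr.
have [le|nle] := pselect (bruhat_le S u (v * s)%g); last first.
  by rewrite Rinc_nle // rmorph0 !mulr0.
have := bruhat_le_len le => le'; congr (_ * _); rewrite /len2 lv subSn // exprS.
by rewrite mulN1r.
Qed.

(** The last factor is q T_s^-1, so this is what T_(v^-1) = T_s T_((v s)^-1) demands of the
    inverses. On coefficients it is the recursion of the R-polynomials. *)
Lemma hsum_step v s : S s -> (len S (v * s)%g < len S v)%N ->
  hsum v = hsum (v * s)%g * (T s - (lX - 1) *: 1).
Proof.
move=> Ss vs; have s2 := gen_invol hWS Ss.
(* Both sums are spread over a list closed under u |-> u s, so that the terms with T_(u s) can be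
   reindexed. *)
pose C := below S v ++ below S (v * s)%g.
pose B := undup (C ++ [seq (u * s)%g | u <- C]).
have uB : uniq B by apply: undup_uniq.
have subC : {subset C <= B} by move=> u uC; rewrite mem_undup mem_cat uC.
rewrite (hsum_widen uB); last by move=> u h; apply: subC; rewrite mem_cat h.
rewrite (@hsum_widen (v * s)%g _ uB); last by move=> u h; apply: subC; rewrite mem_cat h orbT.
have pB : perm_eq B [seq (u * s)%g | u <- B].
  have sK u : (u * s * s = u)%g by rewrite -mulgA s2 mulg1.
  have memS (X : seq W) u : (u \in [seq (x * s)%g | x <- X]) = ((u * s)%g \in X).
    by apply/mapP/idP => [[x xX ->]|uX]; [rewrite sK | exists (u * s)%g; rewrite ?sK].
  apply: uniq_perm => // [|u]; first by rewrite map_inj_uniq // => x y /mulIg.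
  by rewrite memS !mem_undup ![_ \in C ++ _]mem_cat !memS sK orbC.
pose f u : laurent := if (len S u < len S (u * s)%g)%N then 1 else lX.
pose g u : laurent := if (len S u < len S (u * s)%g)%N then lX - 1 else 0.
have Tf u : T u * (T s - (lX - 1) *: 1) = f u *: T (u * s)%g - g u *: T u.
  rewrite mulrBr -scalerAr mulr1 /f /g; case: ltngtP => l.
  - by rewrite TM_up // scale1r.
  - by rewrite TM_down // addrK scale0r subr0.
  by have := len_gen_neq hWS u Ss; rewrite l eqxx.
rewrite mulr_suml.
under [RHS]eq_bigr do rewrite -scalerAl Tf scalerBr !scalerA.
rewrite sumrB (perm_big _ pB) /= big_map.
rewrite [X in X - _](_ : _ = \sum_(u <- B) (rcoef (u * s)%g (v * s)%g * f (u * s)%g) *: T u); last first.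
  rewrite [RHS](perm_big _ pB) /= big_map; apply: eq_bigr => u _.
  by rewrite -mulgA s2 mulg1.
rewrite -sumrB -(big_map _ xpredT (fun u => rcoef u v *: T u)) -(perm_big _ pB).
apply: eq_bigr => u _; rewrite -scalerBl; congr (_ *: _).
rewrite /f /g -mulgA s2 mulg1; have [l|l|l] := ltngtP (len S u) (len S (u * s)%g).
- by rewrite (rcoef_up Ss l vs) ![_ * rcoef _ _]mulrC.
- by rewrite (rcoef_down Ss l vs) mulr1 mulr0 subr0.
by have := len_gen_neq hWS u Ss; rewrite l eqxx.
Qed.

Lemma lXn_unit n : lX ^+ n \is a GRing.unit.
Proof. exact/unitrX/lX_unit. Qed.

Lemma hsum_inv v :
  (lX ^- len S v *: hsum v) * T (v^-1)%g = 1 /\ T (v^-1)%g * (lX ^- len S v *: hsum v) = 1.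
Proof.
suff [E1 E2] : hsum v * T (v^-1)%g = lX ^+ len S v *: 1 /\
    T (v^-1)%g * hsum v = lX ^+ len S v *: 1.
  by rewrite -scalerAl -scalerAr E1 E2 scalerA mulVr ?lXn_unit // scale1r.
elim: {v}(len S v) {-2}v (erefl (len S v)) => [|n IH] v lv.
  suff -> : hsum v = 1 by rewrite lv (len_eq0 hWS lv) invg1 T1 mulr1 expr0 scale1r.
  rewrite (len_eq0 hWS lv); rewrite /hsum (perm_big [:: 1%g]) /=; last first.
      apply: uniq_perm => //; first exact: below_uniq.
      move=> u; rewrite inE; apply/(belowP hWS)/eqP => [[p pp]|->]; last exact: bruhat_le_refl.
      have := bruhat_path_len pp; rewrite (len1 hWS); case: p pp => [|? ?] pp; last by rewrite addnS.
      by case: pp.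
  by rewrite big_seq1 /rcoef /len2 subnn Rinc1 // eqxx rmorph1 mulr1 T1 scale1r.
have v1 : v <> 1%g by move=> v1; move: lv; rewrite v1 (len1 hWS).
have [s Ss vs] := exists_descent hWS v1.
have lvs : len S (v * s)%g = n by have := len_mul_gen hWS Ss vs; rewrite lv => -[].
have [IH1 IH2] := IH _ lvs.
have vE : (v^-1 = s * (v * s)^-1)%g by rewrite invgM (genV hWS Ss) mulgA (gen_invol hWS Ss) mul1g.
have TE : T (v^-1)%g = T s * T ((v * s)^-1)%g.
  by rewrite {1}vE hecke_mulSl // -vE !(lenV hWS).
have [S1 S2] := hecke_gen_inv Ss.
rewrite (hsum_step Ss vs) TE; split.
  by rewrite -mulrA (mulrA (_ - _)) S2 -scalerAl mul1r -scalerAr IH1 scalerA -exprS lvs lv.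
by rewrite -mulrA (mulrA (T (v * s)^-1%g)) IH2 -scalerAl mul1r -scalerAr S1 scalerA -exprSr lvs lv.
Qed.

Lemma Rinc_family : R_family S T (Rinc S lt).
Proof.
split=> [u v|v]; first exact: Rinc_nle.
have -> : \sum_(u \in [set u | bruhat_le S u v])
    ((-1) ^+ len2 S u v * (map_poly intr (Rinc S lt u v)).[lX]) *: T u = hsum v.
  by rewrite fsbig_finite //; apply: below_finite.
exact: hsum_inv.
Qed.

(** Two-sided inverses are unique and the T_w are independent, which fixes the coefficients up to
    the signs and the power of q, both invertible. *)
Lemma R_family_unique R : R_family S T R -> R = Rinc S lt.
Proof.
move=> [Rnle Rinv]; apply/funext => u; apply/funext => v.
have [uv|nuv] := pselect (bruhat_le S u v); last by rewrite Rnle // Rinc_nle.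
have [_] := Rinv v; rewrite fsbig_finite; last exact: below_finite.
rewrite -/(below S v); set h := \sum_(_ <- _) _ => hR.
have [hL _] := hsum_inv v.
have : lX ^- len S v *: hsum v = lX ^- len S v *: h.
  by rewrite -[LHS]mulr1 -hR mulrA hL mul1r.
move/(congr1 (fun x : H => lX ^+ len S v *: x)); rewrite !scalerA divrr ?lXn_unit // !scale1r.
move/eqP; rewrite -subr_eq0 /hsum /h -sumrB => /eqP.
under eq_bigr do rewrite -scalerBl.
case: hHT => _ indep _ _ /indep; rewrite below_uniq => /(_ isT u).
have ub : u \in below S v by apply/(belowP hWS).
move=> /(_ ub); rewrite /rcoef -mulrBr => /(congr1 (fun x : laurent => (-1) ^+ len2 S u v * x)).
rewrite mulr0 mulrA -expr2 sqrr_sign mul1r => /eqP; rewrite subr_eq0 => /eqP/ev_inj.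
by move=> ->.
Qed.

End HeckeInverse.

Section RTilde.
Variables (W : groupType) (S : set W) (lt : rel W) (H : algType laurent) (T : W -> H).
Hypotheses (hWS : coxeter_system S) (hlt : reflection_order S lt).
Hypothesis hHT : hecke_algebra S T.
Implicit Types (u v : W).

Definition inc_poly u v : {poly nat} := \poly_(n < (len S v).+1) inc_count S lt n u v.

Lemma coef_inc_poly n u v : (inc_poly u v)`_n = inc_count S lt n u v.
Proof.
rewrite coef_poly; case: ltnP => // vn; apply/esym/eqP/contraT.
by move=> /(inc_count_support hWS)[_ le _]; have := leq_trans (leq_addl _ _) le; lia.
Qed.

Lemma Rpoly_inc : Rpoly S T = Rinc S lt.
Proof.
apply: (R_family_unique hWS hlt hHT); rewrite /Rpoly.
apply: (xgetPex (fun _ _ : W => 0)); exists (Rinc S lt).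
exact: (Rinc_family hWS hlt hHT).
Qed.

Lemma Rinc_inc_poly u v : bruhat_le S u v ->
  (map_poly intr (Rinc S lt u v)).[lX ^+ 2] = lX ^+ len2 S u v * zeval (inc_poly u v).
Proof.
move=> uv.
have -> : zeval (inc_poly u v) = \sum_(n < (len S v).+1) (inc_count S lt n u v)%:R * lz ^+ n.
  rewrite /zeval (@horner_coef_wide _ (len S v).+1); last first.
    have sz : (size (inc_poly u v) <= (len S v).+1)%N by apply: size_poly.
    by apply: leq_trans sz; apply: size_poly.
  by apply: eq_bigr => n _; rewrite coef_map_id0 // coef_inc_poly.
rewrite mulr_sumr /Rinc rmorph_sum horner_sum; apply: eq_bigr => n _ /=.
have [->|/(inc_count_support hWS)[_ le od]] := eqVneq (inc_count S lt n u v) 0%N.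
  by rewrite !mul0r rmorph0 horner0 mulr0.
rewrite rmorphM rmorph_nat -polyC_natr hornerCM mulrCA; congr (_ * _).
rewrite lX_lz /len2; last 2 first.
- by lia.
- by rewrite -subnDA oddB // oddD od; case: (odd _) (odd _) => [] [].
by rewrite /Rterm rmorphM !rmorphXn rmorphB rmorph1 /= map_polyX !hornerE.
Qed.

Lemma Rtilde_inc u v : bruhat_le S u v -> Rtilde S T u v = inc_poly u v.
Proof.
move=> uv; have ex : exists P : {poly nat}, (map_poly intr (Rpoly S T u v)).[lX ^+ 2] =
    lX ^+ len2 S u v * (map_poly (fun n : nat => n%:R) P).[lX - lX^-1].
  by exists (inc_poly u v); rewrite Rpoly_inc; apply: Rinc_inc_poly.
have := xgetPex (0 : {poly nat}) ex; rewrite -/(Rtilde S T u v) /= Rpoly_inc.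
rewrite Rinc_inc_poly // => /(mulrI (lXn_unit _)) E.
exact/zeval_inj/esym/E.
Qed.

End RTilde.

Section OrderIndependence.
Variables (W : groupType) (S : set W) (lt : rel W) (H : algType laurent) (T : W -> H).
Hypotheses (hWS : coxeter_system S) (hlt : reflection_order S lt).
Hypothesis hHT : hecke_algebra S T.

(** Both counts are coefficients of [Rtilde], whose definition involves no ordering. *)
Lemma inc_count_rev n u v :
  inc_count S (fun x y => lt y x) n u v = inc_count S lt n u v.
Proof.
have hgt := reflection_order_rev hWS hlt.
have [uv|nuv] := pselect (bruhat_le S u v); last by rewrite !inc_count_nle.
by rewrite -!coef_inc_poly // -(Rtilde_inc hWS hlt hHT uv) -(Rtilde_inc hWS hgt hHT uv).
Qed.

End OrderIndependence.

(** * Compositions and descents *)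

Section Compositions.
Implicit Types (al be ms : seq nat) (w x : seq bool).
Local Open Scope nat_scope.

Definition psum al i : Prop := exists2 k, 0 < k <= size al & i = sumn (take k al).

Lemma sumn_take_le al k l : k <= l -> sumn (take k al) <= sumn (take l al).
Proof.
move=> kl; rewrite -(subnKC kl) takeD sumn_cat; exact: leq_addr.
Qed.

Lemma sumn_take_lt al k l : composition al -> k < l <= size al ->
  sumn (take k al) < sumn (take l al).
Proof.
elim: al k l => [|a al IH] k l; first by move=> _ /andP[kl]; rewrite leqn0 => /eqP l0; rewrite l0 in kl.
move=> /andP[a0 cal]; case: l => // l; case: k => [|k] /=; first by lia.
by rewrite !ltnS ltn_add2l => kl; apply: IH.
Qed.

Lemma psum_gt0 al i : composition al -> psum al i -> 0 < i.
Proof.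
move=> cal [k /andP[k0 ks] ->]; have := @sumn_take_lt al 0 k cal.
by rewrite take0 k0 ks => /(_ isT).
Qed.

Lemma psum_cons a al i : psum (a :: al) i <-> i = a \/ exists2 j, psum al j & i = a + j.
Proof.
split=> [[[|[|k]] // ks ->]|[->|[j [k /andP[k0 ks] ->] ->]]].
- by left; rewrite /= take0 addn0.
- by right; exists (sumn (take k.+1 al)) => //; exists k.+1.
- by exists 1 => //=; rewrite take0 addn0.
by exists k.+1.
Qed.

Lemma psum_total al : composition al -> 0 < sumn al -> psum al (sumn al).
Proof. by case: al => // a al _ _; exists (size (a :: al)); rewrite ?take_size //=. Qed.

(** Bit i is set iff i + 1 is a partial sum, the total included. Refinement then becomes inclusion
    of bits. *)
Definition cbits al : seq bool := flatten [seq rcons (nseq a.-1 false) true | a <- al].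

Lemma size_cbits al : composition al -> size (cbits al) = sumn al.
Proof.
elim: al => //= a al IH /andP[a0 cal].
by rewrite /cbits /= size_cat size_rcons size_nseq prednK // IH.
Qed.

Lemma nth_cbits_cons a al i : 0 < a ->
  nth false (cbits (a :: al)) i = (i.+1 == a) || (a <= i) && nth false (cbits al) (i - a).
Proof.
move=> a0; rewrite /cbits /= nth_cat size_rcons size_nseq prednK //.
rewrite nth_rcons size_nseq nth_nseq -eqSS prednK //.
by case: (ltngtP i a.-1); case: (ltngtP i.+1 a); case: (leqP a i) => //=; lia.
Qed.

Lemma nth_cbits al i : composition al -> nth false (cbits al) i <-> psum al i.+1.
Proof.
elim: al i => [|a al IH] i; first by rewrite nth_nil; split=> // -[[|k] /andP[]].
move=> /andP[a0 cal]; rewrite nth_cbits_cons //; split.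
  move=> /orP[/eqP->|/andP[ai /IH h]]; apply/psum_cons; first by left.
  by right; exists (i - a).+1; [apply: h | lia].
move=> /psum_cons[->|[j pj ij]]; first by rewrite eqxx.
have j0 := psum_gt0 cal pj.
have -> : a <= i by lia.
have -> : i - a = j.-1 by lia.
by apply/orP; right; apply/IH; rewrite ?prednK.
Qed.

Lemma mem_comp_set al i : composition al ->
  i \in comp_set al <-> 0 < i < sumn al /\ nth false (cbits al) i.-1.
Proof.
move=> cal; split.
  move=> /imfsetP[k /= kin ->].
  have ks : 0 < k < size al by move: kin; rewrite mem_iota; case: al {cal} => //= *; lia.
  have p : psum al (sumn (take k al)) by exists k => //; lia.
  have p0 := psum_gt0 cal p; split.
    rewrite p0 -{2}(take_size al); apply: sumn_take_lt => //; lia.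
  by apply/nth_cbits; rewrite ?prednK.
move=> [/andP[i0 il] /(nth_cbits _ cal)]; rewrite prednK // => -[k ks iE].
apply/imfsetP; exists k => //=; rewrite mem_iota.
suff : k != size al by case: al ks {cal il iE} => //=; lia.
by apply: contraTN il => /eqP ke; rewrite iE ke take_size ltnn.
Qed.

(** The inverse of [cbits]; [k] counts the steps already in the current part. *)
Fixpoint cdec k x : seq nat :=
  match x with
  | [::] => [::]
  | true :: x' => k.+1 :: cdec 0 x'
  | false :: x' => cdec k.+1 x'
  end.

(** A descent word has one letter fewer than the path has steps; the added [true] closes the last
    part. *)
Definition comp_of_word w : seq nat := cdec 0 (rcons w true).

Lemma cdec_composition k x : composition (cdec k x).
Proof. by rewrite /composition; elim: x k => [|[] x IH] k //=; rewrite IH. Qed.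

Lemma comp_of_word_composition w : composition (comp_of_word w).
Proof. exact: cdec_composition. Qed.

Lemma cbits_comp_of_word w : cbits (comp_of_word w) = rcons w true.
Proof.
rewrite -[RHS]/(nseq 0 false ++ rcons w true) /comp_of_word.
elim: w 0 => [|[] w IH] k /=; rewrite /cbits /= -?/(cbits _).
- by rewrite cats0 cats1.
- by rewrite IH cat_rcons.
by rewrite IH -[RHS]cat_rcons; congr cat; elim: k => //= k ->.
Qed.

Lemma sumn_comp_of_word w : sumn (comp_of_word w) = (size w).+1.
Proof.
by rewrite -(size_cbits (comp_of_word_composition w)) cbits_comp_of_word size_rcons.
Qed.

Lemma cdec_cbits al : composition al -> cdec 0 (cbits al) = al.
Proof.
elim: al => //= a al IH /andP[a0 cal]; rewrite /cbits /= -/(cbits al).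
have aux k b y : cdec k (rcons (nseq b false) true ++ y) = (k + b).+1 :: cdec 0 y.
  by elim: b k => [|b IHb] k /=; rewrite ?addn0 // IHb addSnnS.
by rewrite aux add0n prednK // IH.
Qed.

Lemma cbits_inj al be : composition al -> composition be -> cbits al = cbits be -> al = be.
Proof. by move=> cal cbe E; rewrite -(cdec_cbits cal) E cdec_cbits. Qed.

Lemma nth_cbits_last al : composition al -> 0 < sumn al ->
  nth false (cbits al) (sumn al).-1.
Proof. by move=> cal al0; apply/nth_cbits; rewrite ?prednK //; apply: psum_total. Qed.

Lemma composition_sumn0 al : composition al -> sumn al = 0 -> al = [::].
Proof. by case: al => //= a al /andP[a0 _]; lia. Qed.

Lemma comp_set_inj al be : composition al -> composition be ->
  sumn al = sumn be -> comp_set al = comp_set be -> al = be.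
Proof.
move=> cal cbe s E; have [al0|al0] := posnP (sumn al).
  by rewrite (composition_sumn0 cal al0) (composition_sumn0 cbe) // -s.
apply: cbits_inj => //; apply: (@eq_from_nth _ false); first by rewrite !size_cbits.
move=> i; rewrite size_cbits // => il.
have [lt|ge] := ltnP i.+1 (sumn al).
  have := mem_comp_set i.+1 cal; have := mem_comp_set i.+1 cbe.
  rewrite -E -s lt /= => h1 h2; apply/idP/idP => h.
    by case: (h1.1 (h2.2 (conj isT h))).
  by case: (h2.1 (h1.2 (conj isT h))).
have -> : i = (sumn al).-1 by lia.
by rewrite nth_cbits_last // s nth_cbits_last // -s.
Qed.

(** For the converse, the first part b of [be] is a partial sum of [al]; the parts of [al] up to
    there form the first block, and the rest goes by induction. *)
Lemma refinesP al be : composition al -> composition be ->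
  refines al be <->
  sumn al = sumn be /\ forall i, nth false (cbits be) i -> nth false (cbits al) i.
Proof.
move=> cal cbe; split.
  move=> [ss [sal sbe]]; split; first by rewrite -sal -sbe sumn_flatten.
  move=> i /(nth_cbits _ cbe) pb; have i0 := psum_gt0 cbe pb.
  apply/(nth_cbits _ cal); case: pb => k /andP[k0 ks] E.
  have E' : i.+1 = sumn (flatten (take k ss)) by rewrite E -sbe -map_take sumn_flatten.
  have alE : al = flatten (take k ss) ++ flatten (drop k ss).
    by rewrite -flatten_cat cat_take_drop.
  exists (size (flatten (take k ss))); last by rewrite alE take_size_cat.
  rewrite alE size_cat leq_addr andbT lt0n.
  by apply/eqP => /size0nil e; rewrite e in E'.
move=> [s sub]; have {}sub i : psum be i -> psum al i.
  move=> pb; have i0 := psum_gt0 cbe pb; rewrite -(prednK i0).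
  by apply/(nth_cbits _ cal)/sub/(nth_cbits _ cbe); rewrite prednK.
elim: be al cal cbe s sub => [|b be IH] al cal cbe s sub.
  by rewrite (composition_sumn0 cal s); exists [::].
have [k /andP[k0 ks] bE] : psum al b by apply/sub/psum_cons; left.
move: cbe => /andP[b0 cbe].
have sal : sumn al = b + sumn (drop k al).
  by rewrite {1}bE -sumn_cat cat_take_drop.
have [||i pbe|ss [ssE1 ssE2]] := IH (drop k al) _ cbe.
- by apply/allP => x /mem_drop xal; apply: (allP cal).
- by move: s; rewrite sal /=; lia.
- have i0 := psum_gt0 cbe pbe.
  have [l /andP[l0 ls] lE] : psum al (b + i) by apply/sub/psum_cons; right; exists i.
  have kl : k < l.
    by rewrite ltnNge; apply/negP => /(sumn_take_le al); rewrite -lE -bE; lia.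
  exists (l - k); first by rewrite subn_gt0 kl size_drop leq_sub2r.
  apply: (@addnI b); rewrite lE {1}bE -sumn_cat.
  by rewrite -{1}(subnKC (ltnW kl)) takeD.
by exists (take k al :: ss); rewrite /= ssE1 cat_take_drop ssE2 -bE.
Qed.

Lemma refines_sumn al be : refines al be -> sumn al = sumn be.
Proof. by move=> [ss [<- <-]]; rewrite sumn_flatten. Qed.

(* A block of m steps of a path carries m - 1 letters of its descent word [w]; the letter
   at the junction with the next block is unconstrained. *)
Fixpoint wbi ms w : bool :=
  if ms is m :: ms' then ~~ has id (take m.-1 w) && wbi ms' (drop m w) else true.

(** An empty block imposes no condition and consumes no letter. This is the source of quasisymmetry:
    zero exponents of a monomial may be dropped. *)
Lemma wbi_filter ms w : wbi [seq m <- ms | 0 < m] w = wbi ms w.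
Proof. by elim: ms w => //= -[|m] ms IH w //=; rewrite ?drop0 ?take0 IH. Qed.

Lemma wbiP al w : composition al ->
  wbi al w <-> (forall i, i < sumn al -> nth false w i -> nth false (cbits al) i).
Proof.
elim: al w => [|a al IH] w //=.
move=> /andP[a0 cal]; split.
  move=> /andP[/hasPn nh /(IH _ cal) h] i il wi; rewrite nth_cbits_cons //.
  have [ia|ai] := ltnP i a.
    have [_ //|ne] := eqVneq i.+1 a.
    have is_ : i < size w by rewrite ltnNge; apply/negP => /(nth_default false) wi0; rewrite wi0 in wi.
    have ia' : i < a.-1 by lia.
    have szi : i < size (take a.-1 w) by rewrite size_take; case: ifP => _.
    by have := mem_nth false szi; rewrite nth_take // wi => /nh.
  by apply/orP; right; apply: h; [lia | rewrite nth_drop subnKC].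
move=> h; apply/andP; split.
  apply/hasPn => b /(nthP false)[i]; rewrite size_take => il <-.
  have ia : i < a.-1 by move: il; case: ifP; lia.
  rewrite nth_take //; apply/negP => wi.
  by have := h i _ wi; rewrite nth_cbits_cons // => /(_ ltac:(lia)) /orP[]; lia.
apply/IH => // i il; rewrite nth_drop => wi.
have := h (a + i) _ wi; rewrite ltn_add2l nth_cbits_cons // => /(_ il)/orP[|/andP[_]].
  by lia.
by rewrite addKn.
Qed.

Lemma refines_comp_of_word al w : composition al -> sumn al = (size w).+1 ->
  refines al (comp_of_word w) <-> wbi al w.
Proof.
move=> cal s; have cw := comp_of_word_composition w.
rewrite refinesP // wbiP // sumn_comp_of_word cbits_comp_of_word; split.
  by move=> [_ h] i _ wi; apply: h; rewrite nth_rcons; case: ltngtP => //; move: wi => /[swap] ?; rewrite nth_default // ltnW.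
move=> h; split=> // i; rewrite nth_rcons; case: ltngtP => // [iw|->] wi.
  by apply: h => //; rewrite s ltnS ltnW.
by have := nth_cbits_last cal; rewrite s /= => ->.
Qed.

End Compositions.

(** * Descent words and descent compositions of paths *)

Section DescentWords.
Local Open Scope group_scope.
Variables (W : groupType) (S : set W) (lt : rel W).
Implicit Types (u v x : W) (p q ls : seq W).

Definition dword ls : seq bool :=
  if ls is l :: ls' then pairmap (fun x y => lt y x) l ls' else [::].

Definition des u p : seq bool := dword (labels u p).

Lemma size_labels u p : size (labels u p) = size p.
Proof. exact: size_pairmap. Qed.

Lemma size_dword ls : size (dword ls) = (size ls).-1.
Proof. by case: ls => //= l ls; rewrite size_pairmap. Qed.

Lemma size_des u p : size (des u p) = (size p).-1.
Proof. by rewrite size_dword size_labels. Qed.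

Lemma dword_cat_nth ls i k : nth false (dword ls) (k + i) = nth false (dword (drop k ls)) i.
Proof.
elim: ls k => [|l ls IH] [|k] //=; first by rewrite !nth_nil.
rewrite addSn; case: ls IH => [|l' ls] IH /=; first by rewrite !nth_nil.
exact: IH.
Qed.

Lemma dword_drop ls k : dword (drop k ls) = drop k (dword ls).
Proof.
apply: (@eq_from_nth _ false).
  by rewrite size_drop !size_dword size_drop; lia.
by move=> i _; rewrite nth_drop dword_cat_nth.
Qed.

Lemma dword_take ls k : dword (take k ls) = take k.-1 (dword ls).
Proof.
elim: ls k => [|l ls IH] [|k] //=; first by rewrite take0.
case: ls IH => [|l' ls] IH //=; case: k => [|k] //=.
by have /= -> := IH k.+1.
Qed.

Lemma labels_take u p k : labels u (take k p) = take k (labels u p).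
Proof. by elim: p u k => [|x p IH] u [|k] //=; rewrite IH. Qed.

Lemma labels_drop u p k : labels (last u (take k p)) (drop k p) = drop k (labels u p).
Proof. by elim: p u k => [|x p IH] u [|k] //=; rewrite IH. Qed.

Lemma des_take u p k : des u (take k p) = take k.-1 (des u p).
Proof. by rewrite /des labels_take dword_take. Qed.

Lemma des_drop u p k : des (last u (take k p)) (drop k p) = drop k (des u p).
Proof. by rewrite /des labels_drop dword_drop. Qed.

Lemma mem_descents u p i : i \in descents lt u p = (0 < i)%N && nth false (des u p) i.-1.
Proof.
have -> : i \in descents lt u p = (0 < i < size p)%N && lt
    (nth u (u :: p) i.+1 * (nth u (u :: p) i)^-1) (nth u (u :: p) i * (nth u (u :: p) i.-1)^-1).
  by rewrite !inE mem_iota /=; congr (_ && _); case: p => //= *; lia.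
case: i => // i; rewrite !ltnS /=.
have [ip|pi] := ltnP i.+1 (size p); last first.
  by rewrite /= nth_default // size_des; move: pi; case: (size p) => //=.
have labE k : (k < size p)%N -> nth u (labels u p) k = nth u p k * (nth u (u :: p) k)^-1.
  by move=> kp; rewrite /labels (nth_pairmap u).
have /= L1 := labE i.+1 ip; have /= L2 := labE i (ltnW ip); rewrite -L1 -L2.
rewrite /des; move: ip; rewrite -(size_labels u p); move: (labels u p) => ls.
by case: ls => [|l ls] //= ip; rewrite (nth_pairmap u).
Qed.

(** The empty path is singled out because its descent word is empty as well, like that of a single
    edge, whose composition is [[:: 1]]. *)
Definition path_composition u p : seq nat :=
  if p is [::] then [::] else comp_of_word (des u p).

Lemma path_compositionP u p be :
  descent_composition lt u p be <-> be = path_composition u p.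
Proof.
have cw := comp_of_word_composition (des u p).
case: p cw => [|x p] cw; rewrite /descent_composition.
  split=> [[cb sb _]|->]; first exact: composition_sumn0.
  by split=> //; apply/fsetP => i; rewrite mem_descents nth_nil andbF; apply/imfsetP => -[].
have sw : sumn (comp_of_word (des u (x :: p))) = size (x :: p).
  by rewrite sumn_comp_of_word size_des.
have E : comp_set (comp_of_word (des u (x :: p))) = descents lt u (x :: p).
  apply/fsetP => i; rewrite mem_descents; apply/idP/idP.
    move=> /(mem_comp_set _ cw)[/andP[i0 il]]; rewrite i0 cbits_comp_of_word nth_rcons.
    by rewrite size_des /=; case: ltngtP => //; rewrite sw /= in il; lia.
  move=> /andP[i0 wi]; apply/(mem_comp_set _ cw); rewrite i0 cbits_comp_of_word nth_rcons sw.
  have il : (i.-1 < size (des u (x :: p)))%N.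
    by rewrite ltnNge; apply/negP => /(nth_default false) h; rewrite h in wi.
  by rewrite il wi; split=> //; rewrite size_des /= in il *; lia.
split=> [[cb sb Eb]|->] //; apply: comp_set_inj => //; first by rewrite sw.
by rewrite E.
Qed.

Lemma sumn_path_composition u p : sumn (path_composition u p) = size p.
Proof. by case: p => // x p; rewrite sumn_comp_of_word size_des. Qed.

Lemma path_composition_composition u p : composition (path_composition u p).
Proof. by case: p => // x p; apply: comp_of_word_composition. Qed.

Lemma refines_path_composition u p al : composition al -> sumn al = size p ->
  refines al (path_composition u p) <-> wbi al (des u p).
Proof.
case: p => [|x p] cal s; last by apply: refines_comp_of_word; rewrite ?size_des.
by rewrite (composition_sumn0 cal s) /=; split=> // _; exists [::].
Qed.

End DescentWords.

Section PathCounts.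
Variables (W : groupType) (S : set W) (lt : rel W).
Hypotheses (hWS : coxeter_system S) (hlt : reflection_order S lt).
Implicit Types (u v x : W) (p q ls : seq W).

(** Consecutive labels differ: using the same reflection twice would lead back to u although lengths
    grow. So a step that is not a descent is an ascent. *)
Lemma bruhat_edge_lt u x y : bruhat_edge S u x -> bruhat_edge S x y ->
  lt (x * u^-1)%g (y * x^-1)%g = ~~ lt (y * x^-1)%g (x * u^-1)%g.
Proof.
move=> [ru ux] [rx xy]; apply: (refl_order_total hlt rx ru) => E.
suff yu : y = u by move: (ltn_trans ux xy); rewrite yu ltnn.
have -> : y = (y * x^-1 * x)%g by rewrite mulgVK.
rewrite E; have -> : (x * u^-1 * x = x * u^-1 * (x * u^-1 * u))%g by rewrite mulgVK.
by rewrite mulgA (refl_invol hWS ru) mul1g.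
Qed.

Lemma increasing_des u v p : bruhat_path S u v p -> increasing lt u p = ~~ has id (des lt u p).
Proof.
rewrite /increasing /des; elim: p u => [|x p IH] u // /bruhat_path_cons[[ru ux]].
case: p IH => [|y p] IH // pp; have := IH x pp.
move: pp => /bruhat_path_cons[[rx xy] _] /= ->.
rewrite negb_or; congr (_ && _).
by rewrite (bruhat_edge_lt (conj ru ux) (conj rx xy)).
Qed.

Lemma card_fset_set_seq (T : choiceType) (A : set T) (s : seq T) : uniq s ->
  (forall z, A z <-> z \in s) -> (#|` fset_set A|)%fset = size s.
Proof.
move=> us As; have fA : finite_set A.
  by apply: (@sub_finite_set _ _ [set` s]); [move=> z /As | apply: finite_seq].
rewrite -(undup_id us) -card_fseq; congr (#|` _|)%fset; apply/fsetP => z.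
by rewrite in_fset_set // inE; apply/idP/idP => [/set_mem/As|/As/mem_set].
Qed.

Lemma c_count u v al : composition al ->
  c_ S lt u v al = count (fun p => wbi al (des lt u p)) (paths S (sumn al) u v).
Proof.
move=> cal; rewrite -size_filter; apply: card_fset_set_seq.
  exact/filter_uniq/paths_uniq.
move=> p; rewrite mem_filter; split.
  move=> [pp sp [be /path_compositionP-> /(refines_path_composition _ _ cal)]].
  by rewrite sp => /(_ erefl) ->; apply/(pathsP hWS).
move=> /andP[wp /(pathsP hWS)[pp sp]]; split=> //.
by exists (path_composition lt u p); [apply/path_compositionP | apply/refines_path_composition].
Qed.

Lemma b_count u v al :
  b_ S lt u v al = count (fun p => path_composition lt u p == al) (paths S (sumn al) u v).
Proof.
rewrite -size_filter; apply: card_fset_set_seq.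
  exact/filter_uniq/paths_uniq.
move=> p; rewrite mem_filter; split.
  move=> [pp sp /path_compositionP->]; rewrite eqxx.
  by apply/(pathsP hWS); rewrite sumn_path_composition.
move=> /andP[/eqP<- /(pathsP hWS)[pp sp]]; split=> //.
exact/path_compositionP.
Qed.

Lemma inc_count_des n u v :
  inc_count S lt n u v = count (fun p => ~~ has id (des lt u p)) (paths S n u v).
Proof. by apply: eq_in_count => p /(pathsP hWS)[pp _]; apply: increasing_des pp. Qed.

(** What the multichains with as many steps as [ms] has entries contribute to the coefficient of the
    monomial with exponents [ms]. *)
Fixpoint block_count u ms v : nat :=
  if ms is m :: ms' then
    \sum_(a <- below S v) inc_count S lt m u a * block_count a ms' v
  else u == v.

Lemma block_countE u ms v :
  block_count u ms v = count (fun p => wbi ms (des lt u p)) (paths S (sumn ms) u v).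
Proof.
elim: ms u => [|m ms IH] u /=.
  rewrite count_predT; case: eqP => [->|ne].
    rewrite (perm_size (s2 := [:: [::]])) //; apply: uniq_perm; rewrite ?paths_uniq //.
    move=> p; rewrite inE; apply/(pathsP hWS)/eqP => [[_ /size0nil]//|->].
    by split=> //; apply/bruhat_path_nil.
  case E : (paths S 0 u v) => [|p l] //.
  have /(pathsP hWS)[pp /size0nil p0] : p \in paths S 0 u v by rewrite E inE eqxx.
  by case: ne; apply/bruhat_path_nil; rewrite -p0; exact: pp.
under eq_bigr do rewrite inc_count_des IH.
rewrite -(count_paths_cat hWS (fun p => ~~ has id (des lt u p))
  (fun a p => wbi ms (des lt a p))).
by apply: eq_count => p; rewrite des_take des_drop.
Qed.

End PathCounts.

(** * Coefficients of quasisymmetric functions *)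

Section FiniteSupportSums.

Lemma fsbig_supp_seq (I : choiceType) (A : set I) (F : I -> rat) (r : seq I) :
  uniq r -> (forall i, A i -> F i != 0 -> i \in r) ->
  (forall i, i \in r -> F i != 0 -> A i) ->
  \sum_(i \in A) F i = \sum_(i <- r) F i.
Proof.
move=> ur Ar rA; rewrite [RHS]fsbig_seq //.
transitivity (\sum_(i \in A `|` [set` r]) F i).
  apply: fsbig_widen => [i|i [[//|ri] nA]]; first by left.
  by apply: contrapT => /eqP/(rA _ ri).
apply/esym/fsbig_widen => [i|i [[Ai|//] nr]]; first by right.
by apply: contrapT => /eqP/(Ar _ Ai).
Qed.

Lemma fsbig_delta (I : choiceType) (A : set I) (x : I) (F : I -> rat) :
  A x -> (forall i, A i -> i <> x -> F i = 0) -> \sum_(i \in A) F i = F x.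
Proof.
move=> Ax F0; rewrite (@fsbig_supp_seq _ A F [:: x]) ?big_seq1 // => i.
  by move=> Ai; rewrite inE; apply: contraR => /eqP/(F0 _ Ai)->.
by rewrite inE => /eqP->.
Qed.

End FiniteSupportSums.

Section Monomials.
Implicit Types (m : {cmonom nat}) (i j k a : nat).

Definition mpow i a : {cmonom nat} := iter a (mmul (ucm i)) mone.

Lemma mpowE i a j : mpow i a j = (if i == j then a else 0)%N.
Proof.
elim: a => [|a IH]; first by rewrite /mpow cm1 if_same.
by rewrite /mpow /= cmM -/(mpow i a) IH cmU; case: eqP.
Qed.

Lemma monom_mul (m1 m2 : {cmonom nat}) :
  << m1 >> * << m2 >> = << mmul m1 m2 >> :> {malg rat[{cmonom nat}]}.
Proof. by apply: etrans (fgmulUU 1 1 m1 m2) _; congr << _ *g _ >>; rewrite mul1r. Qed.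

Lemma x_exp i a : x_ i ^+ a = << mpow i a >>.
Proof.
elim: a => [|a IH]; first by rewrite expr0.
rewrite exprS IH -[mpow i a.+1]/(mmul (ucm i) (mpow i a)); exact: monom_mul.
Qed.

Lemma prod_x (I : Type) (r : seq I) (f a : I -> nat) :
  exists2 m, \prod_(i <- r) x_ (f i) ^+ a i = << m >> &
    forall j, m j = (\sum_(i <- r) if f i == j then a i else 0)%N.
Proof.
elim: r => [|i r [m mE mj]].
  by exists mone => [|j]; rewrite big_nil ?cm1.
exists (mmul (mpow (f i) (a i)) m) => [|j].
  rewrite big_cons mE x_exp; exact: monom_mul.
by rewrite big_cons cmM mpowE mj.
Qed.

Lemma coef_prod_x (I : Type) (r : seq I) (f a : I -> nat) m :
  (\prod_(i <- r) x_ (f i) ^+ a i)@_m =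
  (`[< forall j, m j = (\sum_(i <- r) if f i == j then a i else 0)%N >])%:R.
Proof.
have [m' -> m'E] := prod_x r f a; rewrite mcoeffU1; congr (_%:R); congr nat_of_bool.
apply/eqP/asboolP => [<- //|mE]; apply/eqP/cmP => j.
by rewrite m'E mE.
Qed.

Definition var_bound m : nat := (\max_(i <- finsupp m) i.+1)%N.

Lemma var_bound_out m j : (var_bound m <= j)%N -> m j = 0%N.
Proof.
move=> le; apply/eqP; rewrite cmE_eq0; apply/negP => jm.
have : (j.+1 <= var_bound m)%N by rewrite /var_bound (big_rem j) //= leq_maxl.
by rewrite ltnNge le.
Qed.

Lemma var_bound_last m k : var_bound m = k.+1 -> (0 < m k)%N.
Proof.
move=> E; rewrite lt0n cmE_neq0; suff [i im ->] : exists2 i, i \in enum_fset (finsupp m) & k = i by [].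
move: E; rewrite /var_bound.
elim: (enum_fset (finsupp m)) => [|i r IH]; first by rewrite big_nil.
rewrite big_cons; case: (leqP (\max_(i0 <- r) i0.+1)%N i) => h.
  by rewrite (maxn_idPl _) ?leqW // => -[<-]; exists i; rewrite ?inE ?eqxx.
rewrite (maxn_idPr _) // => /IH[j jr kj]; exists j => //.
by rewrite inE jr orbT.
Qed.

(** Zeros are kept here, as the steps of a multichain are matched with all variables up to the last
    that occurs; [mcomp] drops them. *)
Definition exponents m : seq nat := [seq m i | i <- iota 0 (var_bound m)].
Definition msupport m : seq nat := [seq i <- iota 0 (var_bound m) | (0 < m i)%N].
Definition mcomp m : seq nat := [seq m i | i <- msupport m].

Lemma mcompE m : mcomp m = [seq a <- exponents m | (0 < a)%N].
Proof. by rewrite /mcomp /msupport /exponents filter_map. Qed.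

Lemma mcomp_composition m : composition (mcomp m).
Proof. by rewrite mcompE /composition; apply/allP => a; rewrite mem_filter => /andP[]. Qed.

Lemma sumn_filter_pos (s : seq nat) : sumn [seq a <- s | (0 < a)%N] = sumn s.
Proof. by elim: s => //= -[|a] s IH /=; rewrite IH. Qed.

Lemma sumn_exponents m : sumn (exponents m) = mdeg m.
Proof.
rewrite mdegE /exponents sumnE big_map; apply/esym.
rewrite [LHS](perm_big [seq i <- iota 0 (var_bound m) | i \in finsupp m]) /=.
  rewrite big_filter big_mkcond; apply: eq_bigr => i _.
  by rewrite -cmE_neq0; case: eqP => // ->.
apply: uniq_perm; rewrite ?filter_uniq ?iota_uniq ?fset_uniq //.
move=> i; rewrite mem_filter mem_iota /= add0n; case im : (i \in finsupp m) => //=.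
apply/esym; rewrite ltnNge; apply/negP => /var_bound_out/eqP.
by rewrite cmE_eq0 im.
Qed.

Lemma sumn_mcomp m : sumn (mcomp m) = mdeg m.
Proof. by rewrite mcompE sumn_filter_pos sumn_exponents. Qed.

Lemma mem_msupport m i : (i \in msupport m) = (0 < m i)%N.
Proof.
rewrite mem_filter mem_iota /= add0n; case: posnP => //= mi.
by rewrite ltnNge; apply/negP => /var_bound_out E; rewrite E in mi.
Qed.

Lemma sorted_msupport m : sorted ltn (msupport m).
Proof. exact/(sorted_filter ltn_trans)/iota_ltn_sorted. Qed.

Lemma zip_exponents m (i al : seq nat) : sorted ltn i -> size i = size al ->
  composition al ->
  (forall j, m j = (\sum_(ia <- zip i al) if ia.1 == j then ia.2 else 0)%N) <->
  i = msupport m /\ al = mcomp m.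
Proof.
move=> si; have {}si' := si; move: (sorted_uniq ltn_trans ltnn si) => ui sz cal.
have F j : (\sum_(ia <- zip i al) if ia.1 == j then ia.2 else 0)%N =
    if j \in i then nth 0%N al (index j i) else 0%N.
  elim: i al sz ui {si si' cal} => [|i0 i IH] [|a al] //=; first by rewrite big_nil.
  move=> [sz] /andP[nin ui]; rewrite big_cons /= IH // inE (eq_sym i0).
  have [->|] := eqVneq j i0; first by rewrite (negbTE nin) addn0.
  by rewrite add0n.
split=> [mE|[iE aE] j].
  have iE : i = msupport m.
    apply: (irr_sorted_eq ltn_trans ltnn si (sorted_msupport m)) => j.
    rewrite mem_msupport mE F; case: ifP => // ji.
    by apply/esym/(allP cal)/mem_nth; rewrite -sz index_mem.
  split=> //; rewrite /mcomp -iE; apply: (@eq_from_nth _ 0%N); first by rewrite size_map.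
  move=> k kal; rewrite (nth_map 0%N) ?sz // mE F mem_nth ?sz // index_uniq ?sz //.
rewrite F iE mem_msupport aE; case: posnP => // mj.
have jm : j \in msupport m by rewrite mem_msupport.
by rewrite /mcomp (nth_map 0%N) ?index_mem // nth_index.
Qed.

(** As the parts are positive, the monomial determines its increasing sequence of indices, namely
    its support; at most one term counts. *)
Lemma M_coef al m : composition al -> M_ al m = (al == mcomp m)%:R.
Proof.
move=> cal; rewrite /M_ /ser_sum /ser_of_poly.
have E (i : seq nat) : sorted ltn i -> size i = size al ->
    (\prod_(ia <- zip i al) x_ ia.1 ^+ ia.2)@_m = ((i == msupport m) && (al == mcomp m))%:R.
  move=> si sz; rewrite coef_prod_x; congr (_%:R); congr nat_of_bool.
  apply/asboolP/andP => [/(zip_exponents m si sz cal)[-> ->]//|[/eqP iE /eqP aE]].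
  exact/zip_exponents.
have [aE|ne] := eqVneq al (mcomp m); last first.
  by rewrite fsbig1 // => i [si sz]; rewrite E // (negbTE ne) andbF.
rewrite (@fsbig_delta _ _ (msupport m)) ?E ?eqxx ?aE ?eqxx //.
- exact: sorted_msupport.
- by rewrite size_map.
- by split; [exact: sorted_msupport | rewrite size_map].
move=> i [si sz] ine; rewrite -aE E ?aE //.
by case: eqP.
Qed.

Lemma L_coef be m : L_ be m = (`[< refines (mcomp m) be >])%:R.
Proof.
rewrite /L_ /ser_sum; case: asboolP => h.
  rewrite (@fsbig_delta _ _ (mcomp m)); first by rewrite M_coef ?eqxx //; exact: mcomp_composition.
    by split=> //; exact: mcomp_composition.
  by move=> al [cal _] /eqP ne; rewrite M_coef // (negbTE ne).
rewrite fsbig1 // => al [cal ref]; rewrite M_coef //.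
by case: eqP => // alE; case: h; rewrite -alE.
Qed.

Lemma ser1_coef m : ser1 m = (m == mone)%:R.
Proof. by rewrite /ser1 /ser_of_poly mcoeff1. Qed.

Lemma mcomp_nil m : (mcomp m == [::]) = (m == mone).
Proof.
rewrite -mdeg_eq0 -sumn_mcomp; apply/eqP/eqP => [->//|].
exact/composition_sumn0/mcomp_composition.
Qed.

Lemma coef_prod_poly_x k (P : nat -> {poly nat}) m :
  (\prod_(j < k) (map_poly (fun n : nat => n%:R) (P j)).[x_ j])@_m =
  if (var_bound m <= k)%N then (\prod_(j < k) ((P j)`_(m j))%R)%:R else 0.
Proof.
(* This bounds all degrees and all exponents of m, so that the choice [f0] of the exponents of m is
   among the functions over which the product is expanded. *)
pose d := (\max_(j < k) maxn (size (P j)) (m j)).+1.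
have dP (j : 'I_k) : (size (P j) <= d)%N.
  by rewrite ltnW // ltnS (leq_trans _ (leq_bigmax j)) // leq_maxl.
have dm (j : 'I_k) : (m j < d)%N.
  by rewrite ltnS (leq_trans _ (leq_bigmax j)) // leq_maxr.
have hE (j : 'I_k) : (map_poly (fun n : nat => n%:R) (P j)).[x_ j] =
    \sum_(i < d) ((P j)`_i)%R%:R * x_ j ^+ i :> {malg rat[{cmonom nat}]}.
  rewrite (@horner_coef_wide _ d).
    by apply: eq_bigr => i _; rewrite coef_map_id0.
  by apply: leq_trans (dP j); apply: size_poly.
under eq_bigr do rewrite hE.
rewrite bigA_distr_bigA /= raddf_sum /=.
have termE (f : {ffun 'I_k -> 'I_d}) :
    (\prod_(i < k) (((P i)`_(f i))%R%:R * x_ i ^+ f i))@_m =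
    (\prod_(i < k) ((P i)`_(f i))%R)%:R *
    (`[< forall j, m j = (\sum_(i < k) if val i == j then val (f i) else 0)%N >])%:R :> rat.
  rewrite big_split /= -natr_prod [X in mcoeff m X]mulr_natl mcoeffMn.
  by rewrite (@coef_prod_x _ _ (fun i : 'I_k => val i) (fun i : 'I_k => val (f i))) mulr_natl.
have sumE (f : {ffun 'I_k -> 'I_d}) j :
    (\sum_(i < k) if val i == j then val (f i) else 0)%N =
    if insub j is Some i then val (f i) else 0%N.
  case: insubP => [i jk ij|nk].
    rewrite (bigD1 i) //= ij eqxx big1 ?addn0 // => i' ne.
    by case: eqP => // E; case/eqP: ne; apply: val_inj; exact: etrans E (esym ij).
  by rewrite big1 // => i _; case: eqP => // E; move: nk; rewrite -E ltn_ord.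
under eq_bigr do rewrite termE.
case: leqP => h; last first.
  rewrite big1 // => f _; case: asboolP => [mE|]; last by rewrite mulr0.
  have [l lE] : exists l, var_bound m = l.+1 by exists (var_bound m).-1; rewrite prednK //; lia.
  have := var_bound_last lE; rewrite mE sumE insubF //.
  by rewrite lE in h; lia.
pose f0 : {ffun 'I_k -> 'I_d} := [ffun j => Ordinal (dm j)].
rewrite (bigD1 f0) //= [X in _ + X]big1 => [|f ne].
  rewrite addr0 asboolT ?mulr1; last first.
    move=> j; rewrite sumE; case: insubP => [i jk ij|nk]; first by rewrite ffunE /= ij.
    by rewrite var_bound_out // (leq_trans h) // leqNgt.
  by congr (_%:R); apply: eq_bigr => j _; rewrite ffunE.
case: asboolP => [mE|]; last by rewrite mulr0.
case/eqP: ne; apply/ffunP => i; rewrite ffunE; apply: val_inj => /=.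
by rewrite mE sumE valK.
Qed.

End Monomials.

(** * Coefficients of the R-quasisymmetric function *)

Section FtildeCoefficients.
Variables (W : groupType) (S : set W) (lt : rel W) (H : algType laurent) (T : W -> H).
Hypotheses (hWS : coxeter_system S) (hlt : reflection_order S lt).
Hypothesis hHT : hecke_algebra S T.
Implicit Types (u v a : W) (c : seq W) (m : {cmonom nat}).

(** Neighbours need not be comparable: such sequences contribute 0, and without the condition the
    list follows the recursion of [block_count]. *)
Fixpoint chains k u v : seq (seq W) :=
  if k is k'.+1 then [seq a :: c | a <- below S v, c <- chains k' a v]
  else if u == v then [:: [::]] else [::].

Lemma chains_uniq k u v : uniq (chains k u v).
Proof.
elim: k u => [|k IH] u /=; first by case: eqP.
apply: allpairs_uniq_dep => //; first exact: below_uniq.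
move=> [a c] [a' c'] _ _ /= [-> ->] //.
Qed.

Lemma chainsP k u v c :
  c \in chains k u v <->
  [/\ size c = k, last u c = v & forall x, x \in c -> bruhat_le S x v].
Proof.
elim: k u c => [|k IH] u c /=.
  split; last by move=> [/size0nil-> /= -> _]; rewrite eqxx inE.
  by case: eqP => // ->; rewrite inE => /eqP->.
split.
  move=> /allpairsPdep[a [c' [/(belowP hWS) av /IH[sz l h] ->]]] /=; rewrite sz; split=> // x.
  by rewrite inE => /orP[/eqP->|/h].
case: c => [|a c] [] //= [sz] l h; apply/allpairsPdep; exists a, c; split=> //.
  by apply/(belowP hWS)/h; rewrite inE eqxx.
by apply/IH; split=> // x xc; apply: h; rewrite inE xc orbT.
Qed.

Lemma block_count_chains u (ms : seq nat) v :
  block_count S lt u ms v = (\sum_(c <- chains (size ms) u v)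
    \prod_(j < size c)
      inc_count S lt (nth 0 ms j) (nth u (u :: c) j) (nth u (u :: c) j.+1))%N.
Proof.
elim: ms u => [|n ms IH] u /=.
  by case: eqP => _; rewrite ?big_nil // big_seq1 big_ord0.
rewrite big_allpairs_dep; apply: eq_bigr => a _; rewrite IH big_distrr /=.
apply: eq_big_seq => c /chainsP[sz _ _]; rewrite big_ord_recl /=; congr muln.
apply: eq_bigr => j _; rewrite /bump /= ?add1n /=; congr inc_count.
  by apply: set_nth_default; rewrite /= ltnW // ltnS.
by apply: set_nth_default.
Qed.

Lemma bruhat_chain_le u c x : path (fun x y => `[< bruhat_le S x y >]) u c ->
  x \in u :: c -> bruhat_le S x (last u c).
Proof.
elim: c u x => [|y c IH] u x /=; first by rewrite inE => _ /eqP->; apply: bruhat_le_refl.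
move=> /andP[/asboolP uy yc]; rewrite inE => /orP[/eqP->|]; last exact: IH.
by apply: bruhat_le_trans uy _; apply: IH => //; rewrite inE eqxx.
Qed.

Lemma inc_count0_eq u v : inc_count S lt 0 u v != 0%N -> u = v.
Proof.
rewrite -lt0n -has_count => /hasP[p /(pathsP hWS)[pp /size0nil p0] _].
by apply/bruhat_path_nil; rewrite -p0; exact: pp.
Qed.

Lemma inc_count_diag n v : inc_count S lt n v v != 0%N -> n = 0%N.
Proof. by move=> /(inc_count_support hWS)[_ le _]; lia. Qed.

(** Only multichains with [var_bound m] steps matter. Shorter ones lack the last variable of m;
    longer ones would take their last step with exponent 0, hence from v to v, which multichains
    forbid. Conversely, a positive last exponent makes the last step proper. *)
Lemma Ftilde_neq u v m : u <> v ->
  Ftilde S T u v m = (block_count S lt u (exponents m) v)%:R.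
Proof.
move=> uv; rewrite /Ftilde (introF eqP uv) /ser_sum /ser_of_poly.
pose F c : nat := (\prod_(j < size c)
  inc_count S lt (m j) (nth u (u :: c) j) (nth u (u :: c) j.+1))%N.
have coefE c : multichain S u v c ->
    (\prod_(j < size c) (map_poly (fun n : nat => n%:R)
        (Rtilde S T (nth u (u :: c) j) (nth u (u :: c) j.+1))).[x_ j])@_m =
    if (var_bound m <= size c)%N then (F c)%:R else 0 :> rat.
  move=> [_ pc _ _].
  rewrite (@coef_prod_poly_x (size c)
    (fun j => Rtilde S T (nth u (u :: c) j) (nth u (u :: c) j.+1))).
  case: ifP => // _; congr (_%:R); apply: eq_bigr => j _.
  rewrite (Rtilde_inc hWS hlt hHT) ?coef_inc_poly //.
  by have /asboolP := pathP u pc j (ltn_ord j).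
rewrite (eq_fsbigr (fun c => if (var_bound m <= size c)%N then (F c)%:R else 0)); last first.
  by move=> c /set_mem; apply: coefE.
rewrite (@fsbig_supp_seq _ _ _ (chains (var_bound m) u v)).
- rewrite block_count_chains size_map size_iota natr_sum.
  apply: eq_big_seq => c /chainsP[sz _ _]; rewrite sz leqnn /F; congr (_%:R).
  rewrite sz; apply: eq_bigr => j _.
  by rewrite /exponents (nth_map 0%N) ?size_iota // nth_iota.
- exact: chains_uniq.
- move=> c [c0 pc lc ne]; case: ifP => [h|]; last by rewrite eqxx.
  rewrite Num.Theory.pnatr_eq0 => Fc; apply/chainsP; split=> //; last first.
    by move=> x xc; rewrite -lc; apply: bruhat_chain_le => //; rewrite inE xc orbT.
  apply/eqP; rewrite eqn_leq h andbT leqNgt; apply/negP => lt1.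
  have lj : ((size c).-1 < size c)%N by rewrite prednK.
  move: Fc; rewrite /F (bigD1 (Ordinal lj)) //= muln_eq0 negb_or => /andP[+ _].
  rewrite var_bound_out; last by lia.
  by rewrite nth_last lc => /inc_count0_eq E; case: ne.
move=> c /chainsP[sz lc h]; case: ifP => [_|]; last by rewrite eqxx.
rewrite Num.Theory.pnatr_eq0 => Fc.
have Fj j : (j < size c)%N -> inc_count S lt (m j) (nth u (u :: c) j) (nth u (u :: c) j.+1) != 0%N.
  by move=> jc; move: Fc; rewrite /F (bigD1 (Ordinal jc)) //= muln_eq0 negb_or => /andP[].
have c0 : (0 < size c)%N.
  by case: (c) lc uv => //= -> /(_ erefl).
split=> //.
  apply/(pathP u) => j jc; apply/asboolP.
  by have /(inc_count_support hWS)[] := Fj j jc.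
move=> E; have lj : ((size c).-1 < size c)%N by rewrite prednK.
have L : nth u (u :: c) (size c) = v by rewrite -lc; exact: (nth_last u (u :: c)).
have := Fj _ lj; rewrite E prednK // L => /inc_count_diag m0.
have := @var_bound_last m (size c).-1; rewrite prednK // m0 sz => /(_ erefl).
by [].
Qed.

End FtildeCoefficients.

Section Expansions.
Variables (W : groupType) (S : set W) (lt : rel W) (H : algType laurent) (T : W -> H).
Hypotheses (hWS : coxeter_system S) (hlt : reflection_order S lt).
Hypothesis hHT : hecke_algebra S T.
Implicit Types (u v a : W) (c : seq W) (m : {cmonom nat}).

Lemma pscaleE (a : rat) (f : pseries) m : (a *: f) m = a * f m.
Proof. by []. Qed.

(** Increasing along consecutive blocks means that descents occur only at junctions. For u = v, no
    path of positive length returns to v. *)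
Lemma Ftilde_coef u v m : Ftilde S T u v m = (c_ S lt u v (mcomp m))%:R.
Proof.
have cm := mcomp_composition m.
have cE : c_ S lt u v (mcomp m) = block_count S lt u (exponents m) v.
  rewrite (c_count lt hWS) // (block_countE hWS hlt) // mcompE sumn_filter_pos.
  by apply: eq_count => p; rewrite wbi_filter.
have [uv|uv] := pselect (u = v); last by rewrite (Ftilde_neq hWS hlt hHT) // cE.
rewrite uv in cE *; rewrite /Ftilde eqxx ser1_coef; congr (_%:R).
have [m1|m1] := eqVneq m mone.
  have -> : mcomp m = [::] by apply/eqP; rewrite mcomp_nil m1.
  have := block_countE hWS hlt v [::] v; rewrite /= eqxx => E.
  by rewrite (c_count lt hWS) // -E.
rewrite cE (block_countE hWS hlt) // sumn_exponents.
have -> : paths S (mdeg m) v v = [::]; last by [].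
case E : (paths S (mdeg m) v v) => [|p l] //.
have /(pathsP hWS)[pp sz] : p \in paths S (mdeg m) v v by rewrite E inE eqxx.
have := bruhat_path_len pp; rewrite sz.
by move: m1; rewrite -mdeg_eq0 -lt0n; lia.
Qed.

Lemma c_refines u v al : composition al ->
  c_ S lt u v al = (\sum_(p <- paths S (sumn al) u v)
    `[< refines al (path_composition lt u p) >])%N.
Proof.
move=> cal; rewrite (c_count lt hWS) // count_sum.
apply: eq_big_seq => p /(pathsP hWS)[_ sz]; congr nat_of_bool.
by apply/idP/asboolP => /(refines_path_composition lt u cal (esym sz)).
Qed.

Lemma c_expansion u v m :
  ser_sum [set al | composition al] (fun al => (c_ S lt u v al)%:R *: M_ al) m =
  (c_ S lt u v (mcomp m))%:R.
Proof.
rewrite /ser_sum (@fsbig_delta _ _ (mcomp m)).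
- by rewrite pscaleE M_coef ?eqxx ?mulr1 //; exact: mcomp_composition.
- exact: mcomp_composition.
by move=> al cal /eqP/negbTE ne; rewrite pscaleE M_coef // ne mulr0.
Qed.

(** The coefficient sums b over the compositions that [mcomp m] refines; after exchanging sums, each
    path is counted once, at its own descent composition. *)
Lemma b_expansion u v m :
  ser_sum [set al | composition al] (fun al => (b_ S lt u v al)%:R *: L_ al) m =
  (c_ S lt u v (mcomp m))%:R.
Proof.
rewrite /ser_sum.
pose P := paths S (mdeg m) u v; pose r := undup (map (path_composition lt u) P).
have rP al : al \in r -> composition al /\ sumn al = mdeg m.
  rewrite mem_undup => /mapP[p /(pathsP hWS)[_ sz] ->].
  by rewrite sumn_path_composition sz; split=> //; apply: path_composition_composition.
rewrite (@fsbig_supp_seq _ _ _ r); first last.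
- by move=> al /rP[].
- move=> al cal; rewrite pscaleE L_coef; case: asboolP => [ref|]; last by rewrite mulr0 eqxx.
  rewrite mulr1 Num.Theory.pnatr_eq0 (b_count lt hWS) -(refines_sumn ref) sumn_mcomp.
  rewrite -lt0n -has_count => /hasP[p pP /eqP<-].
  by rewrite mem_undup; apply: map_f.
- exact: undup_uniq.
rewrite c_refines ?sumn_mcomp -/P; last exact: mcomp_composition.
transitivity (\sum_(al <- r) \sum_(p <- P)
    ((path_composition lt u p == al) * `[< refines (mcomp m) al >])%N%:R : rat).
  apply: eq_big_seq => al /rP[cal sal].
  rewrite pscaleE L_coef (b_count lt hWS) sal count_sum -natrM big_distrl /=.
  by rewrite natr_sum.
rewrite exchange_big natr_sum /=; apply: eq_big_seq => p pP.
rewrite (bigD1_seq (path_composition lt u p)) ?undup_uniq ?mem_undup ?map_f //=.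
rewrite eqxx mul1n big1 ?addr0 // => al /negbTE.
by rewrite eq_sym => ->.
Qed.

End Expansions.

(** * Descent words as polynomials in c and d *)

Section CdSpan.
Implicit Types (w x : seq bool) (ns : seq nat) (f g : seq bool -> rat).

(** The coefficient of w in a cd-word: c allows any letter, and d = xy + yx forces two adjacent
    letters to differ. The final power of c gives no condition, so it is not an argument. *)
Fixpoint chi ns w : bool :=
  if ns is n :: ns' then (nth false w n != nth false w n.+1) && chi ns' (drop n.+2 w)
  else true.

(* [f] agrees on the words of length [N] with the coefficient function of a polynomial
   in c = x + y and d = xy + yx, where [false] stands for x and [true] for y. *)
Inductive cdspan (N : nat) : (seq bool -> rat) -> Prop :=
| CdWord (ws : cdword) of cd_deg ws = N : cdspan N (fun w => (chi ws.1 w)%:R)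
| CdAdd f g of cdspan N f & cdspan N g : cdspan N (fun w => f w + g w)
| CdScale (a : rat) f of cdspan N f : cdspan N (fun w => a * f w)
| CdExt f g of cdspan N f & (forall w, size w = N -> f w = g w) : cdspan N g.

Lemma cd_degE ns n0 : cd_deg (ns, n0) = (sumn ns + (size ns).*2 + n0)%N.
Proof. by rewrite /cd_deg /cd_m /= take_size. Qed.

Lemma cdspan_const N (a : rat) : cdspan N (fun=> a).
Proof.
apply: (CdExt (CdScale a (@CdWord N ([::], N) _))); first by rewrite cd_degE.
by move=> w _; rewrite mulr1.
Qed.

Lemma cdspan_sum N (I : Type) (r : seq I) (F : I -> seq bool -> rat) :
  (forall i, cdspan N (F i)) -> cdspan N (fun w => \sum_(i <- r) F i w).
Proof.
move=> h; elim: r => [|i r IH].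
  by apply: (CdExt (cdspan_const N 0)) => w _; rewrite big_nil.
by apply: (CdExt (CdAdd (h i) IH)) => w _; rewrite big_cons.
Qed.

Lemma cdspan_sum_seq N (I : eqType) (r : seq I) (F : I -> seq bool -> rat) :
  (forall i, i \in r -> cdspan N (F i)) -> cdspan N (fun w => \sum_(i <- r) F i w).
Proof.
elim: r => [|i r IH] h.
  by apply: (CdExt (cdspan_const N 0)) => w _; rewrite big_nil.
apply: (CdExt (CdAdd (h i _) (IH _))) => [|j jr|w _]; first by rewrite inE eqxx.
  by apply: h; rewrite inE jr orbT.
by rewrite big_cons.
Qed.

(** Left multiplication by c. *)
Lemma cdspan_c N f : cdspan N f -> cdspan N.+1 (fun w => f (drop 1 w)).
Proof.
elim=> {f} [[ns n0] <-|f g _ IHf _ IHg|a f _ IH|f g _ IH E].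
- case: ns => [|n ns].
    by apply: (CdExt (@CdWord _ ([::], n0.+1) _)).
  apply: (CdExt (@CdWord _ (n.+1 :: ns, n0) _)) => [|w _ /=]; first by rewrite !cd_degE.
  by rewrite !nth_drop drop_drop !add1n addn1.
- exact: CdAdd.
- exact: CdScale.
by apply: (CdExt IH) => w sw; apply: E; rewrite size_drop sw subn1.
Qed.

Lemma cdspan_d N f : cdspan N f ->
  cdspan N.+2 (fun w => (nth false w 0 != nth false w 1)%:R * f (drop 2 w)).
Proof.
elim=> {f} [[ns n0] <-|f g _ IHf _ IHg|a f _ IH|f g _ IH E].
- apply: (CdExt (@CdWord _ (0%N :: ns, n0) _)) => [|w _ /=]; first by rewrite !cd_degE /=; lia.
  by rewrite -natrM mulnb.
- by apply: (CdExt (CdAdd IHf IHg)) => w _; rewrite mulrDr.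
- by apply: (CdExt (CdScale a IH)) => w _; rewrite mulrCA.
by apply: (CdExt IH) => w sw; rewrite E // size_drop sw subn2.
Qed.

(** The coefficient of w in the power of x - y of degree |w|. *)
Definition wsign w : rat := \prod_(b <- w) (if b then -1 else 1).

Lemma wsign_cat w x : wsign (w ++ x) = wsign w * wsign x.
Proof. exact: big_cat. Qed.

(* (x - y)^2 = c^2 - 2 d *)
Lemma cdspan_eps2 N f : cdspan N f ->
  cdspan N.+2 (fun w => wsign (take 2 w) * f (drop 2 w)).
Proof.
move=> hf; apply: (CdExt (CdAdd (cdspan_c (cdspan_c hf)) (CdScale (-2) (cdspan_d hf)))).
move=> [|a [|b w]] // _; rewrite /= drop0 take0 /wsign big_cons big_seq1.
by case: a; case: b; rewrite /= ?mul0r ?mul1r ?mulr1 ?mulr0 ?addr0 ?mulN1r ?opprK ?mul1r //; lra.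
Qed.

Lemma cdspan_eps_even N k f : cdspan N f ->
  cdspan (k.*2 + N) (fun w => wsign (take k.*2 w) * f (drop k.*2 w)).
Proof.
move=> hf; elim: k => [|k IH].
  by apply: (CdExt hf) => w _; rewrite take0 drop0 /wsign big_nil mul1r.
apply: (CdExt (cdspan_eps2 IH)) => w _.
rewrite mulrA -wsign_cat drop_drop addn2 doubleS; congr (wsign _ * _).
by rewrite -[in RHS]add2n takeD.
Qed.

End CdSpan.

(** * The recursion for Psi, and its consequence *)

Section CdRecursion.
Variables (W : groupType) (S : set W) (lt : rel W) (H : algType laurent) (T : W -> H).
Hypotheses (hWS : coxeter_system S) (hlt : reflection_order S lt).
Hypothesis hHT : hecke_algebra S T.
Implicit Types (u v a : W) (w : seq bool) (p : seq W).

Definition descent_count (R : rel W) u v w : nat :=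
  count (fun p => des R u p == w) (paths S (size w).+1 u v).

Let psi (R : rel W) u v w : rat := (descent_count R u v w)%:R.
Let e n u v : rat := (inc_count S lt n u v)%:R.

Lemma des_rev u v p : bruhat_path S u v p ->
  des (fun x y => lt y x) u p = map negb (des lt u p).
Proof.
rewrite /des; elim: p u => [|x p IH] u // /bruhat_path_cons[[ru ux]].
case: p IH => [|y p] IH // pp; have := IH x pp.
move: pp => /bruhat_path_cons[[rx xy] _] /= ->; congr cons.
exact: (bruhat_edge_lt hWS hlt (conj ru ux) (conj rx xy)).
Qed.

Lemma descent_count_rev u v w :
  descent_count (fun x y => lt y x) u v (map negb w) = descent_count lt u v w.
Proof.
rewrite /descent_count size_map; apply: eq_in_count => p /(pathsP hWS)[pp _].
by rewrite (des_rev pp) inj_eq //; apply: inj_map => -[] [].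
Qed.

(** An increasing path of k + 1 steps carries the letters x^k; the letter at its junction with the
    second path is arbitrary, whence two terms. *)
Lemma descent_count_split (R : rel W) u v k w : reflection_order S R ->
  (\sum_(a <- below S v) inc_count S R k.+1 u a * descent_count R a v w =
   descent_count R u v (nseq k false ++ true :: w) +
   descent_count R u v (nseq k false ++ false :: w))%N.
Proof.
move=> hR; rewrite /descent_count !size_cat /= !size_nseq.
under eq_bigr do rewrite (inc_count_des hWS hR).
rewrite -(count_paths_cat hWS (fun p => ~~ has id (des R u p)) (fun a p => des R a p == w)).
rewrite addSn !count_sum -big_split /=; apply: eq_big_seq => p /(pathsP hWS)[_ sz].
rewrite des_take des_drop /=.
have szd : size (des R u p) = (k + (size w).+1)%N by rewrite size_des sz; lia.
have kd : (k < size (des R u p))%N by rewrite szd; lia.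
rewrite -{3 4}(cat_take_drop k (des R u p)) (drop_nth false kd).
rewrite !eqseq_cat ?size_nseq ?size_takel ?(ltnW kd) // !eqseq_cons.
have -> : ~~ has id (take k (des R u p)) = (take k (des R u p) == nseq k false).
  have : size (take k (des R u p)) = k by rewrite size_takel // ltnW.
  move: (take k _) => x <-; elim: x => //= b x IH; rewrite eqseq_cons -IH.
  by case: b.
by case: (take _ _ == _); case: (nth false _ _) (_ == w) => [] [].
Qed.

Lemma inc_count_descent_count (R : rel W) k u v : reflection_order S R ->
  inc_count S R k.+1 u v = descent_count R u v (nseq k false).
Proof.
move=> hR; rewrite (inc_count_des hWS hR) /descent_count size_nseq.
apply: eq_in_count => p /(pathsP hWS)[_ sz].
have : size (des R u p) = k by rewrite size_des sz.
by move=> <-; elim: (des R u p) => //= b x IH; rewrite eqseq_cons -IH; case: b.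
Qed.

(* Expand the letters of w one after the other, using that y = c - x at a descent. *)
Lemma descent_count_telescope (R : rel W) u v w : reflection_order S R ->
  psi R u v w = wsign w * (inc_count S R (size w).+1 u v)%:R +
    \sum_(k < size w) (nth false w k)%:R * (wsign (take k w) *
       \sum_(a <- below S v) (inc_count S R k.+1 u a)%:R * psi R a v (drop k.+1 w)).
Proof.
move=> hR.
suff tele j : (j <= size w)%N ->
    psi R u v w = wsign (take j w) * psi R u v (nseq j false ++ drop j w) +
    \sum_(k < j) (nth false w k)%:R * (wsign (take k w) *
       \sum_(a <- below S v) (inc_count S R k.+1 u a)%:R * psi R a v (drop k.+1 w)).
  rewrite (tele (size w) (leqnn _)) take_size drop_size cats0.
  by rewrite (inc_count_descent_count _ _ _ hR).
elim: j => [|j IH] jw.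
  by rewrite take0 drop0 big_ord0 addr0 /wsign big_nil mul1r.
rewrite (IH (ltnW jw)) big_ord_recr /= addrA [in RHS]addrAC; congr (_ + _).
rewrite (take_nth false jw) -cats1 wsign_cat /wsign big_seq1 -/(wsign _).
have -> : \sum_(a <- below S v) (inc_count S R j.+1 u a)%:R * psi R a v (drop j.+1 w) =
    psi R u v (nseq j false ++ true :: drop j.+1 w) +
    psi R u v (nseq j false ++ false :: drop j.+1 w) :> rat.
  rewrite /psi -natrD -descent_count_split // natr_sum.
  by apply: eq_bigr => a _; rewrite natrM.
have -> : false :: nseq j false ++ drop j.+1 w = nseq j false ++ false :: drop j.+1 w.
  by move: (drop _ w) => z; elim: (j) => //= i ->.
rewrite (drop_nth false jw); case: (nth false w j) => /=.
  by rewrite mul1r mulrN1 mulNr mulrDr addrCA addNr addr0.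
by rewrite mul0r addr0 mulr1.
Qed.

Lemma wsign_negb w : wsign (map negb w) = (-1) ^+ size w * wsign w.
Proof.
rewrite /wsign big_map; elim: w => [|b w IH]; first by rewrite !big_nil mulr1.
by rewrite !big_cons IH /= exprS; case: b => /=; rewrite ?mulN1r ?mul1r ?mulrN ?mulNr ?opprK.
Qed.

(* Sum of the expansions of Psi with respect to [lt] and to the reversed order. *)
Lemma descent_count_rec u v w :
  2 * psi lt u v w = (1 + (-1) ^+ size w) * e (size w).+1 u v * wsign w +
    \sum_(k < size w) (if odd k then - wsign (take k.+1 w) else wsign (take k w)) *
       \sum_(a <- below S v) e k.+1 u a * psi lt a v (drop k.+1 w).
Proof.
have hgt := reflection_order_rev hWS hlt.
have E1 := descent_count_telescope u v w hlt.
have := descent_count_telescope u v (map negb w) hgt.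
rewrite {1}/psi descent_count_rev -/(psi lt u v w) size_map wsign_negb.
rewrite (inc_count_rev hWS hlt hHT) => E2.
rewrite mulr_natl mulr2n {1}E1 E2 -!/(e _ _ _) addrACA; congr (_ + _).
  by move: (wsign w) (e _ _ _) ((-1) ^+ _) => x y z; ring.
(* The two orderings contribute (x - y)^k y and (-1)^k (x - y)^k x. Their sum is (x - y)^k c for
   even k and -(x - y)^(k+1) for odd k, so only even powers of x - y survive. *)
rewrite -big_split /=; apply: eq_bigr => k _.
under [X in _ + _ * (_ * X)]eq_bigr => a _ do
  rewrite (inc_count_rev hWS hlt hHT) -map_drop /psi descent_count_rev -/(psi _ _ _ _).
rewrite -!/(e _ _ _) (nth_map false) ?ltn_ord // -map_take wsign_negb size_takel 1?ltnW ?ltn_ord //.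
rewrite !mulrA -mulrDl; congr (_ * _).
have -> : wsign (take k.+1 w) = wsign (take k w) * (if nth false w k then -1 else 1).
  by rewrite (take_nth false (ltn_ord k)) -cats1 wsign_cat {2}/wsign big_seq1.
rewrite -signr_odd; move: (wsign _) => s.
by case: (odd k); case: (nth false w k) => /=; ring.
Qed.

Lemma psi_cdspan N u v : cdspan N (psi lt u v).
Proof.
elim/ltn_ind: N u => N IH u.
(* The scalar 1 + (-1)^N vanishes for odd N, so the factor [~~ odd N] costs nothing there and leaves
   an even power of x - y otherwise. *)
apply: (CdExt (CdScale (2^-1) (CdAdd
  (CdScale ((1 + (-1) ^+ N) * e N.+1 u v) (_ : cdspan N (fun w => (~~ odd N)%:R * wsign w)))
  (cdspan_sum_seq (r := index_enum 'I_N) (F := fun k w =>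
    (if odd k then - wsign (take k.+1 w) else wsign (take k w)) *
       \sum_(a <- below S v) e k.+1 u a * psi lt a v (drop k.+1 w)) _)))).
- case: (boolP (odd N)) => oN /=.
    by apply: (CdExt (cdspan_const N 0)) => w _; rewrite mul0r.
  have := cdspan_eps_even N./2 (cdspan_const 0 1); rewrite addn0 even_halfK // => h.
  apply: (CdExt h) => w sw.
  by rewrite mulr1 mul1r -{1}sw take_size.
- move=> k _; have kN := ltn_ord k.
  have hG : cdspan (N - k.+1) (fun x => \sum_(a <- below S v) e k.+1 u a * psi lt a v x).
    by apply: cdspan_sum => a; apply/CdScale/IH; lia.
  case: (boolP (odd k)) => ok.
    have kE : k.+1 = (k.+1)./2.*2 by rewrite even_halfK //= ok.
    have := cdspan_eps_even (k.+1)./2 hG; rewrite -kE subnKC // => h.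
    by apply: (CdExt (CdScale (-1) h)) => w _; rewrite mulN1r mulNr.
  have kE : nat_of_ord k = k./2.*2 by rewrite even_halfK.
  have := cdspan_eps_even k./2 (cdspan_c hG); rewrite -kE.
  have -> : (k + (N - k.+1).+1 = N)%N by lia.
  by move=> h; apply: (CdExt h) => w _; rewrite drop_drop add1n.
move=> w sw; apply: (@mulfI _ 2) => //; rewrite mulVKf //.
rewrite descent_count_rec sw; congr (_ + _).
by rewrite -signr_odd; case: (odd N); rewrite /= ?mul1r // subrr !mul0r.
Qed.

End CdRecursion.

(** * From cd-polynomials to the peak algebra *)

Section PeakAlgebra.
Implicit Types (w : seq bool) (m : {cmonom nat}) (ws : cdword).

Definition word_set w : {fset nat} := [fset i in iota 1 (size w) | nth false w i.-1]%fset.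

Lemma mem_word_set w i : i \in word_set w = (0 < i)%N && nth false w i.-1.
Proof.
rewrite !inE mem_iota /=; case: i => //= i; rewrite add1n ltnS.
by case: ltnP => // h; rewrite nth_default.
Qed.

Lemma comp_set_word w : comp_set (comp_of_word w) = word_set w.
Proof.
have cw := comp_of_word_composition w.
apply/fsetP => i; rewrite mem_word_set; apply/idP/idP.
  move=> /(mem_comp_set _ cw)[/andP[i0]]; rewrite i0 cbits_comp_of_word nth_rcons.
  rewrite sumn_comp_of_word => il; case: ltngtP => // E; lia.
move=> /andP[i0 wi]; apply/(mem_comp_set _ cw).
have il : (i.-1 < size w)%N.
  by rewrite ltnNge; apply/negP => /(nth_default false) h; rewrite h in wi.
by rewrite i0 cbits_comp_of_word nth_rcons sumn_comp_of_word il wi; split=> //; lia.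
Qed.

Lemma comp_of_set_word w : comp_of_set (size w).+1 (word_set w) = comp_of_word w.
Proof.
have cw := comp_of_word_composition w.
have ex : exists be, [/\ composition be, sumn be = (size w).+1 & comp_set be = word_set w].
  by exists (comp_of_word w); rewrite sumn_comp_of_word comp_set_word.
have [c s E] := xgetPex [::] ex.
by apply: comp_set_inj => //; rewrite ?sumn_comp_of_word // E comp_set_word.
Qed.

Lemma word_set_inj w w' : size w = size w' -> word_set w = word_set w' -> w = w'.
Proof.
move=> sz E; apply: (@eq_from_nth _ false) => // i _.
by have := mem_word_set w i.+1; rewrite E mem_word_set.
Qed.

Lemma big_fpowerset_words N (F : {fset nat} -> pseries) (P : pred {fset nat}) :
  \sum_(A <- fpowerset (interval1 N) | P A) F A =
  \sum_(w : N.-tuple bool | P (word_set w)) F (word_set w).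
Proof.
rewrite (perm_big [seq word_set (tval z) | z <- index_enum (N.-tuple bool : finType)]) /=.
  by rewrite big_map.
apply: uniq_perm; first exact: fset_uniq.
  rewrite map_inj_uniq ?index_enum_uniq // => w w' E.
  by apply/val_inj/word_set_inj; rewrite ?size_tuple.
move=> A; rewrite fpowersetE; apply/fsubsetP/mapP => [AN|[w _ ->] i]; last first.
  rewrite mem_word_set => /andP[i0 wi]; rewrite !inE mem_iota i0 /= add1n ltnS.
  rewrite leqNgt; apply/negP => Ni; rewrite nth_default // size_tuple in wi.
  by lia.
exists [tuple of [seq i.+1 \in A | i <- iota 0 N]]; first by rewrite mem_index_enum.
apply/fsetP => i; rewrite mem_word_set /=; case: i => [|i] /=.
  by apply/negP => /AN; rewrite !inE mem_iota.
have [iN|Ni] := ltnP i N; last first.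
  rewrite nth_default ?size_map ?size_iota //; apply/negP => /AN.
  by rewrite !inE mem_iota; lia.
by rewrite (nth_map 0%N) ?size_iota // nth_iota.
Qed.

Lemma chiE ns w o : chi ns (drop o w) =
  all (fun j => nth false w (o + sumn (take j ns) + j.*2).-2 !=
                nth false w (o + sumn (take j ns) + j.*2).-1) (iota 1 (size ns)).
Proof.
elim: ns o => [|n ns IH] o //=.
rewrite !nth_drop drop_drop IH take0 addn0; congr (_ && _).
  by congr (nth _ _ _ != nth _ _ _); lia.
rewrite (iotaDl 1 1) all_map; apply: eq_in_all => j.
rewrite mem_iota => /andP[j1 _] /=; rewrite ?add0n.
by congr (nth _ _ _ != nth _ _ _); lia.
Qed.

(** The set and its complement both meet {m_j - 1, m_j} iff exactly one of the two elements is in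
    the set. Elements are counted from 1 and letters from 0, so they are the letters m_j - 2 and m_j
    - 1. *)
Lemma in_B_chi ws w : size w = cd_deg ws -> in_B ws (word_set w) = chi ws.1 w.
Proof.
move=> sw; rewrite -[in RHS](drop0 w) chiE /in_B /cd_sets all_map.
apply: eq_in_all => j; rewrite mem_iota => /andP[j1 js] /=.
have mw : (1 < cd_m ws j <= size w)%N.
  rewrite sw /cd_deg /cd_m; have := @sumn_take_le ws.1 j (size ws.1); lia.
rewrite add0n -/(cd_m ws j); move: (cd_m ws j) mw => k /andP[k1 kw].
have int i : i \in interval1 (cd_deg ws) = (0 < i <= size w)%N.
  by rewrite !inE mem_iota sw add1n ltnS.
have A1 : (word_set w `&` [fset k.-1; k] != fset0)%fset = nth false w k.-2 || nth false w k.-1.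
  apply/fset0Pn/orP => [[i]|[h|h]].
  - by rewrite in_fsetI mem_word_set !inE => /andP[/andP[_ wi] /orP[]/eqP iE]; [left|right]; rewrite -iE.
  - by exists k.-1; rewrite in_fsetI mem_word_set !inE eqxx h; lia.
  by exists k; rewrite in_fsetI mem_word_set !inE eqxx orbT h; lia.
have A2 : ((interval1 (cd_deg ws) `\` word_set w) `&` [fset k.-1; k] != fset0)%fset =
    ~~ nth false w k.-2 || ~~ nth false w k.-1.
  apply/fset0Pn/orP => [[i]|[h|h]].
  - rewrite in_fsetI in_fsetD mem_word_set int !inE negb_and -eqn0Ngt.
    move=> /andP[/andP[/orP[/eqP->//|wi] _] /orP[]/eqP iE]; [left|right]; by rewrite -iE.
  - by exists k.-1; rewrite in_fsetI in_fsetD mem_word_set int !inE eqxx (negbTE h) andbF /=; lia.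
  by exists k; rewrite in_fsetI in_fsetD mem_word_set int !inE eqxx orbT (negbTE h) andbF /=; lia.
by rewrite A1 A2; case: (nth _ _ _); case: (nth _ _ _).
Qed.

(** The linear map from words to fundamental quasisymmetric functions of degree N + 1; it takes
    cd-words to the [Theta]. *)
Definition Lmap N (f : seq bool -> rat) : pseries :=
  \sum_(w : N.-tuple bool) f w *: L_ (comp_of_word w).

Lemma Theta_Lmap ws : Theta ws = Lmap (cd_deg ws) (fun w => (chi ws.1 w)%:R).
Proof.
rewrite /Theta big_fpowerset_words big_mkcond; apply: eq_bigr => w _.
have := comp_of_set_word w; rewrite in_B_chi size_tuple // /Lset => ->.
by case: (chi _ _); rewrite ?scale1r ?scale0r.
Qed.

Lemma peak_algebraD f g : peak_algebra f -> peak_algebra g -> peak_algebra (f + g).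
Proof.
move=> [a0 [ws [a ->]]] [b0 [vs [b ->]]].
pose us := undup (ws ++ vs).
(* The lists may overlap and repeat words; multiplicities turn both sums into sums over the
   duplicate-free [us]. *)
exists (a0 + b0), us, (fun w : cdword => a w *+ count_mem w ws + b w *+ count_mem w vs).
rewrite scalerDl addrACA; congr (_ + _).
have E (s : seq cdword) (c : cdword -> rat) : {subset s <= us} ->
    \sum_(w <- s) c w *: Theta w = \sum_(w <- us) (c w *+ count_mem w s) *: Theta w.
  move=> sub; under [RHS]eq_bigr => w _ do
    rewrite -mulr_natr -sum1_count natr_sum big_mkcond mulr_sumr scaler_suml.
  rewrite exchange_big /=; apply: eq_big_seq => x xs.
  rewrite (bigD1_seq x) ?undup_uniq ?sub //= eqxx mulr1 big1 ?addr0 // => y /negbTE.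
  by rewrite eq_sym => ->; rewrite mulr0 scale0r.
rewrite (E ws a) => [|x h]; last by rewrite mem_undup mem_cat h.
rewrite (E vs b) => [|x h]; last by rewrite mem_undup mem_cat h orbT.
by rewrite -big_split; apply: eq_bigr => x _; rewrite scalerDl.
Qed.

Lemma peak_algebraZ (c : rat) f : peak_algebra f -> peak_algebra (c *: f).
Proof.
move=> [a0 [ws [a ->]]]; exists (c * a0), ws, (fun w : cdword => c * a w).
by rewrite scalerDr scalerA scaler_sumr; congr (_ + _); apply: eq_bigr => w _; rewrite scalerA.
Qed.

Lemma peak_algebra1 (c : rat) : peak_algebra (c *: ser1).
Proof. by exists c, [::], (fun=> 0); rewrite big_nil addr0. Qed.

Lemma peak_algebra_sum (I : Type) (r : seq I) (F : I -> pseries) :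
  (forall i, peak_algebra (F i)) -> peak_algebra (\sum_(i <- r) F i).
Proof.
move=> h; elim: r => [|i r IH].
  by rewrite big_nil -(scale0r ser1); apply: peak_algebra1.
by rewrite big_cons; apply: peak_algebraD.
Qed.

Lemma cdspan_peak N f : cdspan N f -> peak_algebra (Lmap N f).
Proof.
elim=> {f} [ws <-|f g _ IHf _ IHg|a f _ IH|f g _ IH E].
- rewrite -Theta_Lmap; exists 0, [:: ws], (fun=> 1).
  by rewrite scale0r add0r big_seq1 scale1r.
- rewrite (_ : Lmap N _ = Lmap N f + Lmap N g); first exact: peak_algebraD.
  by rewrite /Lmap -big_split; apply: eq_bigr => w _; rewrite scalerDl.
- rewrite (_ : Lmap N _ = a *: Lmap N f); first exact: peak_algebraZ.
  by rewrite /Lmap scaler_sumr; apply: eq_bigr => w _; rewrite scalerA.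
rewrite (_ : Lmap N g = Lmap N f) //.
by apply: eq_bigr => w _; rewrite E ?size_tuple.
Qed.

End PeakAlgebra.

Section PeakComponents.
Variables (W : groupType) (S : set W) (lt : rel W) (H : algType laurent) (T : W -> H).
Hypotheses (hWS : coxeter_system S) (hlt : reflection_order S lt).
Hypothesis hHT : hecke_algebra S T.
Implicit Types (u v : W) (m : {cmonom nat}).

Definition Fpart n u v : pseries :=
  fun m => if mdeg m == n then Ftilde S T u v m else 0.

Lemma Fpart_homogeneous n u v : homogeneous n (Fpart n u v).
Proof. by move=> m; rewrite /Fpart; have [//|_] := eqVneq (mdeg m) n; rewrite eqxx. Qed.

Lemma pseries_sumE (I : Type) (r : seq I) (F : I -> pseries) m :
  (\sum_(i <- r) F i) m = \sum_(i <- r) F i m.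
Proof. by elim: r => [|i r IH]; rewrite ?big_nil // !big_cons -IH. Qed.

Lemma Fpart_Lmap N u v :
  Fpart N.+1 u v = Lmap N (fun w => (descent_count S lt u v w)%:R).
Proof.
apply/funext => m; rewrite /Fpart /Lmap pseries_sumE.
under eq_bigr do rewrite pscaleE L_coef.
case: eqP => [mN|mN]; last first.
  rewrite big1 // => w _; case: asboolP => [|]; last by rewrite mulr0.
  by move/refines_sumn; rewrite sumn_mcomp sumn_comp_of_word size_tuple.
rewrite (Ftilde_coef hWS hlt hHT) (c_refines lt hWS); last exact: mcomp_composition.
rewrite sumn_mcomp mN natr_sum.
transitivity (\sum_(w : N.-tuple bool) \sum_(p <- paths S N.+1 u v)
    (des lt u p == w)%:R * (`[< refines (mcomp m) (comp_of_word w) >])%:R : rat).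
  rewrite exchange_big; apply: eq_big_seq => p /(pathsP hWS)[_ sz].
  have sd : size (des lt u p) == N by rewrite size_des sz.
  rewrite (bigD1 (Tuple sd)) //= eqxx mul1r big1 ?addr0 => [|w ne].
    by case: p sz sd => [|x p].
  by rewrite (_ : (des lt u p == w) = false) ?mul0r //; apply: contraNF ne => /eqP E;
    apply/eqP/val_inj.
apply: eq_bigr => w _; rewrite /descent_count size_tuple count_sum natr_sum mulr_suml.
by apply: eq_bigr.
Qed.

(** Degree 0 is a multiple of 1 and treated apart, since [Lmap] starts in degree 1. *)
Lemma Fpart_peak n u v : peak_part n (Fpart n u v).
Proof.
split; last exact: Fpart_homogeneous.
case: n => [|N]; last by rewrite Fpart_Lmap; apply/cdspan_peak/(psi_cdspan hWS hlt hHT).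
rewrite (_ : Fpart 0 u v = Ftilde S T u v mone *: ser1); first exact: peak_algebra1.
apply/funext => m; rewrite pscaleE ser1_coef /Fpart mdeg_eq0.
by case: eqP => [->|_]; rewrite ?mulr1 ?mulr0.
Qed.

(** A nonzero coefficient comes from a path of length [mdeg m]. Each edge raises the length by an
    odd amount, as reflections are odd. *)
Lemma Ftilde_degree u v m : bruhat_le S u v -> Ftilde S T u v m != 0 ->
  (mdeg m <= len2 S u v)%N /\ ~~ odd (len2 S u v - mdeg m).
Proof.
move=> uv; rewrite (Ftilde_coef hWS hlt hHT) Num.Theory.pnatr_eq0.
rewrite (c_count lt hWS); last exact: mcomp_composition.
rewrite -lt0n -has_count sumn_mcomp => /hasP[p /(pathsP hWS)[pp <-] _].
have le := bruhat_path_len pp; have od := bruhat_path_odd hWS pp.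
have uvl := bruhat_le_len uv.
rewrite /len2; split; first by lia.
by rewrite oddB ?oddB // ?od; [case: (odd _) (odd _) => [] [] | lia].
Qed.

Lemma Ftilde_decomposition u v : bruhat_le S u v ->
  Ftilde S T u v = \sum_(j < (len2 S u v)./2.+1) Fpart (len2 S u v - j.*2)%N u v.
Proof.
move=> uv; apply/funext => m; rewrite pseries_sumE /Fpart.
have [F0|F0] := eqVneq (Ftilde S T u v m) 0.
  by rewrite F0 big1 // => j _; rewrite if_same.
have [le ev] := Ftilde_degree uv F0; set l := len2 S u v in le ev *.
have dE : (l - mdeg m)./2.*2 = (l - mdeg m)%N by rewrite even_halfK.
have jl : ((l - mdeg m)./2 < l./2.+1)%N by rewrite ltnS half_leq // leq_subr.
rewrite (bigD1 (Ordinal jl)) //= dE subKn // eqxx big1 ?addr0 // => j ne.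
have jl' := ltn_ord j; have := odd_double_half l.
rewrite ifF //; apply: contraNF ne => /eqP E; apply/eqP/val_inj => /=.
by rewrite E subKn ?doubleK //; lia.
Qed.

End PeakComponents.

Theorem theorem2p2 (W : groupType) (S : set W) (H : algType laurent) (T : W -> H)
    (lt : rel W) (u v : W)
    (hWS : coxeter_system S)
    (hHT : hecke_algebra S T)
    (hlt : reflection_order S lt)
    (huv : bruhat_le S u v) :
  [/\ Ftilde S T u v =
        ser_sum [set al | composition al] (fun al => (c_ S lt u v al)%:R *: M_ al),
      Ftilde S T u v =
        ser_sum [set al | composition al] (fun al => (b_ S lt u v al)%:R *: L_ al),
      peak_algebra (Ftilde S T u v) &
      exists g : nat -> pseries,
        (forall j, (j.*2 <= len2 S u v)%N -> peak_part (len2 S u v - j.*2) (g j)) /\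
        Ftilde S T u v = \sum_(j < (len2 S u v)./2.+1) g j].
Proof.
have peak n : peak_part n (Fpart S T n u v) := Fpart_peak hWS hlt hHT n u v.
have dec := Ftilde_decomposition hWS hlt hHT huv.
split.
- by apply/funext => m; rewrite (Ftilde_coef hWS hlt hHT) c_expansion.
- by apply/funext => m; rewrite (Ftilde_coef hWS hlt hHT) b_expansion.
- by rewrite dec; apply: peak_algebra_sum => j; case: (peak (len2 S u v - j.*2)%N).
by exists (fun j => Fpart S T (len2 S u v - j.*2)%N u v).
Qed.
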